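(* Let $\alpha\in(0,1/2)$ be irrational, let $\mathsf f$ be an orientation-preserving $C^\infty$-diffeomorphism of $\mathbb T$ with rotation number $2\alpha$, let $M=\pi_\omega(\mathbb A_{2\alpha})''$ be the von Neumann algebra of the associated state $\omega$ on the noncommutative torus $\mathbb A_{2\alpha}$, and for $x\in L^1_0(M)=M_*$ let $\widehat x$ be the double sequence of its Fourier coefficients. Then $\widehat x\in c_0(\mathbb Z^2)$ for every $x\in L^1_0(M)$, i.e. $\widehat{L^1_0(M)}\subset c_0(\mathbb Z^2)$, with $\|\widehat x\|_{c_0}\le\|x\|_{L^1}$. In addition, if $\widehat x=0$ then $x=0$.
   Context: Setting. $\mathbb T=\{z\in\mathbb C:|z|=1\}$ with normalised Haar measure $m$; $R_\theta(z)=e^{2\pi i\theta}z$. Let $\alpha\in(0,1/2)$ be irrational and let $\mathsf f:\mathbb T\to\mathbb T$ be an orientation-preserving $C^\infty$-diffeomorphism with rotation number $2\alpha$. Let $h$ be the unique homeomorphism of $\mathbb T$ with $h(1)=1$ and $\mathsf f=h\circ R_{2\alpha}\circ h^{-1}$. $\mathsf f^n$ ($n\in\mathbb Z$) denotes iterates. $\mathbb A_{2\alpha}$ is the universal unital $C^*$-algebra generated by unitaries $U,V$ with $UV=e^{4\pi i\alpha}VU$. State and representation. $\omega$ is the state on $\mathbb A_{2\alpha}$ with $\omega(U^mV^n)=\delta_{n,0}\int_{\mathbb T}h^{-1}(z)^m\,dm(z)$. Its GNS triple is: $\mathcal H_\omega=\ell^2(\mathbb Z;L^2(\mathbb T,m))$,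 $(\pi_\omega(U)g)_n(z)=h^{-1}(\mathsf f^n(z))\,g_n(z)$, $(\pi_\omega(V)g)_n=g_{n-1}$, $(\xi_\omega)_n(z)=\delta_{n,0}$. Put $M=\pi_\omega(\mathbb A_{2\alpha})''$; $\xi_\omega$ is cyclic and separating for $M$, and $\omega$ also denotes the vector state $\langle\,\cdot\,\xi_\omega,\xi_\omega\rangle$ on $M$. Characters. For $k,l\in\mathbb Z$, $u_{kl}=\pi_\omega(V^k\,h^l(U))$ (with $h^l(U)$ given by continuous functional calculus of $U$ for the function $z\mapsto h(z)^l$), i.e. the unitary in $M$ given by $(u_{kl}g)_n(z)=\mathsf f^{\,n-k}(z)^l\,g_{n-k}(z)$. Fourier coefficients. For $a\in M$ let $L_a=\omega(\,\cdot\,a)\in M_*$. $L^1_0(M)$ is $M_*$ with its usual norm. For $x=L_a$, $\widehat x(k,l):=\omega(u_{kl}^*a)$; this extends by continuity to all $x\in M_*$ (the $L_a$ being norm dense), so that $\widehat x(k,l)=x(u_{kl}^* )$, $k,l\in\mathbb Z$. *)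

(* Defs.v *)
From HB Require Import structures.
From mathcomp Require Import all_boot all_order all_algebra.
From mathcomp Require Import all_classical all_reals all_analysis.
From mathcomp Require Import measurable_realfun.
From mathcomp Require Import complex ring lra.

Set Implicit Arguments.
Unset Strict Implicit.
Unset Printing Implicit Defensive.

Import Order.TTheory GRing.Theory Num.Theory numFieldNormedType.Exports.

(* The carrier of all statements is an arbitrary realType R, and R[i] are the
   complex numbers over it; cabs is the modulus with values in R. *)

Local Open Scope classical_set_scope.
Local Open Scope complex_scope.
Local Open Scope ring_scope.
Local Open Scope quotient_scope.

HB.instance Definition _ (R : realType) := NormedModule.copy R[i] R[i]^o.

Notation cabs := ComplexField.Normc.normc.

Section Circle.
Variable R : realType.

Definition circle : Type := [set z : R[i] | `|z| = 1].
HB.instance Definition _ := Topological.on circle.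

Definition circle_val (z : circle) : R[i] := set_val z.

Lemma cexp_subproof (t : R) :
  cos (2 * pi * t) +i* sin (2 * pi * t) \in [set z : R[i] | `|z| = 1].
Proof. by rewrite inE /= normc_def /= cos2Dsin2 sqrtr1. Qed.

(* cexp t = e^(2 pi i t) *)
Definition cexp (t : R) : circle := SigSub (cexp_subproof t).

HB.instance Definition _ := isPointed.Build circle (cexp 0).

Lemma norm_circle (z : circle) : `|circle_val z| = 1.
Proof. by have := set_mem (valP z). Qed.

Lemma cmul_subproof (z w : circle) :
  circle_val z * circle_val w \in [set z : R[i] | `|z| = 1].
Proof. by rewrite inE /= normrM !norm_circle mulr1. Qed.

Definition cmul (z w : circle) : circle := SigSub (cmul_subproof z w).

Definition rotation (theta : R) (z : circle) : circle := cmul (cexp theta) z.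

HB.instance Definition _ := @isMeasurable.Build
  (sigma_display (@open circle)) circle <<s @open circle >>
  (@sigma_algebra0 _ _ _) (@sigma_algebraC _ _) (@sigma_algebra_bigcup _ _ _).

Lemma continuous_real_complex : continuous (fun x : R => x%:C).
Proof.
move=> x; apply/cvgrPdist_lt => -[e i] /=; rewrite ltcE /= => /andP[/eqP -> e0].
move/cvgrPdist_lt: (@cvg_id _ (nbhs x)) => /(_ e e0); apply: filterS => y /=.
by rewrite -rmorphB /= normc_def /= expr0n addr0 sqrtr_sqr ltcR.
Qed.

Lemma continuous_cexp : continuous cexp.
Proof.
move=> t; apply: (@continuous_comp_initial _ _ _ set_val) => {}t.
have lin : {for t, continuous (fun s : R => 2 * pi * s)} by exact: mulrl_continuous.
rewrite (_ : _ \o _ = fun s => (cos (2 * pi * s))%:C + 'i%C * (sin (2 * pi * s))%:C).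
  apply: cvgD; last (apply: cvgM; first exact: cvg_cst).
  - apply: (@continuous_comp _ _ _ (fun s => cos (2 * pi * s)) _ t).
      exact: (continuous_comp lin (@continuous_cos _ _)).
    exact: continuous_real_complex.
  - apply: (@continuous_comp _ _ _ (fun s => sin (2 * pi * s)) _ t).
      exact: (continuous_comp lin (@continuous_sin _ _)).
    exact: continuous_real_complex.
by apply/funext => s /=; rewrite [LHS]complexE.
Qed.

Lemma measurable_cexp : measurable_fun setT cexp.
Proof.
apply: (@measurability _ _ _ _ setT cexp (@open circle)) => //.
move=> _ [B oB <-]; rewrite setTI.
by apply: open_measurable; apply: open_comp => // x _; exact: continuous_cexp.
Qed.

(* The normalised Haar measure is the law of cexp t for t uniform in [0, 1[. *)
Definition haar : set circle -> \bar R :=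
  pushforward (mrestr lebesgue_measure
    (measurable_itv (`[0, 1[ : interval R))) cexp.

HB.instance Definition _ := Measure.copy haar
  (measure_function_pushforward__canonical__measure_function_Measure
    (mrestr lebesgue_measure (measurable_itv (`[0, 1[ : interval R)))
    measurable_cexp).

Lemma haar_setT : haar setT = 1%E.
Proof.
rewrite /haar /pushforward /mrestr preimage_setT setTI.
by rewrite lebesgue_measure_itv /= lte01 oppr0 adde0.
Qed.

HB.instance Definition _ := Measure_isProbability.Build _ _ _ haar haar_setT.

End Circle.

Section Hilbert.
Variable R : realType.
Local Notation T := (circle R).
Local Notation haar := (@haar R).

Definition cmeasurable (phi : T -> R[i]) : Prop :=
  measurable_fun setT (fun z => complex.Re (phi z)) /\
  measurable_fun setT (fun z => complex.Im (phi z)).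

Definition cintegral (phi : T -> R[i]) : R[i] :=
  (\int[haar]_z complex.Re (phi z)) +i* (\int[haar]_z complex.Im (phi z)).

Definition sqint : {pred int -> T -> R[i]} :=
  mem [set g | (forall n, cmeasurable (g n)) /\
    (\esum_(n in [set: int]) \int[haar]_z (cabs (g n z) ^+ 2)%:E < +oo)%E].

Lemma cabs_sqr (z : R[i]) : cabs z ^+ 2 = complex.Re z ^+ 2 + complex.Im z ^+ 2.
Proof. by case: z => a b /=; rewrite sqr_sqrtr // addr_ge0 ?sqr_ge0. Qed.

Lemma cabs_sqrM (z w : R[i]) : cabs (z * w) ^+ 2 = cabs z ^+ 2 * cabs w ^+ 2.
Proof. by rewrite !cabs_sqr; case: z w => [a b] [c d] /=; ring. Qed.

Lemma cabs_sqrD (z w : R[i]) :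
  cabs (z + w) ^+ 2 <= 2 * cabs z ^+ 2 + 2 * cabs w ^+ 2.
Proof.
rewrite !cabs_sqr; case: z w => [a b] [c d] /=.
by have := sqr_ge0 (a - c); have := sqr_ge0 (b - d); nra.
Qed.

Lemma measurable_cabs_sqr (phi : T -> R[i]) : cmeasurable phi ->
  measurable_fun setT (fun z => cabs (phi z) ^+ 2).
Proof.
move=> [mr mi]; under eq_fun do rewrite cabs_sqr.
by apply: measurable_funD; exact: measurable_funX.
Qed.

Lemma cmeasurable_lin (a : R[i]) (phi psi : T -> R[i]) :
  cmeasurable phi -> cmeasurable psi ->
  cmeasurable (fun z => a * phi z + psi z).
Proof.
case: a => a b [mr mi] [nr ni]; split.
- rewrite (_ : (fun z => _) = (fun z => a * complex.Re (phi z)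
    - b * complex.Im (phi z) + complex.Re (psi z))); last first.
    by apply/funext => z; case: (phi z) (psi z) => [? ?] [? ?].
  by apply: measurable_funD => //; apply: measurable_funB;
    apply: measurable_funM.
- rewrite (_ : (fun z => _) = (fun z => a * complex.Im (phi z)
    + b * complex.Re (phi z) + complex.Im (psi z))); last first.
    by apply/funext => z; case: (phi z) (psi z) => [? ?] [? ?] /=.
  by apply: measurable_funD => //; apply: measurable_funD;
    apply: measurable_funM.
Qed.

Lemma le_esumZl (c : R) (a : int -> \bar R) : 0 <= c -> (forall n, 0 <= a n)%E ->
  (\esum_(n in [set: int]) (c%:E * a n) <= c%:E * \esum_(n in [set: int]) a n)%E.
Proof.
move=> c0 a0; apply: ge_ereal_sup => _ [F [finF _] <-].
rewrite -ge0_mule_fsumr //; apply: lee_wpmul2l; first by rewrite lee_fin.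
by apply: esum_ge; exists F.
Qed.

Lemma sqint_submod_closed : submod_closed sqint.
Proof.
split.
  rewrite inE /=; split.
    by move=> n; split; exact: measurable_cst.
  rewrite esum1 ?ltry // => n _.
  by rewrite integral0_eq // => z _; rewrite !expr0n addr0 sqrtr0 expr0n.
move=> a u v; rewrite !inE /= => -[mu fu] [mv fv].
have muv n : cmeasurable ((a *: u + v) n) by exact: cmeasurable_lin.
split=> //.
have ge2a : (0 <= (2 * cabs a ^+ 2)%:E)%E.
  by rewrite lee_fin pmulr_rge0 // sqr_ge0.
pose I (g : int -> T -> R[i]) n := (\int[haar]_z (cabs (g n z) ^+ 2)%:E)%E.
have I0 g n : (0 <= I g n)%E by apply: integral_ge0 => z _; rewrite lee_fin sqr_ge0.
apply: (@le_lt_trans _ _ (\esum_(n in [set: int])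
  (((2 * cabs a ^+ 2)%:E * I u n) + 2%:E * I v n))%E).
  apply: le_esum => n _.
  rewrite -!ge0_integralZl //=; last 4 first.
  - by apply/measurable_EFinP; exact: measurable_cabs_sqr.
  - by move=> z _; rewrite lee_fin sqr_ge0.
  - by apply/measurable_EFinP; exact: measurable_cabs_sqr.
  - by move=> z _; rewrite lee_fin sqr_ge0.
  rewrite -ge0_integralD //=; last 4 first.
  - by move=> z _; apply: mule_ge0 => //; rewrite lee_fin sqr_ge0.
  - apply/measurable_EFinP; apply: measurable_funM => //.
    exact: measurable_cabs_sqr.
  - by move=> z _; apply: mule_ge0 => //; rewrite lee_fin sqr_ge0.
  - apply/measurable_EFinP; apply: measurable_funM => //.
    exact: measurable_cabs_sqr.
  apply: ge0_le_integral => //=.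
  - by move=> z _; rewrite lee_fin sqr_ge0.
  - by apply/measurable_EFinP; exact: measurable_cabs_sqr.
  - apply/measurable_EFinP; apply: measurable_funD;
      by apply: measurable_funM => //; exact: measurable_cabs_sqr.
  - move=> z _; rewrite -!EFinM -EFinD lee_fin -mulrA -cabs_sqrM; exact: cabs_sqrD.
rewrite esumD; last 2 first.
- by move=> n _; rewrite mule_ge0.
- by move=> n _; rewrite mule_ge0.
apply: lte_add_pinfty; (apply: le_lt_trans; first by
  apply: le_esumZl => //; rewrite -lee_fin);
  by rewrite lte_mul_pinfty.
Qed.

HB.instance Definition _ :=
  GRing.isSubmodClosed.Build _ _ sqint sqint_submod_closed.

Record l2fun := L2fun { l2val :> int -> T -> R[i] ; _ : l2val \in sqint }.
HB.instance Definition _ := [isSub for l2val].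
HB.instance Definition _ := [Choice of l2fun by <:].
HB.instance Definition _ := [SubChoice_isSubLmodule of l2fun by <:].

Definition l2null : {pred l2fun} :=
  mem [set g : l2fun | forall n, {ae haar, forall z, g n z = 0}].

Lemma l2null_zmod_closed : zmod_closed l2null.
Proof.
split; first by rewrite inE /= => n; apply: aeW.
move=> u v; rewrite !inE /= => u0 v0 n.
apply: filterS2 (u0 n) (v0 n) => z uz vz.
by rewrite [LHS](_ : _ = u n z - v n z) // uz vz subr0.
Qed.

HB.instance Definition _ := GRing.isZmodClosed.Build _ l2null l2null_zmod_closed.

Definition Hspace : Type := Quotient.quot l2null.
HB.instance Definition _ := GRing.Zmodule.on Hspace.

Definition hclass (g : l2fun) : Hspace := \pi_(Quotient.quot l2null) g.
Definition hrepr (x : Hspace) : l2fun := repr x.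

Lemma hreprK : cancel hrepr hclass. Proof. exact: reprK. Qed.

Lemma hclassP (u v : l2fun) :
  reflect (forall n, {ae haar, forall z, u n z = v n z}) (hclass u == hclass v).
Proof.
rewrite /hclass -Quotient.idealrBE; apply: (iffP idP); rewrite inE /= => uv n.
  apply: filterS (uv n) => z; rewrite [LHS](_ : _ = u n z - v n z) //.
  by move/eqP; rewrite subr_eq0 => /eqP.
by apply: filterS (uv n) => z uvz;
  rewrite [LHS](_ : _ = u n z - v n z) // uvz subrr.
Qed.

Lemma hclassD (u v : l2fun) : hclass (u + v) = hclass u + hclass v.
Proof. exact: (raddfD (\pi_(Quotient.quot l2null))). Qed.

Definition hscale (c : R[i]) (x : Hspace) : Hspace := hclass (c *: hrepr x).

Lemma hscale_class c (u : l2fun) : hscale c (hclass u) = hclass (c *: u).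
Proof.
apply/eqP/hclassP => n.
have /hclassP/(_ n) : hclass (hrepr (hclass u)) == hclass u by rewrite hreprK.
apply: filterS => z e.
by rewrite [LHS](_ : _ = c *: hrepr (hclass u) n z) // e.
Qed.

Lemma hscaleA a b x : hscale a (hscale b x) = hscale (a * b) x.
Proof. by rewrite -[x]hreprK !hscale_class scalerA. Qed.

Lemma hscale1 : left_id 1 hscale.
Proof. by move=> x; rewrite -[x]hreprK hscale_class scale1r. Qed.

Lemma hscaleDr : right_distributive hscale +%R.
Proof.
move=> a x y; rewrite -[x]hreprK -[y]hreprK -hclassD !hscale_class.
by rewrite scalerDr hclassD.
Qed.

Lemma hscaleDl x : {morph hscale^~ x : a b / a + b}.
Proof.
by move=> a b; rewrite -[x]hreprK !hscale_class scalerDl hclassD.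
Qed.

HB.instance Definition _ := GRing.Zmodule_isLmodule.Build R[i] Hspace
  hscaleA hscale1 hscaleDr hscaleDl.

(* The class of g in l^2(Z; L^2(T)), with the junk value 0 when g is not
   square integrable. *)
Definition hmk (g : int -> T -> R[i]) : Hspace := hclass (insubd 0 g).

(* Symmetric partial sums; only used for absolutely summable families. *)
Definition zsum (u : int -> R[i]) : R[i] :=
  limn (fun N : nat => \sum_(i < N.*2.+1) u (i%:Z - N%:Z)).

(* Linear in the first argument. *)
Definition hdot (x y : Hspace) : R[i] :=
  zsum (fun n => cintegral (fun z => hrepr x n z * (hrepr y n z)^*)).

Definition hnorm (x : Hspace) : R := Num.sqrt (complex.Re (hdot x x)).

End Hilbert.

Section CircleMaps.
Variable R : realType.
Local Notation T := (circle R).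

Definition is_lift (F : R -> R) (f : T -> T) : Prop :=
  continuous F /\ forall t, f (cexp t) = cexp (F t).

Definition smooth (F : R -> R) : Prop :=
  forall (n : nat) (t : R), derivable (derive1n n F) t 1.

(* f is C^oo in the local coordinates t |-> cexp t of the circle *)
Definition circle_smooth (f : T -> T) : Prop :=
  exists2 F, is_lift F f & smooth F.

Definition orientation_preserving (f : T -> T) : Prop :=
  exists2 F, is_lift F f & {homo F : s t / s < t}.

Definition smooth_diffeo (f : T -> T) : Prop :=
  [/\ bijective f, circle_smooth f & circle_smooth (pinv setT f)].

Definition circle_homeo (h : T -> T) : Prop :=
  [/\ bijective h, continuous h & continuous (pinv setT h)].

(* The rotation number is defined modulo 1: changing the lift F by an integer
   changes the limit by that integer. *)
Definition has_rotation_number (f : T -> T) (rho : R) : Prop :=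
  exists2 F, is_lift F f &
    forall t, (iter n F t - t) / n%:R @[n --> \oo] --> rho.

Definition ziter (f : T -> T) (n : int) : T -> T :=
  match n with
  | Posz k => iter k f
  | Negz k => iter k.+1 (pinv setT f)
  end.

End CircleMaps.

Section CstarAlgebras.
Variable R : realType.

Definition seq_lim (A : zmodType) (nrm : A -> R) (u : nat -> A) (l : A) : Prop :=
  forall e : R, 0 < e -> exists N, forall n, (N <= n)%N -> nrm (u n - l) < e.

Record is_cstar (A : algType R[i]) (star : A -> A) (nrm : A -> R) : Prop := {
  star_conj_linear : forall c a b, star (c *: a + b) = c^* *: star a + star b ;
  star_anti_mul : forall a b, star (a * b) = star b * star a ;
  star_involutive : involutive star ;
  cnorm_eq0 : forall a, nrm a = 0 -> a = 0 ;
  cnorm_triangle : forall a b, nrm (a + b) <= nrm a + nrm b ;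
  cnorm_scale : forall c a, nrm (c *: a) = cabs c * nrm a ;
  cnorm_mul : forall a b, nrm (a * b) <= nrm a * nrm b ;
  cnorm_star : forall a, nrm (star a * a) = nrm a ^+ 2 ;
  cnorm_complete : forall u : nat -> A,
    (forall e : R, 0 < e -> exists N, forall m n,
      (N <= m)%N -> (N <= n)%N -> nrm (u m - u n) < e) ->
    exists l, seq_lim nrm u l
}.

(* Unital complex C*-algebras; an algType is a nonzero ring. *)
Record cstar_algebra : Type := CstarAlgebra {
  cstar_carrier :> algType R[i] ;
  star : cstar_carrier -> cstar_carrier ;
  cnorm : cstar_carrier -> R ;
  cstarP : is_cstar star cnorm
}.

Definition unital_star_hom (A B : cstar_algebra) (phi : A -> B) : Prop :=
  [/\ linear phi, phi 1 = 1, {morph phi : a b / a * b}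
    & forall a, phi (star a) = star (phi a)].

Definition cstar_subalgebra (A : cstar_algebra) (S : set A) : Prop :=
  [/\ S 1, (forall c a b, S a -> S b -> S (c *: a + b)),
    (forall a b, S a -> S b -> S (a * b)), (forall a, S a -> S (star a))
    & forall (u : nat -> A) l,
        (forall n, S (u n)) -> seq_lim (@cnorm A) u l -> S l].

Definition cstar_generated_by (A : cstar_algebra) (G : set A) : Prop :=
  forall S, cstar_subalgebra S -> G `<=` S -> forall a, S a.

Definition unitary (A : cstar_algebra) (u : A) : Prop :=
  star u * u = 1 /\ u * star u = 1.

Definition rotation_pair (A : cstar_algebra) (theta : R) (u v : A) : Prop :=
  [/\ unitary u, unitary v & u * v = circle_val (cexp theta) *: (v * u)].

(* A is the universal unital C*-algebra generated by unitaries U, V with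
   U V = e^(2 pi i theta) V U *)
Definition noncommutative_torus (theta : R) (A : cstar_algebra) (U V : A) :
    Prop :=
  [/\ rotation_pair theta U V, cstar_generated_by [set U; V]
    & forall (B : cstar_algebra) (u v : B), rotation_pair theta u v ->
      exists phi : A -> B, [/\ unital_star_hom phi, phi U = u & phi V = v]].

Definition zpow (A : cstar_algebra) (u : A) (n : int) : A :=
  match n with
  | Posz k => u ^+ k
  | Negz k => star u ^+ k.+1
  end.

Definition is_state (A : cstar_algebra) (omega : A -> R[i]) : Prop :=
  [/\ (forall c a b, omega (c *: a + b) = c * omega a + omega b),
    (forall a, 0 <= omega (star a * a)) & omega 1 = 1].

End CstarAlgebras.

Section Operators.
Variable R : realType.
Local Notation T := (circle R).
Local Notation H := (Hspace R).

Definition bounded_operator (a : H -> H) : Prop :=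
  linear a /\ exists K : R, forall x, hnorm (a x) <= K * hnorm x.

Definition opnorm (a : H -> H) : \bar R :=
  ereal_sup [set (hnorm (a x))%:E | x in [set x | hnorm x <= 1]].

Definition is_adjoint (a b : H -> H) : Prop :=
  forall x y, hdot (a x) y = hdot x (b y).

Definition adjoint (a : H -> H) : H -> H :=
  xget (0 : H -> H) [set b | bounded_operator b /\ is_adjoint a b].

Definition commutant (S : set (H -> H)) : set (H -> H) :=
  [set a | bounded_operator a /\ forall b, S b -> a \o b = b \o a].

Definition star_representation (A : cstar_algebra R) (pi_ : A -> H -> H) : Prop :=
  [/\ (forall a, bounded_operator (pi_ a)), linear pi_, pi_ 1 = id,
    (forall a b, pi_ (a * b) = pi_ a \o pi_ b)
    & forall a, is_adjoint (pi_ a) (pi_ (star a))].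

Definition is_gns (A : cstar_algebra R) (omega : A -> R[i])
    (pi_ : A -> H -> H) (xi : H) : Prop :=
  [/\ star_representation pi_,
    (forall a, omega a = hdot (pi_ a xi) xi)
    & forall x (e : R), 0 < e -> exists a, hnorm (pi_ a xi - x) < e].

Definition square_summable (xi : nat -> H) : Prop :=
  (\sum_(0 <= j <oo) (hnorm (xi j) ^+ 2)%:E < +oo)%E.

(* the seminorms that define the sigma-weak (ultraweak) topology of B(H) *)
Definition sigma_weak_seminorm (xi eta : nat -> H) (a : H -> H) : R :=
  cabs (limn (series (fun j => hdot (a (xi j)) (eta j)))).

Definition sigma_weakly_continuous (M : set (H -> H)) (x : (H -> H) -> R[i]) :
    Prop :=
  forall b, M b -> forall e : R, 0 < e ->
    exists (k : nat) (xi eta : 'I_k -> nat -> H),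
      (forall i, square_summable (xi i) /\ square_summable (eta i)) /\
      forall a, M a ->
        (forall i, sigma_weak_seminorm (xi i) (eta i) (a - b) < 1) ->
        cabs (x a - x b) < e.

(* The predual of the von Neumann algebra M: the sigma-weakly continuous linear
   functionals on M. Such a functional is represented by a function on all maps
   H -> H of which only the restriction to M is relevant. *)
Definition predual (M : set (H -> H)) (x : (H -> H) -> R[i]) : Prop :=
  (forall c a b, M a -> M b -> x (c *: a + b) = c * x a + x b) /\
  sigma_weakly_continuous M x.

Definition predual_norm (M : set (H -> H)) (x : (H -> H) -> R[i]) : \bar R :=
  ereal_sup [set (cabs (x a))%:E | a in [set a | M a /\ (opnorm a <= 1)%E]].

End Operators.

Section DoubleSequences.
Variable R : realType.

Definition c0 (y : int * int -> R[i]) : Prop :=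
  forall e : R, 0 < e -> finite_set [set kl | e <= cabs (y kl)].

Definition c0_norm (y : int * int -> R[i]) : \bar R :=
  ereal_sup (range (fun kl => (cabs (y kl))%:E)).

End DoubleSequences.

Section Representation.
Variable R : realType.
Local Notation T := (circle R).
Local Notation H := (Hspace R).
Variables f h : T -> T.

(* The maps to which hmk is applied below are square integrable as soon as
   f and h are homeomorphisms. *)

Definition opU (g : H) : H :=
  hmk (fun n z => circle_val (pinv setT h (ziter f n z)) * hrepr g n z).

Definition opV (g : H) : H := hmk (fun n z => hrepr g (n - 1) z).

Definition xi_omega : H := hmk (fun n _ => (n == 0)%:R).

Definition u_ (k l : int) (g : H) : H :=
  hmk (fun n z => circle_val (ziter f (n - k) z) ^ l * hrepr g (n - k) z).

Definition fourier (x : (H -> H) -> R[i]) (kl : int * int) : R[i] :=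
  x (adjoint (u_ kl.1 kl.2)).

End Representation.

(* Main.v *)
Require Import Defs.
From HB Require Import structures.
From mathcomp Require Import all_boot all_order all_algebra.
From mathcomp Require Import all_classical all_reals all_analysis.
From mathcomp Require Import complex.
From mathcomp Require Import measurable_realfun ring lra zify.

(** M contains every T_{k,b} = V^k b(h(U)) with b a bounded Borel function on the circle (u_kl is the
    case b(z) = z^l, and bounded pointwise limits reach the others), and its commutant contains
    Y_{m,phi} g = (phi g_{n-m} o f^m)_n.

    Since f^n distorts the Haar measure only by a bounded factor, the vectors
    u_kl (f^n(z)^j delta_n) = Y_{n,1} (z^{l+j} delta_k) are images of an orthonormal family under one
    bounded operator.  Bessel's inequality thus makes the adjoints of the u_kl tend weakly, hence sigma-weakly, to 0,
    so the coefficients of x vanish at infinity; they are bounded by the norm of x because the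
    u_kl are unitary.

    If all coefficients vanish, then x vanishes on every T_{k,b}.  For a in M, commutation with the
    Y_{m,phi} shows that the k-th diagonal of a is T_{k,b_k}, with b_k the k-th component of a applied
    to the cyclic vector.  The Fejer means (1/N) sum_{r,t<N} T_{r-t,b_{r-t}} are averages of
    compressions of a to windows of length N; they are therefore uniformly bounded and converge weakly
    to a, and x(a) = 0 follows. *)

Set Implicit Arguments.
Unset Strict Implicit.
Unset Printing Implicit Defensive.

Import Order.TTheory GRing.Theory Num.Theory numFieldNormedType.Exports.

Local Open Scope classical_set_scope.
Local Open Scope complex_scope.
Local Open Scope ring_scope.

(** * The Hilbert space l^2(Z; L^2(T)) *)

(** The conjugacy [h] may be singular, so Haar measure is never compared with its image under [h].
    It enters through Borel functions only: what commutes with [opU] commutes with every bounded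
    Borel function of it, in particular with those composed with [h], and this is how the operators
    built from [h(U)] reach the bicommutant. The distortion that has to be controlled is that of the
    iterates of [f]; a Lipschitz lift of the inverse diffeomorphism bounds it. A predual element is
    known through sigma-weak neighbourhoods, so each passage to the limit in [x] asks for a family
    that is uniformly bounded and weakly convergent. For the Fejer means uniform boundedness is the
    delicate half, since they are built from N^2 terms; the windows serve this purpose. That the
    [Yop] lie in the commutant of the represented algebra is checked on U and V and carried to norm
    limits. This requires norm continuity of representations, which is derived from the C*-axioms by
    an elementary square root. *)

Section ComplexLimits.
Variable R : realType.
Implicit Types (z w : R[i]) (u v : nat -> R[i]).

Lemma cabs_ge0 z : 0 <= cabs z.
Proof. by case: z => a b /=; exact: sqrtr_ge0. Qed.

Lemma normcE z : `|z| = (cabs z)%:C.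
Proof. by []. Qed.

Lemma cabs_eq0 z : cabs z = 0 -> z = 0.
Proof. exact: ComplexField.Normc.eq0_normc. Qed.

Lemma cabsM z w : cabs (z * w) = cabs z * cabs w.
Proof. exact: ComplexField.Normc.normcM. Qed.

Lemma cabsD z w : cabs (z + w) <= cabs z + cabs w.
Proof. by rewrite -lecR rmorphD /= -!normcE ler_normD. Qed.

Lemma cabsN z : cabs (- z) = cabs z.
Proof. by case: z => a b /=; rewrite !sqrrN. Qed.

Lemma cabsB z w : cabs (z - w) = cabs (w - z).
Proof. by rewrite -opprB cabsN. Qed.

Lemma cabsJ z : cabs z^* = cabs z.
Proof. by case: z => a b /=; rewrite sqrrN. Qed.

Lemma cabsR (r : R) : cabs r%:C = `|r|.
Proof. by rewrite /= expr0n addr0 sqrtr_sqr. Qed.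

Lemma cabs_Re z : `|complex.Re z| <= cabs z.
Proof. by case: z => a b /=; rewrite -sqrtr_sqr ler_wsqrtr// lerDl sqr_ge0. Qed.

Lemma cabs_Im z : `|complex.Im z| <= cabs z.
Proof. by case: z => a b /=; rewrite -sqrtr_sqr ler_wsqrtr// lerDr sqr_ge0. Qed.

Lemma cabs_ReIm z : cabs z <= `|complex.Re z| + `|complex.Im z|.
Proof.
case: z => a b /=; rewrite -(@ler_pXn2r _ 2%N) ?nnegrE ?sqrtr_ge0 ?addr_ge0//.
rewrite sqr_sqrtr ?addr_ge0 ?sqr_ge0// sqrrD !real_normK ?num_real//.
by rewrite addrAC lerDl mulrn_wge0// mulr_ge0.
Qed.

Lemma cvg_complexP (I : Type) (F : set_system I) {FF : Filter F} (u : I -> R[i]) (l : R[i]) :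
  u @ F --> l <-> (forall e : R, 0 < e -> \forall n \near F, cabs (u n - l) < e).
Proof.
split=> [/cvgrPdist_lt ul e e0|ul].
  have := ul e%:C; rewrite ltcR => /(_ e0); apply: filterS => n.
  by rewrite normcE ltcR cabsB.
apply/cvgrPdist_lt => -[e i] /=; rewrite ltcE /= => /andP[/eqP -> e0].
by move: (ul e e0); apply: filterS => n; rewrite -ltcR -normcE distrC.
Qed.

Lemma cvg_realP (I : Type) (F : set_system I) {FF : Filter F} (u : I -> R) (l : R) :
  u @ F --> l <-> (forall e : R, 0 < e -> \forall n \near F, `|u n - l| < e).
Proof.
split=> [/cvgrPdist_lt ul e e0|ul].
  by apply: filterS (ul e e0) => n; rewrite distrC.
by apply/cvgrPdist_lt => e e0; apply: filterS (ul e e0) => n; rewrite distrC.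
Qed.

Lemma cvg_Re (I : Type) (F : set_system I) {FF : Filter F} (u : I -> R[i]) (l : R[i]) :
  u @ F --> l -> complex.Re (u n) @[n --> F] --> complex.Re l.
Proof.
move=> /cvg_complexP ul; apply/cvg_realP => e e0; apply: filterS (ul e e0) => n.
apply: le_lt_trans; rewrite (_ : _ - _ = complex.Re (u n - l)) ?cabs_Re//.
by clear; case: (u n) l => [? ?] [].
Qed.

Lemma cvg_Im (I : Type) (F : set_system I) {FF : Filter F} (u : I -> R[i]) (l : R[i]) :
  u @ F --> l -> complex.Im (u n) @[n --> F] --> complex.Im l.
Proof.
move=> /cvg_complexP ul; apply/cvg_realP => e e0; apply: filterS (ul e e0) => n.
apply: le_lt_trans; rewrite (_ : _ - _ = complex.Im (u n - l)) ?cabs_Im//.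
by clear; case: (u n) l => [? ?] [].
Qed.

Lemma cvg_ReIm (I : Type) (F : set_system I) {FF : Filter F} (u : I -> R[i]) (a b : R) :
  complex.Re (u n) @[n --> F] --> a -> complex.Im (u n) @[n --> F] --> b ->
  u @ F --> a +i* b.
Proof.
move=> /cvg_realP ua /cvg_realP ub; apply/cvg_complexP => e e0.
have e2 : 0 < e / 2 by rewrite divr_gt0.
apply: filterS2 (ua _ e2) (ub _ e2) => n una unb.
apply: le_lt_trans (cabs_ReIm _) _; rewrite (splitr e).
by case: (u n) una unb => c d /= ? ?; exact: ltrD.
Qed.

End ComplexLimits.

(** * Sums over the integers as limits of symmetric partial sums *)

Section SymmetricSums.
Variable R : realType.

Definition symsum (V : nmodType) (u : int -> V) (N : nat) : V :=
  \sum_(i < N.*2.+1) u (i%:Z - N%:Z).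

Lemma symsum_seq (V : nmodType) (u : int -> V) N :
  symsum u N = \sum_(k <- [seq i%:Z - N%:Z | i <- iota 0 N.*2.+1]) u k.
Proof. by rewrite /symsum -(big_mkord xpredT (fun i => u (i%:Z - N%:Z))) /index_iota subn0 big_map. Qed.

Lemma mem_window N (k : int) :
  (k \in [seq i%:Z - N%:Z | i <- iota 0 N.*2.+1]) = (`|k| <= N)%N.
Proof.
apply/mapP/idP => [ [j]|kN]; first by rewrite mem_iota => jN ->; lia.
by exists `|(k + N%:Z)%R|%N; rewrite ?mem_iota; lia.
Qed.

Lemma uniq_window N : uniq [seq i%:Z - N%:Z | i <- iota 0 N.*2.+1].
Proof. by rewrite map_inj_uniq ?iota_uniq// => i j; lia. Qed.

Lemma ge_esum_seq (T : choiceType) (s : seq T) (a : T -> \bar R) :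
  uniq s -> (\sum_(k <- s) a k <= \esum_(k in [set: T]) a k)%E.
Proof.
move=> us; apply: esum_ge; exists [set` s]; first by split=> //; exact: finite_seq.
by rewrite fsbig_seq.
Qed.

(** Bridges two summation conventions: [hdot] is a limit of symmetric sums, while square
    integrability is stated with [esum]. A finite set that nearly attains the supremum lies in some
    window, and larger windows only add nonnegative terms. *)
Lemma cvg_symsum_ge0 (s : int -> R) : (forall n, 0 <= s n) ->
  (\esum_(n in [set: int]) (s n)%:E < +oo)%E ->
  symsum s @ \oo --> fine (\esum_(n in [set: int]) (s n)%:E).
Proof.
move=> s0 sfin.
have E0 : (0 <= \esum_(n in [set: int]) (s n)%:E)%E.
  by apply: esum_ge0 => n _; rewrite lee_fin.
have Efin : (\esum_(n in [set: int]) (s n)%:E)%E \is a fin_num.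
  by rewrite ge0_fin_numE.
have leE (r : seq int) : uniq r ->
    \sum_(k <- r) s k <= fine (\esum_(n in [set: int]) (s n)%:E).
  move=> ur; rewrite -lee_fin fineK// -sumEFin; exact: ge_esum_seq.
apply/cvg_realP => e e0.
have [_ [X [finX _] <-]] := ub_ereal_sup_adherent e0 Efin.
rewrite -/(esum _ _) -{1}(fineK Efin) -EFinB => ltX.
have [r ur Xr] : exists2 r, uniq r & X = [set` r].
  have /finite_seqP[r ->] := finX; exists (undup r); rewrite ?undup_uniq//.
  by apply/seteqP; split => k /=; rewrite mem_undup.
have [/= M XM] : exists M : nat, forall k, k \in r -> (`|k| <= M)%N.
  exists (\max_(k <- r) `|k|%N) => k kX.
  exact: (@leq_bigmax_seq _ _ _ (fun k : int => `|k|%N)).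
near=> N.
have MN : (M <= N)%N by near: N; exists M.
have : fine (\esum_(n in [set: int]) (s n)%:E) - e < symsum s N.
  rewrite -lte_fin; apply: (lt_le_trans ltX).
  rewrite Xr -fsbig_seq// sumEFin lee_fin symsum_seq.
  set w := [seq _ | _ <- _].
  have -> : \sum_(k <- r) s k = \sum_(k <- [seq k <- w | k \in r]) s k.
    apply: perm_big; apply: uniq_perm => [||k]; rewrite ?filter_uniq ?uniq_window//.
    rewrite mem_filter mem_window.
    by case kX : (k \in r) => //=; rewrite (leq_trans (XM _ kX)).
  by rewrite big_filter [leRHS](bigID (mem r)) lerDl sumr_ge0.
have := leE _ (uniq_window N); rewrite -symsum_seq => h1 h2.
by rewrite ler0_norm ?subr_le0// opprB ltrBlDr addrC -ltrBlDr.
Unshelve. all: by end_near. Qed.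

(** Both [r + s] and [s] are nonnegative and summable, and [r] is their difference. *)
Lemma cvg_symsum_real (r s : int -> R) : (forall n, `|r n| <= s n) ->
  (\esum_(n in [set: int]) (s n)%:E < +oo)%E -> cvgn (symsum r).
Proof.
move=> rs sfin.
have s0 n : 0 <= s n by exact: le_trans (rs n).
have rs0 n : 0 <= r n + s n by have := rs n; rewrite ler_norml => /andP[]; lra.
have -> : symsum r = symsum (fun n => r n + s n) - symsum s.
  by apply/funext => N; rewrite /symsum fctE -sumrB; apply: eq_bigr => i _; rewrite addrK.
apply: is_cvgB; apply/cvg_ex; last by eexists; exact: cvg_symsum_ge0.
eexists; apply: cvg_symsum_ge0 => //.
apply: (@le_lt_trans _ _ (\esum_(n in [set: int]) ((s n)%:E + (s n)%:E))%E).
  apply: le_esum => n _; rewrite -EFinD lee_fin lerD2r.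
  exact: le_trans (ler_norm _) (rs n).
by rewrite esumD ?lte_add_pinfty// => n _; rewrite lee_fin.
Qed.

Lemma cvg_symsum (r : int -> R[i]) (s : int -> R) :
  (forall n, `|complex.Re (r n)| <= s n) -> (forall n, `|complex.Im (r n)| <= s n) ->
  (\esum_(n in [set: int]) (s n)%:E < +oo)%E -> cvgn (symsum r).
Proof.
move=> rs is_ sfin.
have ReS N : complex.Re (symsum r N) = symsum (fun n => complex.Re (r n)) N.
  by rewrite /symsum; elim/big_rec2: _ => //= i a b _ <-; case: (r _) b => [? ?] [].
have ImS N : complex.Im (symsum r N) = symsum (fun n => complex.Im (r n)) N.
  by rewrite /symsum; elim/big_rec2: _ => //= i a b _ <-; case: (r _) b => [? ?] [].
have /cvg_ex[a ra] := cvg_symsum_real rs sfin.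
have /cvg_ex[b rb] := cvg_symsum_real is_ sfin.
apply/cvg_ex; exists (a +i* b); apply: cvg_ReIm.
- by rewrite (_ : (fun n => _) = symsum (fun n => complex.Re (r n)))//; apply/funext.
- by rewrite (_ : (fun n => _) = symsum (fun n => complex.Im (r n)))//; apply/funext.
Qed.

End SymmetricSums.

(** * The inner product of L^2 of the circle, on functions *)

Section InnerProduct.
Variable R : realType.
Local Notation T := (circle R).
Local Notation haar := (@haar R).
Implicit Types (phi psi : T -> R[i]).

Definition nrm2 phi : \bar R := (\int[haar]_z (cabs (phi z) ^+ 2)%:E)%E.

Definition L2fun phi : Prop := cmeasurable phi /\ (nrm2 phi < +oo)%E.

Lemma nrm2_ge0 phi : (0 <= nrm2 phi)%E.
Proof. by apply: integral_ge0 => z _; rewrite lee_fin sqr_ge0. Qed.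

Lemma cmeasurableJ phi : cmeasurable phi -> cmeasurable (fun z => (phi z)^*).
Proof.
move=> [mr mi]; split.
  by rewrite (_ : (fun z => _) = fun z => complex.Re (phi z))//; apply/funext => z; case: (phi z).
rewrite (_ : (fun z => _) = fun z => - complex.Im (phi z)); last first.
  by apply/funext => z; case: (phi z).
exact: measurableT_comp.
Qed.

Lemma cmeasurableM phi psi :
  cmeasurable phi -> cmeasurable psi -> cmeasurable (fun z => phi z * psi z).
Proof.
move=> [mr mi] [nr ni]; split.
  rewrite (_ : (fun z => _) = (fun z => complex.Re (phi z) * complex.Re (psi z)
    - complex.Im (phi z) * complex.Im (psi z))).
    by apply: measurable_funB; apply: measurable_funM.
  by apply/funext => z; case: (phi z) (psi z) => [? ?] [? ?].
rewrite (_ : (fun z => _) = (fun z => complex.Re (phi z) * complex.Im (psi z)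
  + complex.Im (phi z) * complex.Re (psi z))).
  by apply: measurable_funD; apply: measurable_funM.
by apply/funext => z; case: (phi z) (psi z) => [? ?] [? ?].
Qed.

Lemma cmeasurable_cst (c : R[i]) : cmeasurable (fun _ : T => c).
Proof. by split; exact: measurable_cst. Qed.

Lemma cmeasurableZ c phi : cmeasurable phi -> cmeasurable (fun z => c * phi z).
Proof. by move=> mp; apply: cmeasurableM => //; exact: cmeasurable_cst. Qed.

Lemma L2_lin c phi psi : L2fun phi -> L2fun psi -> L2fun (fun z => c * phi z + psi z).
Proof.
move=> [mp fp] [mq fq]; split; first exact: cmeasurable_lin.
apply: (@le_lt_trans _ _ (\int[haar]_z ((2 * cabs c ^+ 2)%:E * (cabs (phi z) ^+ 2)%:E
    + 2%:E * (cabs (psi z) ^+ 2)%:E))%E).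
  apply: ge0_le_integral => //=.
  - by move=> z _; rewrite lee_fin sqr_ge0.
  - by apply/measurable_EFinP; apply: measurable_cabs_sqr; exact: cmeasurable_lin.
  - apply/measurable_EFinP; apply: measurable_funD;
      by apply: measurable_funM => //; exact: measurable_cabs_sqr.
  - move=> z _; rewrite -!EFinM -EFinD lee_fin -mulrA -cabs_sqrM; exact: cabs_sqrD.
have ge2 : (0 <= (2 * cabs c ^+ 2)%:E)%E by rewrite lee_fin mulr_ge0 ?sqr_ge0.
rewrite ge0_integralD//=; last 4 first.
- by move=> z _; apply: mule_ge0 => //; rewrite lee_fin sqr_ge0.
- by apply/measurable_EFinP; apply: measurable_funM => //; exact: measurable_cabs_sqr.
- by move=> z _; apply: mule_ge0 => //; rewrite lee_fin sqr_ge0.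
- by apply/measurable_EFinP; apply: measurable_funM => //; exact: measurable_cabs_sqr.
rewrite !ge0_integralZl//=.
- by apply: lte_add_pinfty; rewrite lte_mul_pinfty.
- by apply/measurable_EFinP; exact: measurable_cabs_sqr.
- by move=> z _; rewrite lee_fin sqr_ge0.
- by apply/measurable_EFinP; exact: measurable_cabs_sqr.
- by move=> z _; rewrite lee_fin sqr_ge0.
Qed.

Definition ip phi psi : R[i] := cintegral (fun z => phi z * (psi z)^*).

Definition cintegrable phi : Prop :=
  haar.-integrable setT (fun z => (complex.Re (phi z))%:E) /\
  haar.-integrable setT (fun z => (complex.Im (phi z))%:E).

Lemma cintegrable_ip phi psi : L2fun phi -> L2fun psi ->
  cintegrable (fun z => phi z * (psi z)^*).
Proof.
move=> [mp fp] [mq fq].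
have dom : haar.-integrable setT (fun z => (cabs (phi z) ^+ 2 + cabs (psi z) ^+ 2)%:E).
  apply/integrableP; split.
    by apply/measurable_EFinP; apply: measurable_funD; exact: measurable_cabs_sqr.
  under eq_integral => z _ do rewrite gee0_abs ?lee_fin ?addr_ge0 ?sqr_ge0// EFinD.
  rewrite ge0_integralD//=; first by rewrite lte_add_pinfty.
  - by move=> z _; rewrite lee_fin sqr_ge0.
  - by apply/measurable_EFinP; exact: measurable_cabs_sqr.
  - by move=> z _; rewrite lee_fin sqr_ge0.
  - by apply/measurable_EFinP; exact: measurable_cabs_sqr.
have [mr mi] : cmeasurable (fun z => phi z * (psi z)^*).
  by apply: cmeasurableM => //; exact: cmeasurableJ.
have bd z : cabs (phi z * (psi z)^*) <= cabs (phi z) ^+ 2 + cabs (psi z) ^+ 2.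
  rewrite cabsM cabsJ; have := cabs_ge0 (phi z); have := cabs_ge0 (psi z); nra.
split; apply: le_integrable dom => //.
- exact/measurable_EFinP.
- move=> z _ /=; rewrite lee_fin (ger0_norm (addr_ge0 (sqr_ge0 _) (sqr_ge0 _))).
  exact: le_trans (cabs_Re _) (bd z).
- exact/measurable_EFinP.
- move=> z _ /=; rewrite lee_fin (ger0_norm (addr_ge0 (sqr_ge0 _) (sqr_ge0 _))).
  exact: le_trans (cabs_Im _) (bd z).
Qed.

Lemma cintegral_lin (c : R[i]) phi psi : cintegrable phi -> cintegrable psi ->
  cintegral (fun z => c * phi z + psi z) = c * cintegral phi + cintegral psi.
Proof.
case: c => a b [pr pi_] [qr qi]; rewrite /cintegral.
have iZ (r : R) (g : T -> R) : haar.-integrable setT (fun z => (g z)%:E) ->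
    haar.-integrable setT (EFin \o (fun z => r * g z)).
  by move=> ig; rewrite (_ : _ \o _ = fun z => (r%:E * (g z)%:E)%E)//; exact: integrableZl.
have -> : (fun z => complex.Re ((a +i* b) * phi z + psi z)) = (fun z => (a * complex.Re (phi z) +
    (- b) * complex.Im (phi z)) + complex.Re (psi z)).
  by apply/funext => z; case: (phi z) (psi z) => [? ?] [? ?] /=; rewrite mulNr.
have -> : (fun z => complex.Im ((a +i* b) * phi z + psi z)) = (fun z => (a * complex.Im (phi z) +
    b * complex.Re (phi z)) + complex.Im (psi z)).
  by apply/funext => z; case: (phi z) (psi z) => [? ?] [? ?].
have iD (g1 g2 : T -> R) : haar.-integrable setT (EFin \o g1) -> haar.-integrable setT (EFin \o g2) ->
    haar.-integrable setT (EFin \o (fun z => g1 z + g2 z)).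
  by move=> i1 i2; rewrite (_ : _ \o _ = (EFin \o g1) \+ (EFin \o g2))%E//; exact: integrableD.
rewrite !RintegralD//; try exact: iZ; try by apply: iD; exact: iZ.
by rewrite !RintegralZl//= mulNr.
Qed.

Lemma ip_linl c phi1 phi2 psi : L2fun phi1 -> L2fun phi2 -> L2fun psi ->
  ip (fun z => c * phi1 z + phi2 z) psi = c * ip phi1 psi + ip phi2 psi.
Proof.
move=> p1 p2 q; rewrite /ip -cintegral_lin; try exact: cintegrable_ip.
by congr cintegral; apply/funext => z; rewrite mulrDl mulrA.
Qed.

Lemma ipC phi psi : L2fun phi -> L2fun psi -> ip psi phi = (ip phi psi)^*.
Proof.
move=> p q; rewrite /ip /cintegral /=; congr (_ +i* _).
  by apply: eq_Rintegral => z _; case: (phi z) (psi z) => [? ?] [? ?] /=; ring.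
have [_ i] := cintegrable_ip p q.
rewrite -mulN1r -RintegralZl//.
by apply: eq_Rintegral => z _; case: (phi z) (psi z) => [? ?] [? ?] /=; ring.
Qed.

Lemma ipxx phi : L2fun phi -> ip phi phi = (fine (nrm2 phi))%:C.
Proof.
move=> [mp fp]; rewrite /ip /cintegral.
have -> : \int[haar]_z complex.Im (phi z * (phi z)^*) = 0.
  by rewrite /Rintegral integral0_eq// => z _; case: (phi z) => a b /=; congr EFin; ring.
congr (_ +i* _); congr fine; apply: eq_integral => z _; congr EFin.
by rewrite cabs_sqr; case: (phi z) => a b /=; ring.
Qed.

Lemma ip_ae phi phi' psi psi' : cmeasurable phi -> cmeasurable phi' ->
  cmeasurable psi -> cmeasurable psi' ->
  {ae haar, forall z, phi z = phi' z} -> {ae haar, forall z, psi z = psi' z} ->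
  ip phi psi = ip phi' psi'.
Proof.
move=> mp mp' mq mq' pp qq; rewrite /ip /cintegral.
have [m1 m2] : cmeasurable (fun z => phi z * (psi z)^*).
  by apply: cmeasurableM => //; exact: cmeasurableJ.
have [m3 m4] : cmeasurable (fun z => phi' z * (psi' z)^*).
  by apply: cmeasurableM => //; exact: cmeasurableJ.
congr (_ +i* _); congr fine; apply: ae_eq_integral => //; try exact/measurable_EFinP.
  by apply: filterS2 pp qq => z -> ->.
by apply: filterS2 pp qq => z -> ->.
Qed.

Lemma nrm2_ae phi phi' : cmeasurable phi -> cmeasurable phi' ->
  {ae haar, forall z, phi z = phi' z} -> nrm2 phi = nrm2 phi'.
Proof.
move=> m m' pp; apply: ae_eq_integral => //.
- by apply/measurable_EFinP; exact: measurable_cabs_sqr.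
- by apply/measurable_EFinP; exact: measurable_cabs_sqr.
- by apply: filterS pp => z ->.
Qed.

Lemma nrm2_eq0 phi : cmeasurable phi -> nrm2 phi = 0%E -> {ae haar, forall z, phi z = 0}.
Proof.
move=> mp; rewrite /nrm2 => p0.
have /(ae_eq_integral_abs haar measurableT) : measurable_fun setT (fun z => (cabs (phi z) ^+ 2)%:E).
  by apply/measurable_EFinP; exact: measurable_cabs_sqr.
under eq_integral => z _ do rewrite gee0_abs ?lee_fin ?sqr_ge0//.
move=> [/(_ p0) + _]; apply: filterS => z /(_ Logic.I) /eqP.
by rewrite eqe sqrf_eq0 => /eqP /cabs_eq0.
Qed.

(** Comes from expanding the squared norms of [psi + phi] and [psi - phi]. The crude bound serves to
    dominate the series that defines [hdot]; Cauchy-Schwarz is proved afterwards, on the whole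
    space. *)
Lemma le_Re_ip phi psi : L2fun phi -> L2fun psi ->
  `|complex.Re (ip phi psi)| <= fine (nrm2 phi) + fine (nrm2 psi).
Proof.
move=> p q.
have expand (s : R) : s ^+ 2 = 1 ->
    fine (nrm2 (fun z => s%:C * phi z + psi z)) =
    fine (nrm2 phi) + fine (nrm2 psi) + 2 * s * complex.Re (ip phi psi).
  move=> s1; have ps := L2_lin s%:C p q.
  apply: complexI; rewrite -ipxx// ip_linl// ipC// [ip psi _]ipC//.
  rewrite !ip_linl// ipxx// (ipxx q) (ipC p q).
  case: (ip phi psi) => a b; apply/eqP; rewrite eq_complex /=.
  by apply/andP; split; apply/eqP; ring: s1.
have sN1 : (-1 : R) ^+ 2 = 1 by rewrite sqrrN expr1n.
have := expand 1 (expr1n _ _); have := expand (-1) sN1.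
have ge0 (chi : T -> R[i]) : 0 <= fine (nrm2 chi) by rewrite fine_ge0// nrm2_ge0.
move: (ge0 (fun z => (-1)%:C * phi z + psi z)) (ge0 (fun z => 1%:C * phi z + psi z)) (ge0 phi) (ge0 psi).
move=> h1 h2 h3 h4 h5 h6; rewrite ler_norml; apply/andP; split; lra.
Qed.

(** Multiplying [phi] by i turns the imaginary part into a real part and preserves the norm. *)
Lemma le_Im_ip phi psi : L2fun phi -> L2fun psi ->
  `|complex.Im (ip phi psi)| <= fine (nrm2 phi) + fine (nrm2 psi).
Proof.
move=> p q.
have p' : L2fun (fun z => 'i%C * phi z).
  have := L2_lin ('i%C - 1) p p; congr L2fun.
  by apply/funext => z; rewrite mulrBl mul1r subrK.
have := le_Re_ip p' q.
have -> : nrm2 (fun z => 'i%C * phi z) = nrm2 phi.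
  apply: eq_integral => z _; rewrite cabs_sqrM cabs_sqr /=; congr EFin; ring.
suff -> : complex.Re (ip (fun z => 'i%C * phi z) psi) = - complex.Im (ip phi psi).
  by rewrite normrN.
have -> : (fun z => 'i%C * phi z) = (fun z => ('i%C - 1) * phi z + phi z).
  by apply/funext => z; rewrite mulrBl mul1r subrK.
rewrite ip_linl// mulrBl mul1r subrK.
by case: (ip phi psi) => a b /=; ring.
Qed.

End InnerProduct.

(** * Classes modulo null functions, [hdot], [hnorm] and Cauchy-Schwarz *)

Section HilbertSpace.
Variable R : realType.
Local Notation T := (circle R).
Local Notation H := (Hspace R).
Local Notation haar := (@haar R).
Implicit Types (x y : H) (g : int -> T -> R[i]).

Lemma ae1 (P Q : T -> Prop) : (forall z, P z -> Q z) ->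
  {ae haar, forall z, P z} -> {ae haar, forall z, Q z}.
Proof. by move=> PQ; apply: filterS. Qed.

Lemma ae2 (P Q S : T -> Prop) : (forall z, P z -> Q z -> S z) ->
  {ae haar, forall z, P z} -> {ae haar, forall z, Q z} -> {ae haar, forall z, S z}.
Proof. by move=> PQ; apply: filterS2. Qed.

Lemma ae3 (P Q S U : T -> Prop) : (forall z, P z -> Q z -> S z -> U z) ->
  {ae haar, forall z, P z} -> {ae haar, forall z, Q z} -> {ae haar, forall z, S z} ->
  {ae haar, forall z, U z}.
Proof. by move=> PQ; apply: filterS3. Qed.

Lemma ae4 (P Q S U V : T -> Prop) : (forall z, P z -> Q z -> S z -> U z -> V z) ->
  {ae haar, forall z, P z} -> {ae haar, forall z, Q z} -> {ae haar, forall z, S z} ->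
  {ae haar, forall z, U z} -> {ae haar, forall z, V z}.
Proof.
move=> PQ p q r u; apply: (ae2 _ u (ae3 _ p q r)); last by move=> z; exact: PQ.
by move=> z Uz; apply.
Qed.

Definition nsq g : \bar R := (\esum_(n in [set: int]) nrm2 (g n))%E.

Definition l2 g : Prop := (forall n, cmeasurable (g n)) /\ (nsq g < +oo)%E.

Lemma l2P g : l2 g <-> g \in @sqint R.
Proof. by rewrite inE. Qed.

Lemma l2_repr x : l2 (hrepr x).
Proof. by apply/l2P; case: (hrepr x). Qed.

Lemma nsq_ge0 g : (0 <= nsq g)%E.
Proof. by apply: esum_ge0 => n _; exact: nrm2_ge0. Qed.

Lemma nrm2_le_nsq g n : (nrm2 (g n) <= nsq g)%E.
Proof.
have := @ge_esum_seq R int [:: n] (fun n => nrm2 (g n)) isT.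
by rewrite big_seq1.
Qed.

Lemma l2_L2 g n : l2 g -> L2fun (g n).
Proof. by move=> [mg fg]; split=> //; exact: le_lt_trans (nrm2_le_nsq g n) fg. Qed.

Lemma L2_repr x n : L2fun (hrepr x n).
Proof. exact/l2_L2/l2_repr. Qed.

Lemma cmeas_repr x n : cmeasurable (hrepr x n).
Proof. by have [] := L2_repr x n. Qed.

Lemma nsq_ae g g' : (forall n, cmeasurable (g n)) -> (forall n, cmeasurable (g' n)) ->
  (forall n, {ae haar, forall z, g n z = g' n z}) -> nsq g = nsq g'.
Proof. by move=> mg mg' gg'; apply: eq_esum => n _; exact: nrm2_ae. Qed.

Lemma hrepr_class (u : l2fun R) n : {ae haar, forall z, hrepr (hclass u) n z = u n z}.
Proof. by have /hclassP : hclass (hrepr (hclass u)) == hclass u by rewrite hreprK. Qed.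

Lemma hrepr_hmk g n : l2 g -> {ae haar, forall z, hrepr (hmk g) n z = g n z}.
Proof.
move=> /l2P lg; have := hrepr_class (insubd 0 g) n.
by rewrite /hmk; apply: filterS => z ->; rewrite insubdK.
Qed.

Lemma hext x y : (forall n, {ae haar, forall z, hrepr x n z = hrepr y n z}) -> x = y.
Proof. by move=> xy; rewrite -[x]hreprK -[y]hreprK; apply/eqP/hclassP. Qed.

Lemma hreprD x y n : {ae haar, forall z, hrepr (x + y) n z = hrepr x n z + hrepr y n z}.
Proof.
have := hrepr_class (hrepr x + hrepr y) n; rewrite hclassD !hreprK.
by apply: filterS => z ->.
Qed.

Lemma hreprZ c x n : {ae haar, forall z, hrepr (c *: x) n z = c * hrepr x n z}.
Proof.
have := hrepr_class (c *: hrepr x) n; rewrite -hscale_class hreprK.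
by apply: filterS => z ->.
Qed.

Lemma hrepr0 n : {ae haar, forall z, hrepr (0 : H) n z = 0}.
Proof.
have := hreprZ 0 0 n; rewrite scale0r; apply: filterS => z ->.
by rewrite mul0r.
Qed.

Lemma hrepr_lin c x y n :
  {ae haar, forall z, hrepr (c *: x + y) n z = c * hrepr x n z + hrepr y n z}.
Proof. by apply: filterS2 (hreprD (c *: x) y n) (hreprZ c x n) => z -> ->. Qed.

Lemma l2_lin c g g' : l2 g -> l2 g' -> l2 (fun n z => c * g n z + g' n z).
Proof.
move=> /l2P lg /l2P lg'; apply/l2P.
have [_ h] := sqint_submod_closed R; exact: (h c g g' lg lg').
Qed.

#[local] Opaque hmk hrepr.

Lemma hmk_lin c g g' : l2 g -> l2 g' ->
  hmk (fun n z => c * g n z + g' n z) = c *: hmk g + hmk g'.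
Proof.
move=> lg lg'; apply: hext => n.
apply: (ae4 _ (hrepr_hmk n (l2_lin c lg lg')) (hrepr_lin c (hmk g) (hmk g') n)
  (hrepr_hmk n lg) (hrepr_hmk n lg')) => z e1 e2 e3 e4.
by rewrite e1 e2 e3 e4.
Qed.

Lemma hmk_ae g g' : l2 g -> l2 g' ->
  (forall n, {ae haar, forall z, g n z = g' n z}) -> hmk g = hmk g'.
Proof.
move=> lg lg' gg; apply: hext => n.
by apply: (ae3 _ (hrepr_hmk n lg) (hrepr_hmk n lg') (gg n)) => z -> ->.
Qed.

Lemma hmk_repr x : hmk (hrepr x) = x.
Proof. by apply: hext => n; exact/hrepr_hmk/l2_repr. Qed.

#[local] Transparent hmk hrepr.

Definition hip x y n := ip (hrepr x n) (hrepr y n).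

Lemma hdotE x y : hdot x y = limn (symsum (hip x y)).
Proof. by []. Qed.

Lemma cvg_hdot x y : symsum (hip x y) @ \oo --> hdot x y.
Proof.
rewrite hdotE.
apply: (@cvg_symsum _ _ (fun n => fine (nrm2 (hrepr x n)) + fine (nrm2 (hrepr y n)))).
- by move=> n; apply: le_Re_ip; exact: L2_repr.
- by move=> n; apply: le_Im_ip; exact: L2_repr.
have e (w : H) n : (fine (nrm2 (hrepr w n)))%:E = nrm2 (hrepr w n).
  by rewrite fineK// ge0_fin_numE ?nrm2_ge0//; case: (L2_repr w n).
under eq_esum do rewrite EFinD !e.
rewrite esumD; try by move=> *; exact: nrm2_ge0.
by apply: lte_add_pinfty; case: (l2_repr x) (l2_repr y) => _ ? [_ ?].
Qed.

Lemma hdot_linl c x y w : hdot (c *: x + y) w = c * hdot x w + hdot y w.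
Proof.
rewrite hdotE; apply/cvg_lim; first exact: norm_hausdorff.
rewrite (_ : symsum _ = fun N => c * symsum (hip x w) N + symsum (hip y w) N).
  apply: cvgD; last exact: cvg_hdot.
  by apply: cvgM; [exact: cvg_cst|exact: cvg_hdot].
apply/funext => N; rewrite /symsum mulr_sumr -big_split; apply: eq_bigr => k _ /=.
set n := _ - _; rewrite /hip -ip_linl; try exact: L2_repr.
apply: ip_ae; try exact: cmeas_repr; last exact: aeW.
  by have [] := L2_lin c (L2_repr x n) (L2_repr y n).
exact: hrepr_lin.
Qed.

Lemma hdotC x y : hdot y x = (hdot x y)^*.
Proof.
rewrite hdotE; apply/cvg_lim; first exact: norm_hausdorff.
rewrite (_ : symsum _ = fun N => (symsum (hip x y) N)^*).
  rewrite [(hdot x y)^*](_ : _ = complex.Re (hdot x y) +i* (- complex.Im (hdot x y))); last by case: hdot.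
  apply: cvg_ReIm.
    rewrite (_ : (fun n => _) = fun N => complex.Re (symsum (hip x y) N)).
      by apply: cvg_Re; exact: cvg_hdot.
    by apply/funext => N; case: (symsum _ _).
  rewrite (_ : (fun n => _) = fun N => - complex.Im (symsum (hip x y) N)).
    by apply: cvgN; apply: cvg_Im; exact: cvg_hdot.
  by apply/funext => N; case: (symsum _ _).
apply/funext => N; rewrite /symsum rmorph_sum; apply: eq_bigr => k _ /=.
by rewrite /hip ipC//; exact: L2_repr.
Qed.

Definition hsq x := fine (nsq (hrepr x)).

Lemma hsq_fin x : (hsq x)%:E = nsq (hrepr x).
Proof. by rewrite fineK// ge0_fin_numE ?nsq_ge0//; case: (l2_repr x). Qed.

Lemma hdotxx x : hdot x x = (hsq x)%:C.
Proof.
rewrite hdotE; apply/cvg_lim; first exact: norm_hausdorff.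
have fE n : (fine (nrm2 (hrepr x n)))%:E = nrm2 (hrepr x n).
  by rewrite fineK// ge0_fin_numE ?nrm2_ge0//; case: (L2_repr x n).
have := @cvg_symsum_ge0 R (fun n => fine (nrm2 (hrepr x n))).
have -> : (\esum_(n in [set: int]) (fine (nrm2 (hrepr x n)))%:E)%E = nsq (hrepr x).
  by apply: eq_esum.
move=> /(_ (fun n => fine_ge0 (nrm2_ge0 _))) /(_ (proj2 (l2_repr x))) h.
have -> : symsum (hip x x) = fun N => (symsum (fun n => fine (nrm2 (hrepr x n))) N)%:C.
  apply/funext => N; rewrite /symsum rmorph_sum; apply: eq_bigr => k _ /=.
  by rewrite /hip ipxx//; exact: L2_repr.
by apply: cvg_ReIm => //=; exact: cvg_cst.
Qed.

Lemma hsq_ge0 x : 0 <= hsq x.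
Proof. by rewrite fine_ge0 ?nsq_ge0. Qed.

Lemma hnorm_sqr x : hnorm x ^+ 2 = hsq x.
Proof. by rewrite /hnorm hdotxx sqr_sqrtr//= hsq_ge0. Qed.

Lemma hnormE x : hnorm x = Num.sqrt (hsq x).
Proof. by rewrite /hnorm hdotxx. Qed.

Lemma hnorm_ge0 x : 0 <= hnorm x.
Proof. exact: sqrtr_ge0. Qed.

Lemma hnorm_nsq x : ((hnorm x) ^+ 2)%:E = nsq (hrepr x).
Proof. by rewrite hnorm_sqr hsq_fin. Qed.

Lemma hsq_hmk g : l2 g -> (hsq (hmk g))%:E = nsq g.
Proof.
move=> lg; rewrite hsq_fin; apply: nsq_ae; first exact: cmeas_repr.
  by case: lg.
by move=> n; exact: hrepr_hmk.
Qed.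

Lemma hsq_eq0 x : hsq x = 0 -> x = 0.
Proof.
move=> x0; apply: hext => n.
have n0 : nrm2 (hrepr x n) = 0%E.
  apply/eqP; rewrite eq_le nrm2_ge0 andbT.
  by have := nrm2_le_nsq (hrepr x) n; rewrite -hsq_fin x0.
by apply: filterS2 (nrm2_eq0 (cmeas_repr x n) n0) (hrepr0 n) => z -> ->.
Qed.

Lemma hnorm_eq0 x : hnorm x = 0 -> x = 0.
Proof. by move=> x0; apply: hsq_eq0; rewrite -hnorm_sqr x0 expr0n. Qed.

#[local] Opaque hdot hnorm hmk hrepr.

Lemma hdotDl x y w : hdot (x + y) w = hdot x w + hdot y w.
Proof. by have := hdot_linl 1 x y w; rewrite scale1r mul1r. Qed.

Lemma hdot0l y : hdot 0 y = 0.
Proof. by have := hdot_linl (-1) 0 0 y; rewrite scaler0 addr0 mulN1r addNr. Qed.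

Lemma hdotZl c x w : hdot (c *: x) w = c * hdot x w.
Proof. by have := hdot_linl c x 0 w; rewrite addr0 hdot0l addr0. Qed.

Lemma hdotNl x w : hdot (- x) w = - hdot x w.
Proof. by rewrite -scaleN1r hdotZl mulN1r. Qed.

Lemma hdotBl x y w : hdot (x - y) w = hdot x w - hdot y w.
Proof. by rewrite hdotDl hdotNl. Qed.

Lemma hdotDr x y w : hdot w (x + y) = hdot w x + hdot w y.
Proof. by rewrite [LHS]hdotC hdotDl rmorphD /= -(hdotC x w) -(hdotC y w). Qed.

Lemma hdotZr c x w : hdot w (c *: x) = c^* * hdot w x.
Proof. by rewrite hdotC hdotZl (hdotC w x) rmorphM /= conjCK. Qed.

Lemma hdot0r y : hdot y 0 = 0.
Proof. by rewrite hdotC hdot0l rmorph0. Qed.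

Lemma hdotNr x w : hdot w (- x) = - hdot w x.
Proof. by rewrite hdotC hdotNl (hdotC w x) rmorphN /= conjCK. Qed.

Lemma hdotBr x y w : hdot w (x - y) = hdot w x - hdot w y.
Proof. by rewrite hdotDr hdotNr. Qed.

Lemma hdot_suml (I : Type) (r : seq I) (P : pred I) (F : I -> H) w :
  hdot (\sum_(i <- r | P i) F i) w = \sum_(i <- r | P i) hdot (F i) w.
Proof. by elim/big_rec2: _ => [|k a b _ <-]; rewrite ?hdot0l ?hdotDl. Qed.

Lemma hdot_sumr (I : Type) (r : seq I) (P : pred I) (F : I -> H) w :
  hdot w (\sum_(i <- r | P i) F i) = \sum_(i <- r | P i) hdot w (F i).
Proof. by elim/big_rec2: _ => [|k a b _ <-]; rewrite ?hdot0r ?hdotDr. Qed.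

Lemma hsqE x : hsq x = complex.Re (hdot x x).
Proof. by rewrite hdotxx. Qed.

Lemma hsqZ c x : hsq (c *: x) = cabs c ^+ 2 * hsq x.
Proof.
apply: complexI; rewrite rmorphM /= -!hdotxx hdotZl hdotZr mulrA; congr (_ * _).
by rewrite cabs_sqr; case: c => a b; apply/eqP; rewrite eq_complex /=; apply/andP; split; apply/eqP; ring.
Qed.

Lemma hsqD x y : hsq (x + y) = hsq x + hsq y + 2 * complex.Re (hdot x y).
Proof.
rewrite !hsqE hdotDl !hdotDr (hdotC x y).
by case: (hdot x x) (hdot y y) (hdot x y) => [? ?] [? ?] [? ?] /=; ring.
Qed.

Lemma hnorm_scale c x : hnorm (c *: x) = cabs c * hnorm x.
Proof. by rewrite !hnormE hsqZ sqrtrM ?sqr_ge0// sqrtr_sqr ger0_norm// cabs_ge0. Qed.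

Lemma hnorm_opp x : hnorm (- x) = hnorm x.
Proof. by rewrite -scaleN1r hnorm_scale cabsN ComplexField.Normc.normc1 mul1r. Qed.

Lemma hnorm_zero : hnorm (0 : H) = 0.
Proof. by rewrite hnormE hsqE hdot0l /= sqrtr0. Qed.

Lemma complex_phase (z : R[i]) : exists2 c : R[i], cabs c = 1 & c * z = (cabs z)%:C.
Proof.
have [->|z0] := eqVneq z 0; first by exists 1; rewrite ?ComplexField.Normc.normc1 ?mulr0 ?ComplexField.Normc.normc0.
have c0 : cabs z != 0 by apply: contra_neq z0; exact: cabs_eq0.
exists (z^* / (cabs z)%:C).
  by rewrite cabsM cabsJ ComplexField.Normc.normcV cabsR ger0_norm ?cabs_ge0// divff.
rewrite mulrAC [_^* * z](_ : _ = (cabs z ^+ 2)%:C).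
  by rewrite rmorphXn /= expr2 mulfK//; apply: contra_neq c0 => -[].
by rewrite cabs_sqr; case: z {z0 c0} => a b; apply/eqP; rewrite eq_complex /=; apply/andP; split; apply/eqP; ring.
Qed.

(** A phase factor on [x] makes the inner product equal to its modulus, so that only its real part
    has to be bounded. *)
Lemma cabs_hdot x y : cabs (hdot x y) <= hnorm x * hnorm y.
Proof.
have [c c1 cE] := complex_phase (hdot x y).
have {cE} cE : complex.Re (hdot (c *: x) y) = cabs (hdot x y) by rewrite hdotZl cE.
have xE : hnorm (c *: x) = hnorm x by rewrite hnorm_scale c1 mul1r.
rewrite -cE -xE; move: (c *: x) => {cE xE c1} {}x.
have [x0|x0] := eqVneq (hnorm x) 0; first by rewrite x0 mul0r (hnorm_eq0 x0) hdot0l.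
have xp : 0 < hnorm x by rewrite lt_def x0 hnorm_ge0.
(* With p, q the norms of [x], [y] and a the real part of the inner product, this square is 2 p q (p
   q - a); the positive factor p q is cancelled at the end. *)
have := hsq_ge0 ((- (hnorm y))%:C *: x + (hnorm x)%:C *: y).
rewrite hsqD (hsqZ _ x) (hsqZ _ y) (cabsR (hnorm x)) (cabsR (- hnorm y)).
rewrite hdotZl hdotZr -(hnorm_sqr x) -(hnorm_sqr y).
rewrite (real_normK (num_real (hnorm x))) (real_normK (num_real (- hnorm y))).
rewrite sqrrN; have [y0|y0] := eqVneq (hnorm y) 0.
  by rewrite (hnorm_eq0 y0) hdot0r /= hnorm_zero mulr0.
have yp : 0 < hnorm y by rewrite lt_def y0 hnorm_ge0.
case: (hdot x y) => a b /=; move: (hnorm x) (hnorm y) xp yp => p q p0 q0 {x0 y0}.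
rewrite !(mul0r, mulr0, oppr0, subr0, addr0, mulNr, mulrN) => h.
have : 0 <= (p * q) * (p * q - a) by lra.
by rewrite pmulr_rge0 ?mulr_gt0// subr_ge0.
Qed.

Lemma hnorm_add x y : hnorm (x + y) <= hnorm x + hnorm y.
Proof.
rewrite -(@ler_pXn2r _ 2%N) ?nnegrE ?addr_ge0 ?hnorm_ge0//.
rewrite hnorm_sqr hsqD -!hnorm_sqr sqrrD.
have := le_trans (ler_norm _) (le_trans (cabs_Re _) (cabs_hdot x y)).
by move: (hnorm x) (hnorm y) (complex.Re _) => a b c; lra.
Qed.

Lemma hdot_inj y y' : (forall x, hdot x y = hdot x y') -> y = y'.
Proof.
move=> e; apply/eqP; rewrite -subr_eq0; apply/eqP/hsq_eq0.
by rewrite hsqE hdotBr e subrr.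
Qed.

End HilbertSpace.

(** * Weighted composition operators *)

Section Nonsingular.
Variable R : realType.
Local Notation T := (circle R).
Local Notation haar := (@haar R).

(** Stronger than preserving null sets: the image of Haar measure under [tau] has a bounded density,
    which makes composition with [tau] bounded on L^2. *)
Definition nonsing (tau : T -> T) : Prop :=
  measurable_fun setT tau /\
  exists2 C : R, 0 <= C & forall E, measurable E -> (haar (tau @^-1` E) <= C%:E * haar E)%E.

Lemma nonsing_id : nonsing id.
Proof.
split; first exact: measurable_id.
by exists 1 => // E mE; rewrite mul1e.
Qed.

Lemma nonsing_comp tau1 tau2 : nonsing tau1 -> nonsing tau2 -> nonsing (tau1 \o tau2).
Proof.
move=> [m1 [C1 C10 h1]] [m2 [C2 C20 h2]]; split; first exact: measurableT_comp.
exists (C2 * C1); first exact: mulr_ge0.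
move=> E mE; have mE1 : measurable (tau1 @^-1` E) by rewrite -[X in measurable X]setTI; exact: m1.
rewrite comp_preimage; apply: le_trans (h2 _ mE1) _; rewrite EFinM -muleA.
by apply: lee_wpmul2l; rewrite ?lee_fin//; exact: h1.
Qed.

Lemma nonsing_ae tau (P : T -> Prop) : nonsing tau ->
  {ae haar, forall z, P z} -> {ae haar, forall z, P (tau z)}.
Proof.
move=> [mt [C C0 h]] [N [mN N0 PN]]; exists (tau @^-1` N); split.
- by rewrite -[X in measurable X]setTI; exact: mt.
- by apply/eqP; rewrite eq_le measure_ge0 andbT; apply: le_trans (h N mN) _; rewrite N0 mule0.
- by move=> z /= nP; apply: PN.
Qed.

Lemma nonsing_integral tau : nonsing tau -> exists2 C : R, 0 <= C &
  forall psi : T -> \bar R, measurable_fun setT psi -> (forall z, 0 <= psi z)%E ->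
  (\int[haar]_z psi (tau z) <= C%:E * \int[haar]_z psi z)%E.
Proof.
move=> [mt [C C0 h]]; exists C => // psi mpsi psi0.
have := @ge0_integral_pushforward _ _ _ _ R tau mt haar setT psi measurableT mpsi (fun y _ => psi0 y).
rewrite preimage_setT => <-.
have -> : C = (NngNum C0)%:num by [].
rewrite -ge0_integral_mscale//.
apply: ge0_le_measure_integral => //= E mE; exact: h.
Qed.

Lemma cmeasurable_comp (phi : T -> R[i]) tau :
  measurable_fun setT tau -> cmeasurable phi -> cmeasurable (fun z => phi (tau z)).
Proof. by move=> mt [mr mi]; split; [exact: (measurableT_comp mr)|exact: (measurableT_comp mi)]. Qed.

End Nonsingular.

(** * Boundedness and composition of weighted composition operators, and density of bounded sites *)

Section WeightedOperators.
Variable R : realType.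
Local Notation T := (circle R).
Local Notation H := (Hspace R).
Local Notation haar := (@haar R).
Implicit Types (x y : H) (g : int -> T -> R[i]) (phi psi : T -> R[i]) (c : int -> T -> R[i]).
#[local] Opaque hmk hrepr hdot hnorm.

Definition bmeas (K : R) phi : Prop := cmeasurable phi /\ forall z, cabs (phi z) <= K.

Definition weight (K : R) c : Prop := forall n, bmeas K (c n).

(* The shape of all operators that occur: opU, opV, u_, and their relatives in M and its commutant. *)
Definition wop c (k : int) (tau : T -> T) (x : H) : H :=
  hmk (fun n z => c n z * hrepr x (n - k) (tau z)).

Lemma nrm2M K phi psi : bmeas K phi -> cmeasurable psi ->
  (nrm2 (fun z => (phi z * psi z)%R) <= (K ^+ 2)%:E * nrm2 psi)%E.
Proof.
move=> [mp bp] mq; rewrite -ge0_integralZl//=; last 3 first.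
- by apply/measurable_EFinP; exact: measurable_cabs_sqr.
- by move=> z _; rewrite lee_fin sqr_ge0.
- by rewrite lee_fin sqr_ge0.
apply: ge0_le_integral => //=.
- by move=> z _; rewrite lee_fin sqr_ge0.
- by apply/measurable_EFinP; apply: measurable_cabs_sqr; exact: cmeasurableM.
- by apply/measurable_EFinP; apply: measurable_funM => //; exact: measurable_cabs_sqr.
- move=> z _; rewrite -EFinM lee_fin cabs_sqrM ler_wpM2r ?sqr_ge0//.
  by rewrite lerXn2r ?nnegrE ?cabs_ge0//; exact: le_trans (cabs_ge0 _) (bp z).
Qed.

Lemma nrm2_comp tau : nonsing tau -> exists2 C : R, 0 <= C &
  forall phi, cmeasurable phi -> (nrm2 (fun z => phi (tau z)) <= C%:E * nrm2 phi)%E.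
Proof.
move=> /nonsing_integral [C C0 h]; exists C => // phi mp.
apply: (h (fun z => (cabs (phi z) ^+ 2)%:E)).
  by apply/measurable_EFinP; exact: measurable_cabs_sqr.
by move=> z; rewrite lee_fin sqr_ge0.
Qed.

Lemma nsq_shift (k : int) g : nsq (fun n => g (n - k)) = nsq g.
Proof.
rewrite /nsq; apply/esym.
apply: (@reindex_esum R int int setT setT (fun n => n - k) (fun n => nrm2 (g n))).
split=> // [a b _ _ /(congr1 (fun m => m + k))|n _ /=]; first by rewrite !subrK.
by exists (n + k) => //; rewrite addrK.
Qed.

Lemma nsq_wop K c (tau : T -> T) : weight K c -> nonsing tau -> exists2 C : R, 0 <= C &
  forall k g, l2 g -> (nsq (fun n z => (c n z * g (n - k) (tau z))%R) <= C%:E * nsq g)%E.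
Proof.
move=> wc nt; have [C C0 h] := nrm2_comp nt; exists (K ^+ 2 * C); first by rewrite mulr_ge0 ?sqr_ge0.
move=> k g [mg fg].
apply: (@le_trans _ _ (\esum_(n in [set: int]) ((K ^+ 2 * C)%:E * nrm2 (g (n - k)%R)))%E).
  apply: le_esum => n _; apply: le_trans (nrm2M (wc n) _) _.
    by apply: cmeasurable_comp => //; case: nt.
  by rewrite [(K ^+ 2 * C)%:E]EFinM -muleA; apply: lee_wpmul2l; rewrite ?lee_fin ?sqr_ge0//; exact: h.
apply: le_trans (le_esumZl _ _) _; first by rewrite mulr_ge0 ?sqr_ge0.
  by move=> n; exact: nrm2_ge0.
by rewrite -[X in (_ <= _ * X)%E](nsq_shift k).
Qed.

Lemma l2_wop K c tau k g : weight K c -> nonsing tau -> l2 g ->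
  l2 (fun n z => c n z * g (n - k) (tau z)).
Proof.
move=> wc nt lg; have [mg fg] := lg; split.
  move=> n; apply: cmeasurableM; first by case: (wc n).
  by apply: cmeasurable_comp => //; case: nt.
have [C C0 h] := nsq_wop wc nt; apply: le_lt_trans (h k g lg) _.
by rewrite lte_mul_pinfty.
Qed.

Lemma wopE K c tau k x n : weight K c -> nonsing tau ->
  {ae haar, forall z, hrepr (wop c k tau x) n z = c n z * hrepr x (n - k) (tau z)}.
Proof. by move=> wc nt; apply: hrepr_hmk; apply: (l2_wop _ wc nt); exact: l2_repr. Qed.

Lemma wop_hmk K c tau k g : weight K c -> nonsing tau -> l2 g ->
  wop c k tau (hmk g) = hmk (fun n z => c n z * g (n - k) (tau z)).
Proof.
move=> wc nt lg; apply: hmk_ae; try (apply: (l2_wop _ wc nt) => //; exact: l2_repr).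
move=> n; apply: ae1 (nonsing_ae nt (hrepr_hmk (n - k) lg)) => z.
by move=> ->.
Qed.

Lemma wop_linear K c tau k : weight K c -> nonsing tau -> linear (wop c k tau).
Proof.
move=> wc nt a x y; rewrite /wop -hmk_lin; try (apply: (l2_wop _ wc nt) => //; exact: l2_repr).
apply: hmk_ae.
- by apply: (l2_wop _ wc nt); exact: l2_repr.
- by apply: l2_lin; apply: (l2_wop _ wc nt); exact: l2_repr.
move=> n; apply: ae1 (nonsing_ae nt (hrepr_lin a x y (n - k))) => z ->; ring.
Qed.

Lemma wop_bound K c tau k : weight K c -> nonsing tau ->
  exists2 C : R, 0 <= C & forall x, hnorm (wop c k tau x) <= C * hnorm x.
Proof.
move=> wc nt; have [C C0 h] := nsq_wop wc nt; exists (Num.sqrt C); first exact: sqrtr_ge0.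
move=> x; rewrite !hnormE -sqrtrM// ler_wsqrtr// -lee_fin hsq_hmk; last first.
  by apply: (l2_wop _ wc nt); exact: l2_repr.
by rewrite EFinM hsq_fin; apply: h; exact: l2_repr.
Qed.

(** For [tau = id] the operator bound is the bound of the weights itself, hence uniform along a
    sequence of weights; the limit arguments for [Top] rest on this. *)
Lemma wop_bound1 K c k x : 0 <= K -> weight K c -> hnorm (wop c k id x) <= K * hnorm x.
Proof.
move=> K0 wc; have lw := l2_wop k wc (nonsing_id R) (l2_repr x).
rewrite !hnormE -[X in X * _](ger0_norm K0) -sqrtr_sqr -sqrtrM ?sqr_ge0// ler_wsqrtr//.
rewrite -lee_fin hsq_hmk// EFinM hsq_fin -[X in (_ <= _ * X)%E](nsq_shift k).
apply: le_trans (le_esumZl (sqr_ge0 K) (fun n => nrm2_ge0 _)).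
apply: le_esum => n _; apply: nrm2M => //; exact: cmeas_repr.
Qed.

Lemma wop_bounded K c tau k : weight K c -> nonsing tau -> bounded_operator (wop c k tau).
Proof.
move=> wc nt; split; first exact: wop_linear wc nt.
by have [C C0 h] := wop_bound k wc nt; exists C.
Qed.

Lemma wop_comp K K' c c' tau tau' k k' x : weight K c -> weight K' c' ->
  nonsing tau -> nonsing tau' ->
  wop c k tau (wop c' k' tau' x) =
  wop (fun n z => c n z * c' (n - k) (tau z)) (k + k') (tau' \o tau) x.
Proof.
move=> wc wc' nt nt'; rewrite {2}/wop (wop_hmk _ wc nt); last first.
  by apply: (l2_wop _ wc' nt'); exact: l2_repr.
by congr hmk; apply/funext => n; apply/funext => z /=; rewrite mulrA opprD addrA.
Qed.

Lemma wop_id x : wop (fun _ _ => 1) 0 id x = x.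
Proof.
rewrite -[RHS]hmk_repr; congr hmk; apply/funext => n; apply/funext => z.
by rewrite mul1r subr0.
Qed.

Lemma wop_isometry c k x : weight 1 c -> (forall n z, cabs (c n z) = 1) ->
  hnorm (wop c k id x) = hnorm x.
Proof.
move=> wc c1; have lw := l2_wop k wc (nonsing_id R) (l2_repr x).
rewrite !hnormE; congr Num.sqrt; apply: EFin_inj.
rewrite hsq_hmk// hsq_fin -[RHS](nsq_shift k).
apply: eq_esum => n _; apply: eq_integral => z _.
by rewrite cabs_sqrM c1 expr1n mul1r.
Qed.

Lemma linearDZ (a : H -> H) : linear a ->
  [/\ forall x y, a (x + y) = a x + a y, forall (b : R[i]) x, a (b *: x) = b *: a x,
      a 0 = 0 & forall x y, a (x - y) = a x - a y].
Proof.
move=> la; have D x y : a (x + y) = a x + a y by have := la 1 x y; rewrite !scale1r.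
have a0 : a 0 = 0 by have := la (-1) 0 0; rewrite scaler0 addr0 scaleN1r addNr.
have Z (b : R[i]) x : a (b *: x) = b *: a x by have := la b x 0; rewrite !addr0 a0 addr0.
by split=> // x y; rewrite D -scaleN1r Z scaleN1r.
Qed.

Lemma lin_bigsum (a : H -> H) (I : Type) (r : seq I) (P : pred I) (F : I -> H) : linear a ->
  a (\sum_(i <- r | P i) F i) = \sum_(i <- r | P i) a (F i).
Proof.
move=> /linearDZ[D _ a0 _]; elim/big_rec2: _ => [|i y z _ <-]; first exact: a0.
exact: D.
Qed.

(** Polarisation: [hsqD] recovers real parts, and replacing [x] by i [x] recovers imaginary
    parts. *)
Lemma isometry_hdot (a : H -> H) : linear a -> (forall x, hnorm (a x) = hnorm x) ->
  forall x y, hdot (a x) (a y) = hdot x y.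
Proof.
move=> la iso x y; have [D Z _ _] := linearDZ la.
have ReE u v : complex.Re (hdot (a u) (a v)) = complex.Re (hdot u v).
  have hs w : hsq (a w) = hsq w by rewrite -hnorm_sqr iso hnorm_sqr.
  have := hsqD (a u) (a v); rewrite -D (hs (u + v)) (hs u) (hs v) (hsqD u v) => /addrI h.
  by apply/esym/(mulfI _ h); rewrite pnatr_eq0.
have := ReE x y; have := ReE ('i%C *: x) y; rewrite Z !hdotZl.
by case: (hdot (a x) (a y)) (hdot x y) => [b c] [d e] /=; rewrite !mul0r !mul1r !sub0r => /oppr_inj -> ->.
Qed.

(** [adjoint] is defined by choice; nondegeneracy of the inner product identifies the chosen
    operator with any adjoint that has been exhibited. *)
Lemma adjointE (a b : H -> H) : bounded_operator b -> is_adjoint a b -> adjoint a = b.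
Proof.
move=> bb ab; rewrite /adjoint; case: xgetP => [b' _ [_ ab']|]; last by move=> /(_ b); case.
by apply/funext => y; apply: hdot_inj => x; rewrite -ab' ab.
Qed.

Definition site (n : int) phi : H := hmk (fun m z => if m == n then phi z else 0).

Lemma nrm20 : nrm2 (fun _ : T => 0 : R[i]) = 0%E.
Proof. by apply: integral0_eq => z _; rewrite ComplexField.Normc.normc0 expr0n. Qed.

Lemma nsq_site n phi : nsq (fun m z => if m == n then phi z else 0) = nrm2 phi.
Proof.
rewrite /nsq (_ : [set: int] = [set n] `|` ~` [set n]); last by rewrite setUv.
transitivity (\esum_(m in [set: int]) (if m \in [set n] then nrm2 phi else 0))%E.
  rewrite setUv; apply: eq_esum => m _; have [->|mn] := eqVneq m n.
    by rewrite ifT// inE.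
  by rewrite ifF ?nrm20//; apply/negbTE; rewrite notin_setE /=; exact/eqP.
by rewrite -(esum_mkcond [set n] (fun _ => nrm2 phi)) esum_set1// nrm2_ge0.
Qed.

Lemma l2_site n phi : L2fun phi -> l2 (fun m z => if m == n then phi z else 0).
Proof.
move=> [mp fp]; split; last by rewrite nsq_site.
by move=> m; case: eqP => // _; exact: cmeasurable_cst.
Qed.

Lemma site_repr n phi m : L2fun phi ->
  {ae haar, forall z, hrepr (site n phi) m z = if m == n then phi z else 0}.
Proof. by move=> lp; exact/hrepr_hmk/l2_site. Qed.

Lemma hsq_site n phi : L2fun phi -> (hsq (site n phi))%:E = nrm2 phi.
Proof. by move=> lp; rewrite hsq_hmk ?nsq_site//; exact: l2_site. Qed.

Lemma site_lin n a phi psi : L2fun phi -> L2fun psi ->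
  site n (fun z => a * phi z + psi z) = a *: site n phi + site n psi.
Proof.
move=> lp lq; rewrite -hmk_lin; try exact: l2_site.
congr hmk; apply/funext => m; apply/funext => z.
by case: ifP => // _; rewrite mulr0 addr0.
Qed.

Lemma wop_site K c tau k n phi : weight K c -> nonsing tau -> L2fun phi ->
  wop c k tau (site n phi) = site (n + k) (fun z => c (n + k) z * phi (tau z)).
Proof.
move=> wc nt lp; rewrite (wop_hmk _ wc nt); last exact: l2_site.
congr hmk; apply/funext => m; apply/funext => z.
by rewrite subr_eq; case: eqP => [->//|_]; rewrite mulr0.
Qed.

Lemma L2_bmeas K phi : bmeas K phi -> L2fun phi.
Proof.
move=> [mp bp]; split=> //.
have := @nrm2M K phi (fun _ => 1) (conj mp bp) (cmeasurable_cst 1).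
under eq_fun do rewrite mulr1; move=> h; apply: le_lt_trans h _.
apply: lte_mul_pinfty => //; rewrite ?lee_fin ?sqr_ge0// /nrm2.
under eq_integral do rewrite ComplexField.Normc.normc1 expr1n.
by rewrite integral_cst//= [X in (_ * X)%E](haar_setT R) mule1 ltry.
Qed.

Lemma L2_M K phi psi : bmeas K phi -> L2fun psi -> L2fun (fun z => phi z * psi z).
Proof.
move=> bp [mq fq]; split; first by apply: cmeasurableM => //; case: bp.
apply: le_lt_trans (nrm2M bp mq) _.
by rewrite lte_mul_pinfty ?lee_fin ?sqr_ge0.
Qed.

Lemma nrm2_cvg0 (K : R) (c : nat -> T -> R[i]) psi : L2fun psi ->
  (forall j, bmeas K (c j)) -> (forall z, c j z @[j --> \oo] --> 0) ->
  nrm2 (fun z => c j z * psi z) @[j --> \oo] --> 0%E.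
Proof.
move=> [mq fq] bc c0.
have K0 : 0 <= K by have [_ b] := bc 0; exact: le_trans (cabs_ge0 _) (b (cexp 0)).
have mf j : measurable_fun setT (fun z => (cabs (c j z * psi z) ^+ 2)%:E).
  apply/measurable_EFinP; apply: measurable_cabs_sqr; apply: cmeasurableM => //.
  by case: (bc j).
have := @dominated_convergence _ _ R haar setT measurableT
  (fun j z => (cabs (c j z * psi z) ^+ 2)%:E) (cst 0%E)
  (fun z => ((K ^+ 2)%:E * (cabs (psi z) ^+ 2)%:E)%E) mf (measurable_cst _).
case.
- apply: aeW => z _; apply/fine_cvgP; split; first exact: nearW.
  apply/cvg_realP => e e0 /=.
  (* The [+ 1] covers the points where [psi] vanishes. *)
  have e' : 0 < e / (cabs (psi z) ^+ 2 + 1) by rewrite divr_gt0// ltr_wpDl ?sqr_ge0.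
  have e'' : 0 < Num.sqrt (e / (cabs (psi z) ^+ 2 + 1)) by rewrite sqrtr_gt0.
  have /cvg_complexP/(_ _ e'') := c0 z; apply: filterS => j; rewrite subr0 => cj.
  rewrite subr0 ger0_norm ?sqr_ge0// cabs_sqrM.
  have {}cj : cabs (c j z) ^+ 2 < e / (cabs (psi z) ^+ 2 + 1).
    by rewrite -(sqr_sqrtr (ltW e')) ltrXn2r ?nnegrE ?cabs_ge0.
  rewrite ltr_pdivlMr in cj; last by rewrite ltr_wpDl ?sqr_ge0.
  by apply: le_lt_trans cj; rewrite ler_wpM2l ?sqr_ge0// lerDl.
- apply/integrableP; split.
    by apply/measurable_EFinP; apply: measurable_funM => //; exact: measurable_cabs_sqr.
  under eq_integral => z _ do rewrite gee0_abs ?mule_ge0 ?lee_fin ?sqr_ge0//.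
  rewrite ge0_integralZl//=.
  + by rewrite lte_mul_pinfty// lee_fin sqr_ge0.
  + by apply/measurable_EFinP; exact: measurable_cabs_sqr.
  + by move=> z _; rewrite lee_fin sqr_ge0.
  + by rewrite lee_fin sqr_ge0.
- apply: aeW => z j _; rewrite gee0_abs; last by rewrite lee_fin sqr_ge0.
  rewrite -EFinM lee_fin cabs_sqrM ler_wpM2r ?sqr_ge0// lerXn2r ?nnegrE ?cabs_ge0//.
  by case: (bc j).
- by move=> _ _; rewrite integral0.
Qed.

Lemma site_cvg0 n (K : R) (c : nat -> T -> R[i]) psi : L2fun psi ->
  (forall j, bmeas K (c j)) -> (forall z, c j z @[j --> \oo] --> 0) ->
  hnorm (site n (fun z => c j z * psi z)) @[j --> \oo] --> 0.
Proof.
move=> lq bc c0; have /fine_cvgP[_ h] := nrm2_cvg0 lq bc c0.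
have -> : (fun j => hnorm (site n (fun z => c j z * psi z))) =
    (fun j => Num.sqrt (fine (nrm2 (fun z => c j z * psi z)))).
  apply/funext => j; rewrite hnormE; congr Num.sqrt; apply: EFin_inj.
  have lj := L2_M (bc j) lq; rewrite hsq_site// fineK// ge0_fin_numE ?nrm2_ge0//.
  by case: lj.
rewrite -[X in _ --> X](@sqrtr0 R); apply: (continuous_cvg _ (@sqrt_continuous R 0)); exact: h.
Qed.

Definition restr (r : seq int) x : H := hmk (fun n z => if n \in r then hrepr x n z else 0).

Lemma l2_restr (r : seq int) x : l2 (fun n z => if n \in r then hrepr x n z else 0).
Proof.
split.
  by move=> n; case: (n \in r); [exact: cmeas_repr|exact: cmeasurable_cst].
have [_] := l2_repr x; apply: le_lt_trans; apply: le_esum => n _.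
by case: (n \in r) => //; rewrite nrm20 nrm2_ge0.
Qed.

Lemma restr_cons k (r : seq int) x : k \notin r -> restr (k :: r) x = site k (hrepr x k) + restr r x.
Proof.
move=> kr; rewrite -[site _ _]scale1r -hmk_lin; try exact: l2_restr; last by apply: l2_site; exact: L2_repr.
congr hmk; apply/funext => n; apply/funext => z; rewrite inE mul1r.
by have [->|nk] /= := eqVneq n k; [rewrite (negbTE kr) addr0|rewrite add0r].
Qed.

Lemma restr_sum (r : seq int) x : uniq r -> restr r x = \sum_(k <- r) site k (hrepr x k).
Proof.
elim: r => [|k r IH] /=; last by move=> /andP[kr ur]; rewrite restr_cons// big_cons IH.
rewrite big_nil => _; apply: hext => n.
apply: ae2 (hrepr_hmk n (l2_restr [::] x)) (hrepr0 R n) => z.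
by move=> -> ->.
Qed.

Lemma restr_approx x (e : R) : 0 < e -> exists2 r, uniq r & hnorm (x - restr r x) <= e.
Proof.
move=> e0; have e20 : 0 < e ^+ 2 by rewrite exprn_gt0.
have Efin : (\esum_(n in [set: int]) nrm2 (hrepr x n))%E \is a fin_num.
  by have := hsq_fin x; rewrite /nsq => <-.
have [_ [X [finX _] <-]] := ub_ereal_sup_adherent e20 Efin.
rewrite -/(esum _ _) => ltX.
have [r ur Xr] : exists2 r, uniq r & X = [set` r].
  have /finite_seqP[r ->] := finX; exists (undup r); rewrite ?undup_uniq//.
  by apply/seteqP; split => k /=; rewrite mem_undup.
exists r => //.
rewrite Xr -fsbig_seq// in ltX.
(* The total splits into a tail [w] and a head [v]; the head comes within e^2 of the total, so the
   tail, which is the squared norm of the error, is at most e^2. *)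
pose w n := if n \in r then 0%E else nrm2 (hrepr x n).
pose v n := if n \in r then nrm2 (hrepr x n) else 0%E.
have wv : (\esum_(n in [set: int]) nrm2 (hrepr x n) =
    \esum_(n in [set: int]) w n + \esum_(n in [set: int]) v n)%E.
  rewrite -esumD.
  - by apply: eq_esum => n _; rewrite /w /v; case: ifP => _; rewrite ?add0e ?adde0.
  - by move=> n _; rewrite /w; case: ifP => // _; exact: nrm2_ge0.
  - by move=> n _; rewrite /v; case: ifP => // _; exact: nrm2_ge0.
have vr : (\sum_(k <- r) nrm2 (hrepr x k) <= \esum_(n in [set: int]) v n)%E.
  rewrite (eq_big_seq v); first exact: ge_esum_seq.
  by move=> k kr; rewrite /v kr.
have we : (\esum_(n in [set: int]) w n <= (e ^+ 2)%:E)%E.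
  have w0 : (0 <= \esum_(n in [set: int]) w n)%E.
    by apply: esum_ge0 => n _; rewrite /w; case: ifP => // _; exact: nrm2_ge0.
  have v0 : (0 <= \esum_(n in [set: int]) v n)%E.
    by apply: esum_ge0 => n _; rewrite /v; case: ifP => // _; exact: nrm2_ge0.
  move: ltX vr Efin; rewrite wv.
  move: (\esum_(n in _) w n)%E (\esum_(n in _) v n)%E (\sum_(k <- r) _)%E w0 v0 => [a| |] [b| |] [c| |] //=.
  by rewrite !lee_fin -!EFinD lte_fin; lra.
suff : hsq (x - restr r x) <= e ^+ 2.
  by rewrite -hnorm_sqr ler_pXn2r// nnegrE ?hnorm_ge0// ltW.
rewrite -lee_fin hsq_fin.
apply: le_trans we; rewrite le_eqVlt; apply/orP; left; apply/eqP.
apply: eq_esum => n _.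
have -> : w n = nrm2 (fun z => if n \in r then 0 else hrepr x n z).
  by rewrite /w; case: ifP => // _; rewrite nrm20.
apply: nrm2_ae; first exact: cmeas_repr.
  by case: (n \in r); [exact: cmeasurable_cst|exact: cmeas_repr].
rewrite [x - _]addrC -[- restr r x]scaleN1r.
apply: (ae2 _ (hrepr_lin (-1) (restr r x) x n) (hrepr_hmk n (l2_restr r x))) => z -> ->.
by case: (n \in r); [rewrite mulN1r addNr|rewrite mulr0 add0r].
Qed.

(** Density in the form of an induction principle: a vector is approximated by its restriction to
    finitely many coordinates, and each L^2 coordinate by a bounded truncation. Scalars are absorbed
    into [phi]. *)
Lemma H_ind (P : H -> Prop) : P 0 -> (forall x y, P x -> P y -> P (x + y)) ->
  (forall x, (forall e : R, 0 < e -> exists2 y, P y & hnorm (x - y) <= e) -> P x) ->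
  (forall n K phi, bmeas K phi -> P (site n phi)) -> forall x, P x.
Proof.
move=> P0 PD Plim Psite.
have PL2 n phi : L2fun phi -> P (site n phi).
  move=> lp; have [mp fp] := lp; apply: Plim => e e0.
  (* [d j] marks where [phi] is large. It tends to 0 pointwise, so by dominated convergence the part
     removed from [phi] becomes small in norm. *)
  pose d (j : nat) z : R[i] := if cabs (phi z) ^+ 2 <= j%:R then 0 else 1.
  have bif j (a b : R[i]) : cmeasurable (fun z => if cabs (phi z) ^+ 2 <= j%:R then a else b).
    split.
      rewrite (_ : (fun z => _) = fun z => if cabs (phi z) ^+ 2 <= j%:R then complex.Re a else complex.Re b); last by apply/funext => z; case: ifP.
      by apply: measurable_fun_ifT => //; apply: measurable_fun_ler => //; exact: measurable_cabs_sqr.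
    rewrite (_ : (fun z => _) = fun z => if cabs (phi z) ^+ 2 <= j%:R then complex.Im a else complex.Im b); last by apply/funext => z; case: ifP.
    by apply: measurable_fun_ifT => //; apply: measurable_fun_ler => //; exact: measurable_cabs_sqr.
  have bd j : bmeas 1 (d j).
    split; first exact: bif.
    by move=> z; rewrite /d; case: ifP => _; rewrite ?ComplexField.Normc.normc0 ?ComplexField.Normc.normc1.
  have dcvg z : d j z @[j --> \oo] --> 0.
    apply/cvg_complexP => e1 e10; exists (Num.truncn (cabs (phi z) ^+ 2)).+1 => // j /= hj.
    rewrite /d ifT ?subrr ?ComplexField.Normc.normc0//.
    apply/ltW; apply: lt_le_trans (truncnS_gt _) _; by rewrite ler_nat.
  have /cvg_realP/(_ e e0) [j _ /(_ j (leqnn j))] := site_cvg0 n lp bd dcvg.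
  rewrite subr0 ger0_norm ?hnorm_ge0// => /ltW hj.
  pose phi' z := (1 - d j z) * phi z.
  have bphi' : bmeas (Num.sqrt j%:R) phi'.
    split.
      apply: cmeasurableM => //; rewrite (_ : (fun z => _) = fun z => if cabs (phi z) ^+ 2 <= j%:R then 1 else 0); first exact: bif.
      by apply/funext => z; rewrite /d; case: ifP => _; rewrite ?subr0 ?subrr.
    move=> z; rewrite /phi' /d; case: ifP => h; last by rewrite subrr mul0r ComplexField.Normc.normc0 sqrtr_ge0.
    by rewrite subr0 mul1r -[leLHS](ger0_norm (cabs_ge0 _)) -sqrtr_sqr ler_wsqrtr.
  exists (site n phi'); first exact: Psite bphi'.
  rewrite (_ : site n phi - site n phi' = site n (fun z => d j z * phi z))//.
  rewrite [LHS]addrC -[- site n phi']scaleN1r -(site_lin n (-1) (L2_bmeas bphi') lp).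
  by congr site; apply/funext => z; rewrite /phi'; ring.
move=> x; apply: Plim => e e0; have [r ur re] := restr_approx x e0.
exists (restr r x) => //; rewrite restr_sum//.
elim: r {ur re} => [|k r IH]; first by rewrite big_nil.
by rewrite big_cons; apply: PD => //; apply: PL2; exact: L2_repr.
Qed.

End WeightedOperators.

(** * Bounded Borel functions as limits of trigonometric polynomials *)

Section BoundedMeasurable.
Variable R : realType.
Local Notation T := (circle R).
Implicit Types (phi psi : T -> R[i]) (r : T -> R).

Lemma cabs0 : cabs (0 : R[i]) = 0. Proof. exact: ComplexField.Normc.normc0. Qed.
Lemma cabs1 : cabs (1 : R[i]) = 1. Proof. exact: ComplexField.Normc.normc1. Qed.

Lemma cabs_circle (z : T) : cabs (circle_val z) = 1.
Proof. by apply: complexI; rewrite -[LHS]/(`|circle_val z|) norm_circle. Qed.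

Lemma circle_conj (z : T) : (circle_val z)^* = (circle_val z)^-1.
Proof.
have z1 : circle_val z * (circle_val z)^* = 1.
  have := cabs_sqr (circle_val z); rewrite cabs_circle expr1n.
  case: (circle_val z) => a b /= e; apply/eqP; rewrite eq_complex /=.
  by apply/andP; split; apply/eqP; [rewrite -!expr2 mulrN opprK -!expr2 -e|ring].
have z0 : circle_val z != 0.
  by apply/eqP => z0; have := cabs_circle z; rewrite z0 cabs0 => /eqP; rewrite eq_sym oner_eq0.
by apply: (mulfI z0); rewrite z1 mulfV.
Qed.

Lemma circle_val_neq0 (z : T) : circle_val z != 0.
Proof. by apply/eqP => z0; have := cabs_circle z; rewrite z0 cabs0 => /eqP; rewrite eq_sym oner_eq0. Qed.

Lemma circle_conjX (z : T) (l : int) : (circle_val z ^ l)^* = circle_val z ^ (- l).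
Proof.
case: l => n; first by rewrite -[in LHS]exprnP rmorphXn /= circle_conj exprVn -exprnN.
rewrite NegzE opprK -exprnN -[RHS]exprnP fmorphV rmorphXn /= circle_conj.
by rewrite exprVn invrK.
Qed.

Lemma cabs_circleX (z : T) (l : int) : cabs (circle_val z ^ l) = 1.
Proof.
suff h (n : nat) : cabs (circle_val z ^+ n) = 1.
  case: l => n; first exact: h.
  by rewrite NegzE -exprnN ComplexField.Normc.normcV h invr1.
by elim: n => [|n IH]; rewrite ?expr0 ?cabs1// exprS cabsM IH cabs_circle mulr1.
Qed.

Lemma continuous_measurable (g : T -> R) : continuous g -> measurable_fun setT g.
Proof.
move=> cg; apply: (measurability _ (RGenOInfty.measurableE R)) => //.
move=> _ [_ [x ->] <-]; rewrite setTI; apply: sub_sigma_algebra.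
by apply: open_comp => [y _|]; [exact: cg|exact: interval_open].
Qed.

Lemma continuous_cmeasurable phi : continuous phi -> cmeasurable phi.
Proof.
move=> cp; split; apply: continuous_measurable => z.
  exact: cvg_Re (cp z).
exact: cvg_Im (cp z).
Qed.

Lemma continuous_circle_val : continuous (@circle_val R).
Proof. exact: initial_continuous. Qed.

Lemma cmeasurable_circleX (l : int) : cmeasurable (fun z : T => circle_val z ^ l).
Proof.
have h (n : nat) : cmeasurable (fun z : T => circle_val z ^+ n).
  elim: n => [|n IH]; first by under eq_fun do rewrite expr0; exact: cmeasurable_cst.
  under eq_fun do rewrite exprS; apply: cmeasurableM => //.
  exact/continuous_cmeasurable/continuous_circle_val.
case: l => n; first exact: h.
rewrite (_ : (fun z => _) = fun z => (circle_val z ^+ n.+1)^*); first exact: cmeasurableJ.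
by apply/funext => z; rewrite NegzE -circle_conjX.
Qed.

Lemma bmeas_circleX (l : int) : bmeas 1 (fun z : T => circle_val z ^ l).
Proof. by split=> [|z]; [exact: cmeasurable_circleX|rewrite cabs_circleX]. Qed.

Lemma bmeas_lin a K L phi psi : bmeas K phi -> bmeas L psi ->
  bmeas (cabs a * K + L) (fun z => a * phi z + psi z).
Proof.
move=> [mp bp] [mq bq]; split; first exact: cmeasurable_lin.
move=> z; apply: le_trans (cabsD _ _) _; rewrite cabsM lerD//.
by rewrite ler_wpM2l ?cabs_ge0.
Qed.

Lemma bmeas_M K L phi psi : bmeas K phi -> bmeas L psi -> bmeas (K * L) (fun z => phi z * psi z).
Proof.
move=> [mp bp] [mq bq]; split; first exact: cmeasurableM.
by move=> z; rewrite cabsM ler_pM ?cabs_ge0.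
Qed.

Lemma bmeas_lim K (phi_ : nat -> T -> R[i]) phi : (forall j, bmeas K (phi_ j)) ->
  (forall z, phi_ j z @[j --> \oo] --> phi z) -> bmeas K phi.
Proof.
move=> bp pp; split.
  split.
    apply: (@measurable_fun_cvg _ _ _ setT (fun j z => complex.Re (phi_ j z))).
      by move=> j; case: (bp j) => -[].
    by move=> z _; exact: cvg_Re (pp z).
  apply: (@measurable_fun_cvg _ _ _ setT (fun j z => complex.Im (phi_ j z))).
    by move=> j; case: (bp j) => -[].
  by move=> z _; exact: cvg_Im (pp z).
move=> z; apply/ler_addgt0Pr => e e0.
have /cvg_complexP/(_ e e0)[j _ /(_ j (leqnn j))] := pp z.
rewrite cabsB => h; rewrite -(subrK (phi_ j z) (phi z)) addrC.
apply: le_trans (cabsD _ _) _; apply: lerD; last exact: ltW.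
by case: (bp j).
Qed.

(** A monotone class of functions, shown below to contain every bounded Borel function. The common
    bound [K] in the limit clause is what makes dominated convergence available in arguments by
    induction on the class. *)
Inductive Bcls : (T -> R[i]) -> Prop :=
| Bcls_mono (l : int) : Bcls (fun z => circle_val z ^ l)
| Bcls_lin a phi psi : Bcls phi -> Bcls psi -> Bcls (fun z => a * phi z + psi z)
| Bcls_lim K (phi_ : nat -> T -> R[i]) phi : (forall j, bmeas K (phi_ j)) ->
    (forall j, Bcls (phi_ j)) -> (forall z, phi_ j z @[j --> \oo] --> phi z) -> Bcls phi.

Lemma Bcls_bmeas phi : Bcls phi -> exists K, bmeas K phi.
Proof.
elim=> [l|a p q _ [K bp] _ [L bq]|K p_ p bp _ _ pp].
- by exists 1; exact: bmeas_circleX.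
- by eexists; exact: bmeas_lin bp bq.
- by exists K; exact: bmeas_lim bp pp.
Qed.

Lemma cvgcM (u : nat -> R[i]) (a b : R[i]) : u @ \oo --> a -> b * u j @[j --> \oo] --> b * a.
Proof.
move=> /cvg_complexP ua; apply/cvg_complexP => e e0.
have b0 : 0 < cabs b + 1 by rewrite ltr_wpDl ?cabs_ge0.
have e' : 0 < e / (cabs b + 1) by rewrite divr_gt0.
apply: filterS (ua _ e') => j; rewrite -mulrBr cabsM ltr_pdivlMr// mulrC => h.
by apply: le_lt_trans h; rewrite ler_wpM2r ?cabs_ge0// lerDl.
Qed.

Lemma Bcls_monoM phi (k : int) : Bcls phi -> Bcls (fun z => circle_val z ^ k * phi z).
Proof.
elim=> [l|a p q _ ip _ iq|K p_ p bp _ ip pp].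
- rewrite (_ : (fun z => _) = fun z => circle_val z ^ (k + l)); first exact: Bcls_mono.
  by apply/funext => z; rewrite expfzDr// circle_val_neq0.
- rewrite (_ : (fun z => _) = fun z => a * (circle_val z ^ k * p z) + circle_val z ^ k * q z).
    exact: Bcls_lin.
  by apply/funext => z; ring.
- apply: (@Bcls_lim (1 * K) (fun j z => circle_val z ^ k * p_ j z)); [|exact: ip|].
    by move=> j; exact: bmeas_M (bmeas_circleX k) (bp j).
  by move=> z; apply: cvgcM; exact: pp.
Qed.

(** Induction on one factor with the other one fixed; the monomial case is [Bcls_monoM], itself an
    induction on the second factor. *)
Lemma BclsM phi psi : Bcls phi -> Bcls psi -> Bcls (fun z => phi z * psi z).
Proof.
move=> Bphi Bpsi; have [L bL] := Bcls_bmeas Bpsi.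
elim: Bphi => [l|a p q _ ip _ iq|K p_ p bp _ ip pp].
- exact: Bcls_monoM.
- rewrite (_ : (fun z => _) = fun z => a * (p z * psi z) + q z * psi z).
    exact: Bcls_lin.
  by apply/funext => z; ring.
- apply: (@Bcls_lim (K * L) (fun j z => p_ j z * psi z)); [|exact: ip|].
    by move=> j; exact: bmeas_M.
  by move=> z; rewrite mulrC; under eq_fun do rewrite mulrC; apply: cvgcM; exact: pp.
Qed.

Lemma Bcls1 : Bcls (fun _ => 1).
Proof. exact: (Bcls_mono 0). Qed.

Lemma Bcls0 : Bcls (fun _ => 0).
Proof.
by have := Bcls_lin (-1) Bcls1 Bcls1; under eq_fun do rewrite mulr1 addNr.
Qed.

Lemma BclsZ a phi : Bcls phi -> Bcls (fun z => a * phi z).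
Proof. by move=> /(Bcls_lin a)/(_ Bcls0); under eq_fun do rewrite addr0. Qed.

Lemma BclsD phi psi : Bcls phi -> Bcls psi -> Bcls (fun z => phi z + psi z).
Proof. by move=> /(Bcls_lin 1) h /h; under eq_fun do rewrite mul1r. Qed.

Lemma Bcls_cst a : Bcls (fun _ => a).
Proof. by have := BclsZ a Bcls1; under eq_fun do rewrite mulr1. Qed.

Lemma BclsJ phi : Bcls phi -> Bcls (fun z => (phi z)^*).
Proof.
elim=> [l|a p q _ ip _ iq|K p_ p bp _ ip pp].
- by under eq_fun do rewrite circle_conjX; exact: Bcls_mono.
- under eq_fun do rewrite rmorphD rmorphM /=; exact: Bcls_lin.
- apply: (@Bcls_lim K (fun j z => (p_ j z)^*)); [|exact: ip|].
    move=> j; have [m b] := bp j; split; first exact: cmeasurableJ.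
    by move=> z; rewrite cabsJ.
  move=> z; apply/cvg_complexP => e e0; have /cvg_complexP/(_ e e0) := pp z.
  by apply: filterS => j; rewrite -rmorphB cabsJ.
Qed.

Definition Breal r : Prop := Bcls (fun z => (r z)%:C).

Lemma Breal_lin (a : R) r s : Breal r -> Breal s -> Breal (fun z => a * r z + s z).
Proof.
move=> br bs; rewrite /Breal (_ : (fun z => _) = fun z => a%:C * (r z)%:C + (s z)%:C).
  exact: Bcls_lin.
by apply/funext => z; rewrite rmorphD rmorphM.
Qed.

Lemma Breal_cst (a : R) : Breal (fun _ => a).
Proof. exact: Bcls_cst. Qed.

Lemma BrealZ (a : R) r : Breal r -> Breal (fun z => a * r z).
Proof. by move=> /(Breal_lin a)/(_ (Breal_cst 0)); under eq_fun do rewrite addr0. Qed.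

Lemma BrealD r s : Breal r -> Breal s -> Breal (fun z => r z + s z).
Proof. by move=> /(Breal_lin 1) h /h; under eq_fun do rewrite mul1r. Qed.

Lemma BrealB r s : Breal r -> Breal s -> Breal (fun z => r z - s z).
Proof.
move=> br bs; have := BrealD br (BrealZ (-1) bs).
by under eq_fun do rewrite mulN1r.
Qed.

Lemma BrealM r s : Breal r -> Breal s -> Breal (fun z => r z * s z).
Proof.
move=> br bs; rewrite /Breal (_ : (fun z => _) = fun z => (r z)%:C * (s z)%:C).
  exact: BclsM.
by apply/funext => z; rewrite rmorphM.
Qed.

Lemma BrealX r n : Breal r -> Breal (fun z => r z ^+ n).
Proof.
move=> br; elim: n => [|n IH]; first by under eq_fun do rewrite expr0; exact: Breal_cst.
by under eq_fun do rewrite exprS; exact: BrealM.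
Qed.

Lemma Breal_measurable r : Breal r -> measurable_fun setT r.
Proof. by move=> /Bcls_bmeas[K [[]]]. Qed.

Lemma Breal_lim (K : R) (r_ : nat -> T -> R) r : (forall j, Breal (r_ j)) ->
  (forall j z, `|r_ j z| <= K) -> (forall z, r_ j z @[j --> \oo] --> r z) -> Breal r.
Proof.
move=> br bK rr; apply: (@Bcls_lim K (fun j z => (r_ j z)%:C)); [|exact: br|].
  move=> j; split; last by move=> z; rewrite cabsR.
  by have [L []] := Bcls_bmeas (br j).
by move=> z; apply: cvg_ReIm => /=; [exact: rr|exact: cvg_cst].
Qed.

(* The polynomials p_0 = 0, p_(n+1)(t) = p_n(t) + (t^2 - p_n(t)^2) / 2 increase to |t| on [-1, 1]. *)
Fixpoint abs_poly (n : nat) (t : R) : R :=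
  if n is m.+1 then abs_poly m t + (t ^+ 2 - abs_poly m t ^+ 2) / 2 else 0.

(** The recursion gives |t| - p_(n+1) = (|t| - p_n) (1 - (|t| + p_n) / 2), and the last factor lies
    between 0 and 1 - |t| / 2. *)
Lemma abs_poly_bound n t : `|t| <= 1 ->
  0 <= abs_poly n t <= `|t| /\ `|t| - abs_poly n t <= `|t| * (1 - `|t| / 2) ^+ n.
Proof.
move=> t1; have t0 := normr_ge0 t; have tt : t ^+ 2 = `|t| ^+ 2 by rewrite real_normK ?num_real.
elim: n => [|n [/andP[p0 pt] pe]]; first by rewrite /= lexx t0 subr0 expr0 mulr1.
rewrite /= tt; move: (abs_poly n t) p0 pt pe => p p0 pt pe.
have q0 : 0 <= (1 - `|t| / 2) ^+ n by rewrite exprn_ge0//; lra.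
split; first by apply/andP; split; nra.
rewrite [_ ^+ n.+1]exprSr mulrA; apply: le_trans (_ : (`|t| - p) * (1 - `|t| / 2) <= _); first by nra.
by apply: ler_wpM2r => //; lra.
Qed.

Lemma abs_poly_cvg t : `|t| <= 1 -> abs_poly n t @[n --> \oo] --> `|t|.
Proof.
move=> t1; have [->|t0] := eqVneq t 0.
  rewrite normr0 (_ : (fun n => _) = fun _ => 0); first exact: cvg_cst.
  apply/funext => n; have := @abs_poly_bound n 0; rewrite normr0 => /(_ ler01)[h _].
  by apply/eqP; rewrite eq_le andbC.
have tp : 0 < `|t| by rewrite normr_gt0.
have q1 : `|1 - `|t| / 2| < 1 by rewrite ger0_norm; lra.
have /cvg_realP h := cvg_expr q1; apply/cvg_realP => e e0.
apply: filterS (h e e0) => n; rewrite subr0 ger0_norm; last by rewrite exprn_ge0//; lra.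
have [/andP[p0 pt] pe] := abs_poly_bound n t1 => qe.
rewrite distrC ger0_norm ?subr_ge0//; apply: le_lt_trans pe _; apply: le_lt_trans qe.
by rewrite ler_piMl// exprn_ge0//; lra.
Qed.

Lemma Breal_abs r : (forall z, `|r z| <= 1) -> Breal r -> Breal (fun z => `|r z|).
Proof.
move=> r1 br; apply: (@Breal_lim 1 (fun n z => abs_poly n (r z))).
- elim=> [|n IH] /=; first exact: Breal_cst.
  apply: BrealD => //; rewrite (_ : (fun z => _) = fun z => 2^-1 * (r z ^+ 2 - abs_poly n (r z) ^+ 2)).
    by apply: BrealZ; apply: BrealB; exact: BrealX.
  by apply/funext => z; rewrite mulrC.
- move=> n z; have [/andP[p0 pt] _] := abs_poly_bound n (r1 z).
  by rewrite ger0_norm//; exact: le_trans (r1 z).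
- by move=> z; exact: abs_poly_cvg.
Qed.

Definition Bset (E : set T) : Prop := Breal (fun z => (z \in E)%:R).

(** If t is the positive part of r / K, with values in [0, 1], then 1 - (1 - t)^n increases to the
    indicator of the set where t > 0. *)
Lemma Bset_gt0 (K : R) r : 0 < K -> (forall z, `|r z| <= K) -> Breal r -> Bset [set z | 0 < r z].
Proof.
move=> K0 rK br.
pose s z := K^-1 * r z.
have s1 z : `|s z| <= 1 by rewrite /s normrM (@ger0_norm _ K^-1) ?invr_ge0 ?(ltW K0)// ler_pdivrMl// mulr1.
have bs : Breal s by exact: BrealZ.
pose t z := 2^-1 * (s z + `|s z|).
have bt : Breal t by apply: BrealZ; apply: BrealD => //; exact: Breal_abs.
have t01 z : 0 <= t z <= 1.
  have := s1 z; have := ler_norm (s z); have := lerNnormlW (lexx `|s z|).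
  by rewrite /t; move: (s z) `|s z| => a b; lra.
apply: (@Breal_lim 1 (fun n z => 1 - (1 - t z) ^+ n)).
- by move=> n; apply: BrealB; [exact: Breal_cst|apply: BrealX; apply: BrealB => //; exact: Breal_cst].
- move=> n z; have /andP[t0 t1] := t01 z.
  have q0 : 0 <= (1 - t z) ^+ n by rewrite exprn_ge0// subr_ge0.
  have q1 : (1 - t z) ^+ n <= 1 by rewrite exprn_ile1// ?subr_ge0// gerBl.
  by rewrite ger0_norm; lra.
- move=> z; have /andP[t0 t1] := t01 z.
  have [rz|rz] := ltP 0 (r z).
    rewrite mem_set//= -[X in _ --> X]subr0; apply: cvgB; first exact: cvg_cst.
    apply: cvg_expr; rewrite ger0_norm ?subr_ge0// gtrBl.
    have sp : 0 < s z by rewrite mulr_gt0 ?invr_gt0.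
    by rewrite /t ger0_norm ?ltW//; lra.
  rewrite memNset /=; last by move=> /=; rewrite ltNge rz.
  have tz : t z = 0.
    have s0 : s z <= 0 by rewrite /s mulr_ge0_le0 ?invr_ge0 ?(ltW K0).
    by rewrite /t (ler0_norm s0) subrr mulr0.
  rewrite tz subr0; under eq_fun do rewrite expr1n subrr; exact: cvg_cst.
Qed.

Lemma BsetC E : Bset E -> Bset (~` E).
Proof.
move=> bE; rewrite /Bset (_ : (fun z => _) = fun z => 1 - (z \in E)%:R).
  by apply: BrealB => //; exact: Breal_cst.
by apply/funext => z; rewrite in_setC; case: (z \in E); rewrite ?subrr ?subr0.
Qed.

Lemma BsetU E F : Bset E -> Bset F -> Bset (E `|` F).
Proof.
move=> bE bF; rewrite -[E]setCK -[F]setCK -setCI; apply: BsetC.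
rewrite /Bset (_ : (fun z => _) = fun z => (z \in ~` E)%:R * (z \in ~` F)%:R).
  by apply: BrealM; exact: BsetC.
by apply/funext => z; rewrite in_setI -natrM mulnb.
Qed.

Lemma Bset0 : Bset set0.
Proof. by rewrite /Bset; under eq_fun do rewrite in_set0; exact: Breal_cst. Qed.

Lemma Bset_bigcup (E : nat -> set T) : (forall n, Bset (E n)) -> Bset (\bigcup_n E n).
Proof.
move=> bE; pose F n := \bigcup_(i in [set i | (i < n)%N]) E i.
have bF n : Bset (F n).
  elim: n => [|n IH].
    rewrite (_ : F 0%N = set0); first exact: Bset0.
    by apply/seteqP; split=> z // -[].
  rewrite (_ : F n.+1 = F n `|` E n); first exact: BsetU.
  apply/seteqP; split=> z.
    move=> [i /=]; rewrite ltnS leq_eqVlt => /orP[/eqP -> ?|ni Ei]; first by right.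
    by left; exists i.
  by move=> [[i /= ni Ei]|Ez]; [exists i => //=; exact: ltnW|exists n => /=].
apply: (@Breal_lim 1 (fun n z => (z \in F n)%:R)); [exact: bF| |].
  by move=> n z; case: (z \in _); rewrite ?normr1 ?normr0.
move=> z; have [zE|zE] := pselect ((\bigcup_n E n) z).
  have [m _ Em] := zE; apply/cvg_realP => e e0; exists m.+1 => // n /= mn.
  by rewrite mem_set//; [rewrite mem_set ?subrr ?normr0|exists m].
rewrite memNset//; apply/cvg_realP => e e0; apply: nearW => n.
rewrite memNset ?subrr ?normr0// => -[i _ Ei]; apply: zE.
by exists i.
Qed.

(** The modulus is squared so that the defining function is a trigonometric polynomial; [e] is
    therefore the square of the radius. *)
Definition cdisk (c : R[i]) (e : R) : set T := [set z | cabs (circle_val z - c) ^+ 2 < e].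

Lemma Bset_cdisk c e : Bset (cdisk c e).
Proof.
pose r (z : T) := e - cabs (circle_val z - c) ^+ 2.
have br : Breal r.
  apply: BrealB; first exact: Breal_cst.
  rewrite /Breal (_ : (fun z => _) = fun z => (circle_val z - c) * (circle_val z - c)^*).
    have h : Bcls (fun z => circle_val z - c).
      by apply: BclsD; [exact: (Bcls_mono 1)|exact: Bcls_cst].
    by apply: BclsM => //; exact: BclsJ.
  apply/funext => z; rewrite cabs_sqr; case: (_ - _) => a b.
  by apply/eqP; rewrite eq_complex /=; apply/andP; split; apply/eqP; ring.
have [K [_ bK]] := Bcls_bmeas br.
rewrite (_ : cdisk c e = [set z | 0 < r z]).
  apply: (@Bset_gt0 (K + 1)) => //.
    by rewrite ltr_wpDl// (le_trans (cabs_ge0 _) (bK (cexp 0))).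
  by move=> z; have := bK z; rewrite cabsR => h; rewrite (le_trans h)// lerDl.
by apply/seteqP; split=> z; rewrite /cdisk /r /= subr_gt0.
Qed.

(** Each coordinate of the centre is approximated within half of the radius 1 / (k + 1), so [z] lies
    in the disk; the diameter 2 / (k + 1) is below [e], so the disk stays in [O]. *)
Lemma open_cdisk (O : set T) z : open O -> O z ->
  exists (p q : rat) (k : nat), let c := (ratr p : R) +i* ratr q in
    cdisk c (k.+1%:R^-1 ^+ 2) z /\ cdisk c (k.+1%:R^-1 ^+ 2) `<=` O.
Proof.
move=> [U oU <-] /= Uz.
have /nbhs_normP[[e i] /=] : nbhs (set_val z) U by exact: open_nbhs_nbhs.
rewrite ltcE /= => /andP[/eqP -> {i}] e0 eU.
have [k ke] : exists k : nat, k.+1%:R^-1 < e / 2.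
  have := near_infty_natSinv_lt (PosNum (_ : 0 < e / 2)).
  by move=> /(_ (divr_gt0 e0 (ltr0n _ 2)))[k _ /(_ k (leqnn k))]; exists k.
have d0 : 0 < k.+1%:R^-1 / 2 :> R by rewrite divr_gt0 ?invr_gt0.
have approx (x : R) : exists p : rat, `|x - ratr p| < k.+1%:R^-1 / 2.
  move: (k.+1%:R^-1 / 2) d0 => d d0.
  have /rat_in_itvoo[p] : x - d < x + d by lra.
  by rewrite in_itv /= => /andP[h1 h2]; exists p; rewrite ltr_norml; apply/andP; split; lra.
have [p hp] := approx (complex.Re (circle_val z)).
have [q hq] := approx (complex.Im (circle_val z)).
exists p, q, k; set c := _ +i* _.
have zc : cabs (circle_val z - c) < k.+1%:R^-1.
  apply: le_lt_trans (cabs_ReIm _) _; rewrite [ltRHS]splitr /c.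
  by case: (circle_val z) hp hq => a b /= hp hq; apply: ltrD.
have k0 : 0 <= k.+1%:R^-1 :> R by rewrite invr_ge0.
split; first by rewrite /cdisk /= ltrXn2r ?nnegrE ?cabs_ge0.
move=> w; rewrite /cdisk /= ltr_pXn2r ?nnegrE ?cabs_ge0// => wc.
suff h : cabs (set_val z - set_val w) < e by apply: eU; have := h; rewrite -ltcR.
rewrite -(subrK c (set_val z)) -addrA; apply: le_lt_trans (cabsD _ _) _.
have {}wc : cabs (c - set_val w) < k.+1%:R^-1 by rewrite cabsB.
by rewrite (splitr e); apply: ltrD; [exact: lt_trans ke|exact: lt_trans ke].
Qed.

(** The sets with [Bset] form a sigma-algebra, and an open set is a countable union of disks with
    rational data. *)
Lemma Bset_measurable (E : set T) : measurable E -> Bset E.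
Proof.
apply: smallest_sub.
  split; first exact: Bset0.
    by move=> A bA; rewrite setTD; exact: BsetC.
  exact: Bset_bigcup.
move=> O oO.
pose D (pqk : rat * rat * nat) : set T :=
  cdisk ((ratr pqk.1.1 : R) +i* ratr pqk.1.2) (pqk.2.+1%:R^-1 ^+ 2).
(* Enumerates the rational disks by natural numbers; codes of nothing, and disks that leave [O],
   contribute the empty set. *)
pose B i := if unpickle i is Some pqk then (if `[< D pqk `<=` O >] then D pqk else set0) else set0.
rewrite (_ : O = \bigcup_i B i).
  apply: Bset_bigcup => i; rewrite /B; case: unpickle => [pqk|]; last exact: Bset0.
  by case: ifP => _; [exact: Bset_cdisk|exact: Bset0].
apply/seteqP; split=> z.
  move=> Oz; have [p [q [k [zD DO]]]] := open_cdisk oO Oz.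
  exists (pickle (p, q, k)); first exact: Logic.I.
  rewrite /B (pickleK (p, q, k)) ifT; first exact: zD.
  by apply/asboolP; exact: DO.
move=> [i _]; rewrite /B; case: unpickle => // pqk.
by case: ifP => // /asboolP; apply.
Qed.

(** The greedy binary expansion of a function with values in [0, 1]; after [n] digits the error is
    at most 2^-n, and every digit is an indicator function. *)
Fixpoint digits r (n : nat) : T -> R :=
  if n is m.+1 then fun z => digits r m z +
    2^-1 ^+ m.+1 * (z \in [set w | 2^-1 ^+ m.+1 <= r w - digits r m w])%:R
  else fun _ => 0.

Lemma Breal_bounded01 r : measurable_fun setT r -> (forall z, 0 <= r z <= 1) -> Breal r.
Proof.
move=> mr r01.
have sP n : [/\ Breal (digits r n), measurable_fun setT (digits r n) & forall z, 0 <= r z - digits r n z <= 2^-1 ^+ n].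
  elim: n => [|n [bs ms hs]]; rewrite /=.
    by split=> [||z]; [exact: Breal_cst|exact: measurable_cst|rewrite subr0 expr0].
  have mE : measurable [set z | 2^-1 ^+ n.+1 <= r z - digits r n z].
    have := measurable_funB mr ms measurableT (measurable_itv `[2^-1 ^+ n.+1, +oo[).
    by rewrite setTI; congr measurable; apply/seteqP; split => z /=; rewrite in_itv /= andbT.
  have bE := Bset_measurable mE.
  have bS : Breal (fun z => digits r n z + 2^-1 ^+ n.+1 * (z \in [set z | 2^-1 ^+ n.+1 <= r z - digits r n z])%:R).
    by apply: BrealD => //; exact: BrealZ.
  split=> //; first exact: Breal_measurable.
  move=> z; have /andP[h0 h1] := hs z.
  have hS : 2^-1 ^+ n = 2 * 2^-1 ^+ n.+1 :> R by rewrite exprS mulrA divff ?mul1r.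
  have q0 : 0 <= 2^-1 ^+ n.+1 :> R by rewrite exprn_ge0.
  have [h|h] := leP (2^-1 ^+ n.+1) (r z - digits r n z).
    by rewrite mem_set//=; move: (digits r n z) (2^-1 ^+ n.+1) (2^-1 ^+ n) h h0 h1 hS q0 => a b c; lra.
  rewrite memNset /=; last by rewrite /= leNgt h.
  by move: (digits r n z) (2^-1 ^+ n.+1) (2^-1 ^+ n) h h0 h1 hS q0 => a b c; lra.
apply: (@Breal_lim 2 (digits r)).
- by move=> j; case: (sP j).
- move=> j z; have [_ _ /(_ z)] := sP j; have := r01 z.
  have : 2^-1 ^+ j <= 1 :> R by rewrite exprn_ile1// invf_le1// ler1n.
  by move: (digits r j z) (2^-1 ^+ j) => a b h1 /andP[h2 h3] /andP[h4 h5]; rewrite ler_norml; apply/andP; split; lra.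
- move=> z; have q1 : `|2^-1 : R| < 1 by rewrite ger0_norm; lra.
  have /cvg_realP h := cvg_expr q1; apply/cvg_realP => e e0.
  apply: filterS (h e e0) => n; rewrite subr0 ger0_norm ?exprn_ge0// => qe.
  have [_ _ /(_ z)/andP[h0 h1]] := sP n.
  by rewrite distrC ger0_norm//; exact: le_lt_trans qe.
Qed.

Lemma Breal_bounded (K : R) r : measurable_fun setT r -> (forall z, `|r z| <= K) -> Breal r.
Proof.
move=> mr rK; have K0 : 0 <= K by exact: le_trans (rK (cexp 0)).
(* The affine map r |-> (r + K) / (2 (K + 1)) sends [-K, K] into [0, 1]; the [+ 1] covers
   [K = 0]. *)
have K1 : 0 < 2 * (K + 1) by lra.
have b : Breal (fun z => (2 * (K + 1))^-1 * (r z + K)).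
  apply: Breal_bounded01.
    by apply: measurable_funM => //; apply: measurable_funD.
  move=> z; have := rK z; rewrite ler_norml => /andP[h1 h2].
  apply/andP; split; first by apply: mulr_ge0; [rewrite invr_ge0 ltW|lra].
  by rewrite ler_pdivrMl//; lra.
have := BrealB (BrealZ (2 * (K + 1)) b) (Breal_cst K).
by congr Breal; apply/funext => z; rewrite mulVKf ?gt_eqF// addrK.
Qed.

Lemma Bcls_bounded K phi : bmeas K phi -> Bcls phi.
Proof.
move=> [[mr mi] bp]; rewrite (_ : phi = fun z => 'i%C * (complex.Im (phi z))%:C + (complex.Re (phi z))%:C).
  apply: Bcls_lin; apply: (@Breal_bounded K) => // z.
    exact: le_trans (cabs_Im _) (bp z).
  exact: le_trans (cabs_Re _) (bp z).
by apply/funext => z; rewrite addrC -complexE.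
Qed.

(** The form in which the class is used: it stands in for the Borel functional calculus of a
    unitary, and it reduces statements on bounded functions to monomials. *)
Lemma bmeas_ind (P : (T -> R[i]) -> Prop) :
  (forall l : int, P (fun z => circle_val z ^ l)) ->
  (forall a K L phi psi, bmeas K phi -> bmeas L psi -> P phi -> P psi ->
    P (fun z => a * phi z + psi z)) ->
  (forall K (phi_ : nat -> T -> R[i]) phi, (forall j, bmeas K (phi_ j)) -> bmeas K phi ->
    (forall j, P (phi_ j)) -> (forall z, phi_ j z @[j --> \oo] --> phi z) -> P phi) ->
  forall K phi, bmeas K phi -> P phi.
Proof.
move=> Pm Pl Plim K phi /Bcls_bounded; elim=> [|a p q Bp ip Bq iq|L p_ p bp _ ip pp].
    exact: Pm.
  have [K1 b1] := Bcls_bmeas Bp; have [K2 b2] := Bcls_bmeas Bq.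
  exact: Pl b1 b2 ip iq.
exact: Plim bp (bmeas_lim bp pp) ip pp.
Qed.

End BoundedMeasurable.

(** * Nonsingularity of circle diffeomorphisms *)

Section Lipschitz.
Variable R : realType.
Local Notation T := (circle R).
Local Notation haar := (@haar R).
Local Notation mu := (@lebesgue_measure R).
Implicit Types (F G : R -> R) (f g : T -> T).

Lemma circle_inj (z w : T) : circle_val z = circle_val w -> z = w.
Proof. exact: val_inj. Qed.

Lemma cexp_val (t : R) : circle_val (cexp t) = cos (2 * pi * t) +i* sin (2 * pi * t).
Proof. by []. Qed.

Lemma cexpD1 (t : R) : cexp (t + 1) = cexp t.
Proof.
apply: circle_inj; rewrite !cexp_val mulrDr mulr1 (_ : 2 * pi = pi *+ 2); last by rewrite mulr_natl.
by rewrite cosD2pi sinD2pi.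
Qed.

Lemma cexpDn (t : R) (n : nat) : cexp (t + n%:R) = cexp t.
Proof.
elim: n => [|n IH]; first by rewrite addr0.
by rewrite -natr1 addrA cexpD1.
Qed.

Lemma cexpDz (t : R) (k : int) : cexp (t + k%:~R) = cexp t.
Proof.
case: k => n; first exact: cexpDn.
by rewrite NegzE mulrNz -{2}(subrK (n.+1%:R) t) cexpDn.
Qed.

(** The number 2 pi |s - t| lies in [0, pi], where [cos] is injective, and its cosine is 1. *)
Lemma cexp_eq_near (s t : R) : cexp s = cexp t -> `|s - t| < 2^-1 -> s = t.
Proof.
move=> /(congr1 (@circle_val R)); rewrite !cexp_val => -[ec es] st.
have pi0 : 0 < pi :> R := pi_gt0 R.
have c1 : cos `|2 * pi * (s - t)| = 1.
  have -> : cos `|2 * pi * (s - t)| = cos (2 * pi * (s - t)).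
    have [h|h] := leP 0 (2 * pi * (s - t)); first by rewrite ger0_norm.
    by rewrite ler0_norm ?ltW// cosN.
  by rewrite mulrBr cosB ec es -!expr2 cos2Dsin2.
have : `|2 * pi * (s - t)| = 0.
  apply: (@cos_inj R); rewrite ?cos0 ?c1// in_itv /=.
    by rewrite normr_ge0 normrM ger0_norm; nra.
  by rewrite lexx ltW.
move/eqP; rewrite normr_eq0 mulf_eq0 subr_eq0 gt_eqF ?mulr_gt0//= => /eqP //.
Qed.

(** The values of [D] lie in one fibre of [cexp], whose distinct points are at least 1/2 apart,
    whereas a nonconstant continuous [D] takes intermediate values. *)
Lemma continuous_lift_const (D : R -> R) : continuous D ->
  (forall s t, cexp (D s) = cexp (D t)) -> forall s t, D s = D t.
Proof.
move=> cD eD.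
suff h s t : s <= t -> D s = D t.
  by move=> s t; have [/h//|/ltW/h//] := leP s t.
move=> st; apply/eqP; apply/negPn/negP => Dst.
pose d := D t - D s.
have d0 : 0 < `|d| by rewrite normr_gt0 subr_eq0 eq_sym.
(* A value between D s and D t that differs from D s, but by at most 1/4. *)
pose v := D s + d * Num.min 1 (4^-1 / `|d|).
have m0 : 0 < Num.min 1 (4^-1 / `|d|) by rewrite lt_min ltr01 divr_gt0.
have m1 : Num.min 1 (4^-1 / `|d|) <= 1 by rewrite ge_min lexx.
have m2 : `|d| * Num.min 1 (4^-1 / `|d|) <= 4^-1.
  by rewrite mulrC -ler_pdivlMr// ge_min lexx orbT.
have Dsub : {within `[s, t], continuous D} by exact: continuous_subspaceT.
have [|r _ Dr] := @IVT R D s t v st Dsub.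
  rewrite /v; move: (Num.min 1 _) m0 m1 => m m0 m1; have : D t = D s + d by rewrite /d addrC subrK.
  move=> ->; case: (lerP (D s) (D s + d)) => h; apply/andP; split; nra.
have : D r = D s.
  apply: cexp_eq_near; first exact: eD.
  rewrite Dr /v addrAC subrr add0r normrM (gtr0_norm m0).
  by apply: le_lt_trans m2 _; rewrite ltf_pV2 ?posrE// ltr_nat.
rewrite Dr /v => /eqP; rewrite -subr_eq0 addrAC subrr add0r mulf_eq0 (gt_eqF m0) orbF.
by rewrite -normr_eq0 (gt_eqF d0).
Qed.

Lemma smooth_lipschitz G (K : R) : smooth G -> exists2 L : R, 0 <= L &
  forall a b, -K <= a <= K -> -K <= b <= K -> `|G a - G b| <= L * `|a - b|.
Proof.
move=> sG; have [K0|K0] := ltP K 0.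
  by exists 0 => // a b /andP[h1 h2]; lra.
have dG t : derivable G t 1 by exact: (sG 0%N).
have dG1 t : derivable (derive1 G) t 1 by exact: (sG 1%N).
have cG : continuous G by move=> t; apply/differentiable_continuous/derivable1_diffP.
have cG1 : continuous (derive1 G) by move=> t; apply/differentiable_continuous/derivable1_diffP.
have cN : {within `[-K, K], continuous (fun t => `|(derive1 G) t|)}.
  apply: continuous_subspaceT => t.
  by apply: cvg_norm; exact: cG1.
have KK : -K <= K by lra.
have [c _ hc] := EVT_max KK cN.
exists `|(derive1 G) c| => // a b.
wlog ab : a b / a <= b.
  move=> h; have [/h//|/ltW ba ha hb] := leP a b.
  by rewrite distrC [X in _ * X]distrC; exact: h.
move=> /andP[Ka aK] /andP[Kb bK].
have [||d] := @MVT_segment R G (derive1 G) a b ab.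
- by move=> x _; apply: DeriveDef => //; rewrite derive1E.
- exact: continuous_subspaceT.
rewrite in_itv /= => /andP[ad db] e.
rewrite distrC e normrM [`|b - a|]distrC ler_wpM2r//; apply: hc.
by rewrite in_itv /=; apply/andP; split; lra.
Qed.

(** Lebesgue measure is an infimum over countable covers by half-open intervals, so the bound on
    those intervals passes to Borel sets by countable subadditivity. *)
Lemma measure_le_lebesgue (nu : {measure set R -> \bar R}) (C : R) : 0 < C ->
  (forall a b : R, a <= b -> (nu `]a, b]%classic <= (C * (b - a))%:E)%E) ->
  forall B, measurable B -> (nu B <= C%:E * mu B)%E.
Proof.
move=> C0 h B mB.
rewrite -lee_pdivrMl//.
apply: le_ereal_inf_tmp => _ [A [mA BA] <-].
rewrite lee_pdivrMl// -nneseriesZl; last by move=> k _; exact: measure_ge0.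
have mA' k : measurable (A k : set R) by have [x _ <-] := mA k; exact: measurable_itv.
apply: (@le_trans _ _ (\sum_(k <oo) nu (A k))%E).
  exact: measure_sigma_subadditive.
apply: lee_nneseries => [k _ _|k _]; first exact: measure_ge0.
have [[a b] _ /= Ak] := mA k.
rewrite -{}Ak; have [ab|ba] := leP a b.
  by rewrite wlength_itv_bnd//=; exact: h.
by rewrite set_itv_ge ?measure0 ?mule0// bnd_simp -leNgt ltW.
Qed.

(** A set of diameter at most [d] lies within distance [d] of any of its points; the resulting
    factor 2 is harmless. *)
Lemma lebesgue_small (S : set R) (d : R) : measurable S -> 0 <= d ->
  (forall s t, S s -> S t -> `|s - t| <= d) -> (mu S <= (2 * d)%:E)%E.
Proof.
move=> mS d0 h; have [->|/set0P[s Ss]] := eqVneq S set0.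
  by rewrite measure0 lee_fin mulr_ge0.
apply: (@le_trans _ _ (mu `[s - d, s + d]%classic)).
  apply: le_measure; rewrite ?inE//.
  move=> t St /=; rewrite in_itv /=; have := h _ _ Ss St; rewrite ler_norml => /andP[h1 h2].
  by apply/andP; split; lra.
rewrite lebesgue_measure_itv /= lte_fin; case: ifP => _; last by rewrite lee_fin mulr_ge0.
by rewrite -EFinB lee_fin; lra.
Qed.

(* As G inverts the lift F up to a constant and is Lipschitz, each piece of the preimage under F of
   an interval of length d has diameter at most L d. *)
Lemma nonsing_lift f g F G : measurable_fun setT f ->
  is_lift F f -> is_lift G g -> cancel f g -> smooth G -> nonsing f.
Proof.
move=> mf [cF eF] [cG eG] gf sG; split=> //.
have FK : exists2 K : nat, True & forall t, t \in `[0, 1]%R -> `|F t| <= K%:R.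
  have cN : {within `[0, 1], continuous (fun t => `|F t|)}.
    apply: continuous_subspaceT => t.
    by apply: cvg_norm; exact: cF.
  have [c _ hc] := EVT_max ler01 cN.
  exists (Num.truncn `|F c|).+1 => // t /hc /le_trans; apply.
  exact/ltW/truncnS_gt.
have [K _ hK] := FK.
(* [G \o F] lifts the identity of the circle, so its difference with the identity is continuous with
   values in one fibre of [cexp]. *)
have GF s t : G (F s) - s = G (F t) - t.
  apply: (continuous_lift_const (D := fun t => G (F t) - t)).
    move=> u; apply: cvgB; last exact: cvg_id.
    by apply: (@continuous_comp _ _ _ F G); [exact: cF|exact: cG].
  have h u : cexp (G (F u)) = cexp u by rewrite -eG -eF gf.
  have h0 u : cexp (G (F u) - u) = cexp 0.
    have := h u => /(congr1 (@circle_val R)); rewrite !cexp_val => -[ec es].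
    apply: circle_inj; rewrite !cexp_val mulr0 cos0 sin0 mulrBr cosB sinB ec es.
    by rewrite -!expr2 cos2Dsin2 mulrC subrr.
  by move=> u v; rewrite !h0.
have [L L0 hL] := smooth_lipschitz K%:R sG.
have FL s t : s \in `[0, 1]%R -> t \in `[0, 1]%R -> `|s - t| <= L * `|F s - F t|.
  move=> hs ht; have := hL (F s) (F t).
  have e : G (F s) - G (F t) = s - t by have := GF s t; lra.
  by rewrite e -!ler_norml; apply; exact: hK.
pose nu0 := mrestr mu (measurable_itv `[0%R, 1%R[).
have mF (k : int) : measurable_fun setT (fun t => F t - k%:~R).
  apply: measurable_funB => //; exact: continuous_measurable_fun.
(* The 2 is the loss in [lebesgue_small]; the [+ 1] makes the constant positive even if [L = 0]. *)
pose C := 2 * (L + 1).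
have C0 : 0 < C by rewrite /C; lra.
have sub01 (t : R) : `[0%R, 1%R[%classic t -> t \in `[0, 1]%R.
  by rewrite /= !in_itv /= => /andP[-> /ltW].
(* For [B] inside the fundamental domain, the part of it on which [F] has integer part [k] and lands
   in the translate of [B] by [k]. *)
pose S (k : int) (B : set R) : set R := [set t | B (F t - k%:~R)] `&` `[0%R, 1%R[%classic.
have key (k : int) (B : set R) : measurable B -> (mu (S k B) <= C%:E * mu B)%E.
  pose nu : {measure set R -> \bar R} := pushforward nu0 (fun t => F t - k%:~R).
  apply: (measure_le_lebesgue (nu := nu (mF k))) => // a b ab.
  rewrite /nu /= /pushforward /nu0 /mrestr /C -mulrA.
  apply: lebesgue_small.
  - apply: measurableI => //; rewrite -[X in measurable X]setTI; exact: mF.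
  - by rewrite mulr_ge0 ?subr_ge0// addr_ge0.
  - move=> s t [hs /sub01 s1] [ht /sub01 t1].
    apply: le_trans (FL s t s1 t1) _.
    have : `|F s - F t| <= b - a.
      move: hs ht; rewrite /= !in_itv /= => /andP[h1 h2] /andP[h3 h4].
      by rewrite ler_norml; apply/andP; split; lra.
    by have := normr_ge0 (F s - F t); nra.
(* As |F| <= K on [0, 1], the integer part of [F] is among the 2K + 2 integers from -K-1 to K; each
   piece costs a factor [C]. *)
exists (C * (K.*2.+2)%:R); first by rewrite mulr_ge0// ltW.
move=> E mE; rewrite /haar /pushforward /mrestr.
set B : set R := (cexp (R := R) @^-1` E) `&` `[0, 1[%classic.
have mB : measurable B.
  apply: measurableI => //; rewrite -[X in measurable X]setTI; exact: measurable_cexp.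
pose I := [seq i%:Z - K.+1%:Z | i <- iota 0 K.*2.+2].
apply: (@le_trans _ _ (mu (\big[setU/set0]_(k <- I) (S k B)))).
  apply: le_measure; rewrite ?inE.
  - apply: measurableI => //; rewrite -[X in measurable X]setTI; apply: measurable_cexp => //.
    by rewrite -[X in measurable X]setTI; exact: mf.
  - apply: bigsetU_measurable => k _; apply: measurableI => //.
    by rewrite -[X in measurable X]setTI; exact: mF.
  move=> t [/= Et t01]; rewrite -bigcup_seq.
  exists (Num.floor (F t)).
    have := hK t (sub01 _ t01); rewrite ler_norml => /andP[h1 h2] /=.
    have f1 := floor_le_tmp (F t); have f2 := floorD1_gt (F t).
    apply/mapP; exists `|(Num.floor (F t) + K.+1%:Z)%R|%N.
      rewrite mem_iota; have : - K%:Z <= Num.floor (F t) by rewrite floor_ge_int mulrNz.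
      have : Num.floor (F t) <= K%:Z by rewrite -(ler_int R); exact: le_trans h2.
      lia.
    have : - K%:Z <= Num.floor (F t) by rewrite floor_ge_int mulrNz.
    lia.
  split=> //=; rewrite /B; split => /=.
    by rewrite -mulrNz cexpDz -eF.
  have f1 := floor_le_tmp (F t); have f2 := floorD1_gt (F t); rewrite intrD in f2.
  by rewrite in_itv /=; apply/andP; split; lra.
apply: le_trans (_ : \sum_(k <- I) mu (S k B) <= _)%E.
  elim: I => [|k I IH]; first by rewrite !big_nil measure0.
  rewrite !big_cons; apply: le_trans (measureU2 _ _ _) _; last exact: leeD.
  - by apply: measurableI => //; rewrite -[X in measurable X]setTI; exact: mF.
  - apply: bigsetU_measurable => j _; apply: measurableI => //.
    by rewrite -[X in measurable X]setTI; exact: mF.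
apply: le_trans (lee_sum _ (fun k _ => key k B mB)) _.
have Bfin : mu B \is a fin_num.
  rewrite ge0_fin_numE//; apply: (@le_lt_trans _ _ (mu `[0%R, 1%R[%classic)).
    by apply: le_measure; rewrite ?inE//; exact: subIsetr.
  by rewrite lebesgue_measure_itv /= lte01 oppr0 adde0 ltry.
rewrite -(fineK Bfin) -!EFinM sumEFin big_const_seq count_predT size_map size_iota.
rewrite iter_addr_0 lee_fin -mulr_natr; lra.
Qed.

End Lipschitz.

(** * Iterates over the integers, and their nonsingularity *)

Section Diffeomorphism.
Variable R : realType.
Local Notation T := (circle R).
Implicit Types (f g h : T -> T).

Lemma pinv_bij f : bijective f -> cancel f (pinv setT f) /\ cancel (pinv setT f) f.
Proof.
move=> bf; have inj : {in [set: T] &, injective f} by move=> x y _ _; exact: bij_inj.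
have fK : cancel f (pinv setT f) by move=> x; apply: pinvKV; rewrite ?inE.
split=> // y; have [g gf fg] := bf; rewrite -(fg y) fK.
by rewrite fg.
Qed.

Lemma circle_continuous_measurable f : continuous f -> measurable_fun setT f.
Proof.
move=> cf; apply: (@measurability _ _ _ _ setT f (@open T)) => //.
move=> _ [B oB <-]; rewrite setTI; apply: sub_sigma_algebra.
by apply: open_comp => // x _; exact: cf.
Qed.

Lemma continuous_rotation (theta : R) : continuous (@rotation R theta).
Proof.
move=> z; apply: (@continuous_comp_initial _ _ _ set_val) => {}z.
apply: (@continuous_comp _ _ _ (@circle_val R) (fun u => circle_val (cexp theta) * u)).
  exact: continuous_circle_val.
exact: mulrl_continuous.
Qed.

Lemma rotationK (theta : R) : cancel (rotation theta) (rotation (- theta)).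
Proof.
move=> z; apply: circle_inj.
have -> : circle_val (rotation (- theta) (rotation theta z)) =
  circle_val (cexp (- theta)) * (circle_val (cexp theta) * circle_val z) by [].
rewrite mulrA [X in X * _](_ : _ = 1) ?mul1r//.
apply/eqP; rewrite eq_complex /= !mulrN !sinN !cosN; apply/andP; split; apply/eqP; last by ring.
by rewrite mulNr opprK -!expr2 cos2Dsin2.
Qed.

Lemma ziter_cancel f (n : int) : cancel f (pinv setT f) -> cancel (pinv setT f) f ->
  forall z, ziter f (n + 1) z = f (ziter f n z) /\ ziter f (n + 1) z = ziter f n (f z).
Proof.
move=> fK Kf z; case: n => n.
  by rewrite addrC -[1 + _]/(Posz n.+1) /=; split=> //; rewrite -iterSr.
case: n => [|n]; first by rewrite (_ : Negz 0 + 1 = 0)//= fK Kf.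
rewrite (_ : Negz n.+1 + 1 = Negz n); last by lia.
by rewrite /ziter [iter n.+2 _ z]iterS Kf; split=> //; rewrite [iter n.+2 _ _]iterSr fK.
Qed.

Lemma ziterD f (m n : int) : bijective f -> forall z, ziter f (m + n) z = ziter f m (ziter f n z).
Proof.
move=> /pinv_bij[fK Kf].
have nat_case (k : nat) l z : ziter f (k%:Z + l) z = ziter f k (ziter f l z).
  elim: k => [|k IH]; first by rewrite add0r.
  rewrite (_ : k.+1%:Z + l = (k%:Z + l) + 1); last by lia.
  by rewrite (ziter_cancel _ fK Kf z).1 IH.
move=> z; case: m => k; first exact: nat_case.
have inv w : ziter f (Negz k) (ziter f k.+1 w) = w.
  rewrite /ziter; elim: k.+1 w => // j IH w.
  by rewrite [iter j.+1 f w]iterS iterSr fK IH.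
rewrite -[LHS](inv) -nat_case; congr (ziter f (Negz k) (ziter f _ z)).
lia.
Qed.

Lemma ziterN f (n : int) : bijective f -> cancel (ziter f n) (ziter f (- n)).
Proof. by move=> bf z; rewrite -ziterD// addNr. Qed.

(** Continuity of [f] and of its inverse is read off the conjugacy with a rotation; the smooth lift
    of each one controls the distortion by the other. *)
Lemma nonsing_diffeo f h theta : smooth_diffeo f -> circle_homeo h ->
  f = h \o rotation theta \o pinv setT h ->
  forall n, nonsing (ziter f n).
Proof.
move=> [bf [F lF sF] [G lG sG]] [bh ch ch'] fE.
have [fK Kf] := pinv_bij bf; have [hK Kh] := pinv_bij bh.
have fz w : f w = h (rotation theta (pinv setT h w)) := congr1 (fun u => u w) fE.
have gE : pinv setT f = h \o rotation (- theta) \o pinv setT h.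
  apply/funext => z; apply: (can_inj fK); rewrite Kf fz /= hK.
  by have := rotationK (- theta) (pinv setT h z); rewrite opprK => ->; rewrite Kh.
have cf : continuous f.
  rewrite fE => z; apply: continuous_comp; first exact: ch'.
  by apply: continuous_comp; [exact: continuous_rotation|exact: ch].
have cg : continuous (pinv setT f).
  rewrite gE => z; apply: continuous_comp; first exact: ch'.
  by apply: continuous_comp; [exact: continuous_rotation|exact: ch].
have nf : nonsing f.
  exact: (nonsing_lift (circle_continuous_measurable cf) lF lG fK sG).
have ng : nonsing (pinv setT f).
  exact: (nonsing_lift (circle_continuous_measurable cg) lG lF Kf sF).
have it u k : nonsing u -> nonsing (iter k u).
  by move=> nu; elim: k => [|k IH]; [exact: nonsing_id|exact: (nonsing_comp nu IH)].
by case=> k; exact: it.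
Qed.

End Diffeomorphism.

(** * The von Neumann algebra and its commutant *)

Section CstarSquareRoot.
Variables (R : realType) (A : cstar_algebra R).
Local Notation nrm := (@cnorm R A).
Implicit Types (a b x y : A).

Let cA := cstarP A.

Lemma star_lin (c : R[i]) a b : star (c *: a + b) = c^* *: star a + star b.
Proof. exact: (star_conj_linear cA). Qed.

Lemma starD a b : star (a + b) = star a + star b.
Proof. by have := star_lin 1 a b; rewrite scale1r rmorph1 scale1r. Qed.

Lemma star0 : star (0 : A) = 0.
Proof. by have := starD 0 0; rewrite addr0 -[LHS]addr0 => /addrI. Qed.

Lemma starZ (c : R[i]) a : star (c *: a) = c^* *: star a.
Proof. by have := star_lin c a 0; rewrite star0 !addr0. Qed.

Lemma starK a : star (star a) = a.
Proof. exact: (star_involutive cA). Qed.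

Lemma starM a b : star (a * b) = star b * star a.
Proof. exact: (star_anti_mul cA). Qed.

Lemma star1 : star (1 : A) = 1.
Proof. by have := starM (star 1) 1; rewrite mulr1 starK mulr1. Qed.

Lemma starN a : star (- a) = - star a.
Proof. by rewrite -scaleN1r starZ rmorphN1 scaleN1r. Qed.

Lemma nrmZ c a : nrm (c *: a) = cabs c * nrm a.
Proof. exact: (cnorm_scale cA). Qed.

Lemma nrmN a : nrm (- a) = nrm a.
Proof. by rewrite -scaleN1r nrmZ cabsN cabs1 mul1r. Qed.

Lemma nrm0 : nrm 0 = 0.
Proof. by have := nrmZ 0 0; rewrite scale0r cabs0 mul0r. Qed.

Lemma nrmD a b : nrm (a + b) <= nrm a + nrm b.
Proof. exact: (cnorm_triangle cA). Qed.

Lemma nrm_ge0 a : 0 <= nrm a.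
Proof. have := nrmD a (- a); rewrite subrr nrm0 nrmN; lra. Qed.

Lemma nrmB a b : nrm (a - b) = nrm (b - a).
Proof. by rewrite -opprB nrmN. Qed.

Lemma nrmM a b : nrm (a * b) <= nrm a * nrm b.
Proof. exact: (cnorm_mul cA). Qed.

Lemma nrm_starM a : nrm (star a * a) = nrm a ^+ 2.
Proof. exact: (cnorm_star cA). Qed.

Lemma nrm_star a : nrm (star a) = nrm a.
Proof.
suff h b : nrm b <= nrm (star b).
  by apply/eqP; rewrite eq_le h andbT -{2}(starK a) h.
have [->|b0] := eqVneq (nrm b) 0; first exact: nrm_ge0.
have bp : 0 < nrm b by rewrite lt_def b0 nrm_ge0.
have := nrmM (star b) b; rewrite nrm_starM expr2.
by rewrite ler_pM2r.
Qed.

Lemma half_cabs : cabs (2^-1 : R[i]) = 2^-1.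
Proof.
rewrite (_ : 2^-1 = (2^-1 : R)%:C); last by rewrite fmorphV rmorph_nat.
by rewrite cabsR ger0_norm.
Qed.

Let step x y : A := 2^-1 *: (x + y * y).

(** Noncommutative difference of squares: y y - y' y' = y (y - y') + (y - y') y'. The factor 1/2
    compensates for the two terms. *)
Lemma step_lip (q : R) x y y' : nrm y <= q -> nrm y' <= q ->
  nrm (step x y - step x y') <= q * nrm (y - y').
Proof.
move=> yq yq'; rewrite /step -scalerBr nrmZ half_cabs opprD addrACA subrr add0r.
have -> : y * y - y' * y' = y * (y - y') + (y - y') * y'.
  by rewrite mulrBr mulrBl addrA subrK.
have h := nrmD (y * (y - y')) ((y - y') * y').
have h1 := nrmM y (y - y'); have h2 := nrmM (y - y') y'; have d0 := nrm_ge0 (y - y').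
move: (nrm (_ + _)) (nrm (y * _)) (nrm (_ * y')) h h1 h2 => r s t h h1 h2.
by move: (nrm y) (nrm y') (nrm _) yq yq' h1 h2 d0 => u v w; nra.
Qed.

Lemma le0_eps (r : R) : (forall e, 0 < e -> r <= e) -> r <= 0.
Proof. by move=> h; apply/ler_addgt0Pr => e e0; rewrite add0r; exact: h. Qed.

(* With x = 1 - c^2, the element y = 1 - c is the fixed point of the contraction y |-> (x + y^2) / 2. *)
Lemma cstar_sqrt x (q : R) : star x = x -> nrm x <= q -> q < 1 ->
  exists2 c, star c = c & c * c = 1 - x.
Proof.
move=> sx xq q1; have q0 : 0 <= q := le_trans (nrm_ge0 x) xq.
pose y n := iter n (step x) 0.
have yq n : nrm (y n) <= q.
  elim: n => [|n IH]; first by rewrite /y /= nrm0.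
  rewrite [y _]/(step x (y n)) /step nrmZ half_cabs.
  have h := nrmD x (y n * y n); have h1 := nrmM (y n) (y n); have h2 := nrm_ge0 (y n).
  by move: (nrm (_ + _)) (nrm (_ * _)) (nrm (y n)) IH h h1 h2 => r s t; nra.
have yd n : nrm (y n.+1 - y n) <= q ^+ n * q.
  elim: n => [|n IH]; first by rewrite /y expr0 mul1r subr0; exact: (yq 1%N).
  apply: le_trans (step_lip _ (yq n.+1) (yq n)) _.
  by rewrite exprS -mulrA ler_wpM2l.
(* The telescoped geometric series, multiplied through by 1 - q to avoid division. *)
have yd2 n k : (1 - q) * nrm (y (n + k)%N - y n) <= q ^+ n * q * (1 - q ^+ k).
  elim: k => [|k IH]; first by rewrite addn0 !subrr nrm0 !mulr0.
  rewrite addnS -(subrK (y (n + k)%N) (y _)) -addrA.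
  have h := nrmD (y (n + k).+1 - y (n + k)%N) (y (n + k)%N - y n).
  have := yd (n + k)%N; rewrite exprD exprSr => h2.
  apply: le_trans (_ : (1 - q) * (q ^+ n * q ^+ k * q) + (q ^+ n * q * (1 - q ^+ k)) <= _); last first.
    by rewrite le_eqVlt; apply/orP; left; apply/eqP; ring.
  apply: le_trans (lerD _ IH); last by apply: ler_wpM2l h2; lra.
  by rewrite -mulrDr ler_wpM2l// subr_ge0 ltW.
have cau : forall e : R, 0 < e -> exists N, forall m n, (N <= m)%N -> (N <= n)%N -> nrm (y m - y n) < e.
  move=> e e0.
  have q1' : `|q| < 1 by rewrite ger0_norm.
  have e1 : 0 < e * (1 - q) by rewrite mulr_gt0// subr_gt0.
  have /cvg_realP/(_ _ e1)[N _ hN] := cvg_expr q1'; exists N.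
  suff h m n : (N <= m)%N -> (m <= n)%N -> nrm (y n - y m) < e.
    by move=> m n Nm Nn; have [mn|/ltnW nm] := leqP m n; [rewrite nrmB|]; exact: h.
  move=> Nm mn; have := hN m Nm; rewrite /= subr0 ger0_norm ?exprn_ge0// => qm.
  have := yd2 m (n - m)%N; rewrite subnKC// => h.
  have k0 : 0 <= q ^+ (n - m) by rewrite exprn_ge0.
  have k1 : 0 <= q ^+ m by rewrite exprn_ge0.
  rewrite -(ltr_pM2l (_ : 0 < 1 - q)) ?subr_gt0//; apply: le_lt_trans h _.
  rewrite [ltRHS]mulrC; apply: le_lt_trans qm.
  by move: (q ^+ m) (q ^+ (n - m)) k0 k1 => a b k0 k1; rewrite -mulrA ler_piMr//; nra.
have [l yl] := cnorm_complete cA cau.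
have sy n : star (y n) = y n.
  elim: n => [|n IH]; first exact: star0.
  rewrite [y _]/(step x (y n)) /step starZ starD starM IH sx.
  by rewrite fmorphV rmorph_nat.
have lq : nrm l <= q + 1.
  have [N /(_ N (leqnn N))] := yl 1 ltr01; rewrite nrmB => h.
  have := nrmD (l - y N) (y N); rewrite subrK; have := yq N; lra.
have sl : star l = l.
  apply/eqP; rewrite -subr_eq0; apply/eqP/(cnorm_eq0 cA)/eqP; rewrite eq_le nrm_ge0 andbT.
  apply: le0_eps => e e0; have e2 : 0 < e / 2 by rewrite divr_gt0.
  have [N /(_ N (leqnn N)) h] := yl _ e2.
  have -> : star l - l = - star (y N - l) + (y N - l).
    by rewrite starD sy starN; rewrite opprB addrA subrK.
  by apply: le_trans (nrmD _ _) _; rewrite nrmN nrm_star; lra.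
have fl : step x l = l.
  apply/eqP; rewrite -subr_eq0; apply/eqP/(cnorm_eq0 cA)/eqP; rewrite eq_le nrm_ge0 andbT.
  apply: le0_eps => e e0; have e2 : 0 < e / (q + 2) by rewrite divr_gt0//; lra.
  have [N hN] := yl _ e2.
  have h0 := hN N (leqnn N); have h1 := hN N.+1 (leqnSn N).
  rewrite -(subrK (y N.+1) (step x l)) -addrA; apply: le_trans (nrmD _ _) _.
  have yq' : nrm (y N) <= q + 1 by have := yq N; lra.
  have := step_lip x lq yq'; rewrite [nrm (l - _)]nrmB => h2.
  have e3 : e = (q + 1) * (e / (q + 2)) + e / (q + 2).
    have e4 : e = e / (q + 2) * (q + 2) by rewrite divfK// lt0r_neq0//; lra.
    by rewrite {1}e4; ring.
  rewrite e3; apply: lerD; last exact: ltW.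
  by apply: le_trans h2 _; rewrite ler_wpM2l ?ltW//; lra.
exists (1 - l); first by rewrite starD starN star1 sl.
have e2 : l + l = x + l * l.
  rewrite (_ : l + l = step x l + step x l); last by rewrite fl.
  by rewrite /step -mulr2n -scaler_nat scalerA mulfV ?scale1r// pnatr_eq0.
rewrite mulrBr mulr1 mulrBl mul1r opprB [l * l - l]addrC addrA.
by rewrite -[1 - l - l]addrA -opprD e2 opprD addrA subrK.
Qed.

End CstarSquareRoot.

Lemma hnorm_add_le (R : realType) (x y : Hspace R) (a b : R) :
  hnorm x <= a -> hnorm y <= b -> hnorm (x + y) <= a + b.
Proof. by move=> xa yb; exact: le_trans (hnorm_add x y) (lerD xa yb). Qed.

Lemma subr_split (V : zmodType) (p q r s : V) : p - r = (p - q - (r - s)) + (q - s).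
Proof. by rewrite opprB [RHS]addrAC !addrA !subrK. Qed.

(** * Norm continuity of representations, and commutants of generators *)

Section Representations.
Variables (R : realType) (A : cstar_algebra R).
Local Notation H := (Hspace R).
Variable pi_ : A -> H -> H.
Hypothesis rep : star_representation pi_.
#[local] Opaque hmk hrepr hdot hnorm.

Lemma rep_lin c a b x : pi_ (c *: a + b) x = c *: pi_ a x + pi_ b x.
Proof. by case: rep => _ l _ _ _; rewrite (l c a b). Qed.

Lemma repM a b x : pi_ (a * b) x = pi_ a (pi_ b x).
Proof. by case: rep => _ _ _ m _; rewrite m. Qed.

Lemma rep1 x : pi_ 1 x = x.
Proof. by case: rep => _ _ o _ _; rewrite o. Qed.

Lemma rep0 x : pi_ 0 x = 0.
Proof. by have := rep_lin (-1) 0 0 x; rewrite scaler0 addr0 scaleN1r addNr. Qed.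

Lemma repZ c a x : pi_ (c *: a) x = c *: pi_ a x.
Proof. by have := rep_lin c a 0 x; rewrite addr0 rep0 addr0. Qed.

Lemma repD a b x : pi_ (a + b) x = pi_ a x + pi_ b x.
Proof. by have := rep_lin 1 a b x; rewrite !scale1r. Qed.

Lemma repB a b x : pi_ (a - b) x = pi_ a x - pi_ b x.
Proof. by rewrite repD -scaleN1r repZ scaleN1r. Qed.

Lemma rep_adj a x y : hdot (pi_ a x) y = hdot x (pi_ (star a) y).
Proof. by case: rep => _ _ _ _ h; exact: h. Qed.

(** [star_representation] bounds each operator separately, with no link to [cnorm]; this lemma
    supplies it. The strict inequality allows [a] to be scaled strictly inside the unit ball, where
    [cstar_sqrt] applies. *)
Lemma rep_contractive a (t : R) x : cnorm a < t -> hnorm (pi_ a x) <= t * hnorm x.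
Proof.
move=> at_; have t0 : 0 < t := le_lt_trans (nrm_ge0 a) at_.
pose b := (t^-1)%:C *: a.
have bE : cnorm b = t^-1 * cnorm a by rewrite nrmZ cabsR ger0_norm ?invr_ge0 ?ltW.
have b1 : cnorm b < 1 by rewrite bE ltr_pdivrMl// mulr1.
have b0 := nrm_ge0 b.
have sb : star (star b * b) = star b * b by rewrite starM starK.
have nb : cnorm (star b * b) <= cnorm b ^+ 2 by rewrite nrm_starM.
have b2 : cnorm b ^+ 2 < 1 by rewrite expr_lt1.
(* 1 - b^* b = c c with c self-adjoint gives |x|^2 - |pi b x|^2 = |pi c x|^2. *)
have [c sc ce] := cstar_sqrt sb nb b2.
have h : hsq x - hsq (pi_ b x) = hsq (pi_ c x).
  have h1 : hdot (pi_ (star b * b) x) x = hdot (pi_ b x) (pi_ b x).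
    by rewrite repM rep_adj starK.
  have h2 : hdot (pi_ (c * c) x) x = hdot (pi_ c x) (pi_ c x).
    by rewrite repM rep_adj sc.
  move: h2; rewrite ce repB rep1 hdotBl h1 => /(congr1 (@complex.Re R)).
  by rewrite !hsqE; case: (hdot x x) (hdot (pi_ b x) _) => [? ?] [? ?].
have : hsq (pi_ b x) <= hsq x by have := hsq_ge0 (pi_ c x); lra.
rewrite -!hnorm_sqr ler_pXn2r ?nnegrE ?hnorm_ge0//.
rewrite /b repZ hnorm_scale cabsR ger0_norm ?invr_ge0 ?(ltW t0)//.
by rewrite ler_pdivrMl.
Qed.

Lemma commute_inv (W P Q : H -> H) : (forall x, Q (P x) = x) -> (forall x, P (Q x) = x) ->
  (forall x, W (P x) = P (W x)) -> forall x, W (Q x) = Q (W x).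
Proof. by move=> QP PQ WP x; rewrite -[LHS]QP -WP PQ. Qed.

(** The elements that commute with [W], together with their stars, form a norm-closed star
    subalgebra. It contains the generators because the star of a unitary is its inverse. *)
Lemma commutant_generators U V W : unitary U -> unitary V ->
  cstar_generated_by [set U; V] -> bounded_operator W ->
  (forall x, W (pi_ U x) = pi_ U (W x)) -> (forall x, W (pi_ V x) = pi_ V (W x)) ->
  commutant (range pi_) W.
Proof.
move=> [U1 U2] [V1 V2] gen [lW [K bW]] WU WV; split; first by split=> //; exists K.
move=> _ [a _ <-]; apply/funext => x /=.
have [WD WZ W0 WB] := linearDZ lW.
(* The second clause is what makes the set closed under [star]. *)
pose S := [set a | (forall x, W (pi_ a x) = pi_ a (W x)) /\
                   (forall x, W (pi_ (star a) x) = pi_ (star a) (W x))].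
suff: S a by case.
apply: gen; last first.
  have inv P : star P * P = 1 -> P * star P = 1 -> (forall x, W (pi_ P x) = pi_ P (W x)) ->
      S P.
    move=> P1 P2 WP; split=> //; apply: commute_inv WP => y.
      by rewrite -repM P1 rep1.
    by rewrite -repM P2 rep1.
  by move=> _ [->|->]; exact: inv.
split.
- by split=> y; rewrite ?star1 !rep1.
- move=> c b d [h1 h2] [h3 h4]; split=> y.
    by rewrite !rep_lin WD WZ h1 h3.
  by rewrite star_lin !rep_lin WD WZ h2 h4.
- by move=> b d [h1 h2] [h3 h4]; split=> y; rewrite ?starM !repM ?h1 ?h3 ?h4 ?h2.
- by move=> b [h1 h2]; split=> // y; rewrite starK.
move=> u l Su ul.
have lim (v : nat -> A) m : seq_lim (@cnorm R A) v m ->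
    (forall n y, W (pi_ (v n) y) = pi_ (v n) (W y)) -> forall y, W (pi_ m y) = pi_ m (W y).
  move=> vm Wv y; apply/eqP; rewrite -subr_eq0; apply/eqP/hnorm_eq0/eqP.
  rewrite eq_le hnorm_ge0 andbT; apply: le0_eps => e e0.
  (* Its summands bound the two error terms, [W] after [pi_ (v N - m)] and before it; the [+ 1]
     keeps it positive. *)
  pose C : R := `|K| * hnorm y + hnorm (W y) + 1.
  have C0 : 0 < C.
    rewrite /C ltr_wpDl// addr_ge0 ?hnorm_ge0// mulr_ge0 ?hnorm_ge0//.
  have e' : 0 < e / C by rewrite divr_gt0.
  have [N /(_ N (leqnn N)) hN] := vm _ e'.
  have -> : W (pi_ m y) - pi_ m (W y) = pi_ (v N - m) (W y) - W (pi_ (v N - m) y).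
    by rewrite !repB WB Wv opprB [RHS]addrC addrA subrK.
  rewrite -[X in hnorm X]/(pi_ (v N - m) (W y) + - W (pi_ (v N - m) y)).
  apply: le_trans (hnorm_add _ _) _; rewrite hnorm_opp.
  have h1 := rep_contractive (W y) hN; have h2 := rep_contractive y hN.
  have h3 := bW (pi_ (v N - m) y).
  have h4 : K * hnorm (pi_ (v N - m) y) <= `|K| * (e / C * hnorm y).
    apply: le_trans (_ : `|K| * hnorm (pi_ (v N - m) y) <= _).
      by apply: ler_wpM2r; [exact: hnorm_ge0|exact: ler_norm].
    by apply: ler_wpM2l h2; exact: normr_ge0.
  apply: le_trans (lerD h1 (le_trans h3 h4)) _.
  rewrite mulrCA -mulrDr -[leRHS](divfK (lt0r_neq0 C0)) ler_wpM2l ?(ltW e')//.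
  by rewrite /C [X in _ <= X + 1]addrC lerDl.
split.
  by apply: lim ul _ => n; case: (Su n).
apply: (lim (fun n => star (u n))); last by move=> n; case: (Su n).
move=> e e0; have [N hN] := ul e e0; exists N => n /hN.
by rewrite -starN -starD nrm_star.
Qed.

End Representations.

(** * Concrete operators attached to [f] and [h], and their commutation *)

Section Dynamics.
Variable R : realType.
Local Notation T := (circle R).
Local Notation H := (Hspace R).
Implicit Types (x y : H) (phi psi : T -> R[i]).
#[local] Opaque hmk hrepr hdot hnorm.
Variables f h : T -> T.
Hypothesis bf : bijective f.
Hypothesis nf : forall n, nonsing (ziter f n).
Hypothesis bh : bijective h.
Hypothesis mh : measurable_fun setT h.
Hypothesis mh' : measurable_fun setT (pinv setT h).

(* [Top k b] is the element V^k b(h(U)) of M, [Yop m phi] belongs to the commutant of M, and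
   [Yop m phi] maps the cyclic vector to [site m phi]. *)
Definition Top (k : int) (beta : T -> R[i]) : H -> H :=
  wop (fun n z => beta (ziter f (n - k) z)) k id.

Definition Yop (m : int) (phi : T -> R[i]) : H -> H :=
  wop (fun _ z => phi z) m (ziter f m).

(** The Borel functional calculus psi(U) of the unitary [opU]. *)
Definition Dop (psi : T -> R[i]) : H -> H :=
  wop (fun n z => psi (pinv setT h (ziter f n z))) 0 id.

Definition Vop (k : int) : H -> H := wop (fun _ _ => 1) k id.

Lemma bmeas_comp K phi (tau : T -> T) : measurable_fun setT tau -> bmeas K phi ->
  bmeas K (fun z => phi (tau z)).
Proof. by move=> mt [mp bp]; split=> [|z]; [exact: cmeasurable_comp|exact: bp]. Qed.

Lemma mziter n : measurable_fun setT (ziter f n).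
Proof. by case: (nf n). Qed.

Lemma weight_Top K beta k : bmeas K beta -> weight K (fun n z => beta (ziter f (n - k) z)).
Proof. by move=> bb n; apply: bmeas_comp => //; exact: mziter. Qed.

Lemma weight_Dop K psi : bmeas K psi -> weight K (fun n z => psi (pinv setT h (ziter f n z))).
Proof.
move=> bb n; apply: (@bmeas_comp K psi (fun z => pinv setT h (ziter f n z))) => //.
by apply: measurableT_comp => //; exact: mziter.
Qed.

Lemma weight_1 : weight 1 (fun (_ : int) (_ : T) => 1).
Proof. by move=> n; split=> [|z]; [exact: cmeasurable_cst|rewrite cabs1]. Qed.

Lemma weight_Yop K phi : bmeas K phi -> weight K (fun (_ : int) z => phi z).
Proof. by move=> bp n. Qed.

Lemma u_E (k l : int) : u_ f k l = Top k (fun z => circle_val z ^ l).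
Proof. by []. Qed.

Lemma opUE : opU f h = Dop (fun z => circle_val z).
Proof.
apply/funext => x; congr hmk; apply/funext => n; apply/funext => z.
by rewrite subr0.
Qed.

Lemma opVE : @opV R = Vop 1.
Proof.
apply/funext => x; congr hmk; apply/funext => n; apply/funext => z.
by rewrite mul1r.
Qed.

Lemma bmeas_id : bmeas 1 (fun z : T => circle_val z).
Proof. by have := bmeas_circleX R 1; under eq_fun do rewrite expr1z. Qed.

Lemma wop_ext c c' k k' tau tau' x : (forall n z, c n z = c' n z) -> k = k' -> (forall z, tau z = tau' z) ->
  wop c k tau x = wop c' k' tau' x.
Proof.
by move=> cc -> tt; congr hmk; apply/funext => n; apply/funext => z; rewrite cc tt.
Qed.

(** The shift by [m] turns the weight of [opU] at [n] into the one at n - m, and the composition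
    with f^m restores f^n. *)
Lemma Yop_opU K m phi x : bmeas K phi -> Yop m phi (opU f h x) = opU f h (Yop m phi x).
Proof.
move=> bp; rewrite opUE /Yop /Dop.
have wY := weight_Yop bp; have wD := weight_Dop bmeas_id.
rewrite (wop_comp _ _ _ wY wD (nf m) (nonsing_id R)) (wop_comp _ _ _ wD wY (nonsing_id R) (nf m)).
apply: wop_ext => //; last by rewrite addr0 add0r.
by move=> n z /=; rewrite mulrC -(ziterD _ _ bf) subrK.
Qed.

Lemma Yop_opV K m phi x : bmeas K phi -> Yop m phi (@opV R x) = @opV R (Yop m phi x).
Proof.
move=> bp; rewrite opVE /Yop /Vop.
have wY := weight_Yop bp; have wV := weight_1.
rewrite (wop_comp _ _ _ wY wV (nf m) (nonsing_id R)) (wop_comp _ _ _ wV wY (nonsing_id R) (nf m)).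
apply: wop_ext => //; last by rewrite addrC.
by move=> n z; rewrite mulrC.
Qed.

Lemma Yop_bounded K m phi : bmeas K phi -> bounded_operator (Yop m phi).
Proof. by move=> bp; exact: wop_bounded (weight_Yop bp) (nf m). Qed.

(** Strong convergence: dominated convergence settles it on bounded sites, and the uniform operator
    bound [K] lets it pass to all vectors. *)
Lemma wop_cvg K (c_ : nat -> int -> T -> R[i]) c k x : (forall j, weight K (c_ j)) -> weight K c ->
  (forall n z, c_ j n z @[j --> \oo] --> c n z) ->
  forall e : R, 0 < e -> \forall j \near \oo, hnorm (wop (c_ j) k id x - wop c k id x) <= e.
Proof.
move=> wc_ wc cc.
have ni := nonsing_id R.
have K0 : 0 <= K by have [_ b] := wc 0; exact: le_trans (cabs_ge0 _) (b (cexp 0)).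
have D j := linearDZ (wop_linear k (wc_ j) ni).
have D' := linearDZ (wop_linear k wc ni).
move: x; apply: H_ind.
- move=> e e0; apply: nearW => j; have [_ _ -> _] := D j; have [_ _ -> _] := D'.
  by rewrite subrr hnorm_zero ltW.
- move=> x y hx hy e e0; have e2 : 0 < e / 2 by rewrite divr_gt0.
  apply: filterS2 (hx _ e2) (hy _ e2) => j hjx hjy.
  have [-> _ _ _] := D j; have [-> _ _ _] := D'.
  rewrite opprD addrACA [e]splitr; exact: hnorm_add_le hjx hjy.
- move=> x hx e e0.
  have e3 : 0 < e / 2 by rewrite divr_gt0.
  have e4 : 0 < (e / 2) / (2 * K + 1) by rewrite divr_gt0// ltr_wpDl// mulr_ge0.
  have [y hy xy] := hx _ e4.
  apply: filterS (hy _ e3) => j hj.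
  have [_ _ _ Bj] := D j; have [_ _ _ B'] := D'.
  have -> : wop (c_ j) k id x - wop c k id x =
      (wop (c_ j) k id (x - y) - wop c k id (x - y)) + (wop (c_ j) k id y - wop c k id y).
    by rewrite Bj B'; exact: subr_split.
  rewrite [e]splitr; apply: hnorm_add_le; last exact: hj.
  apply: le_trans (hnorm_add _ _) _; rewrite hnorm_opp.
  apply: le_trans (lerD (wop_bound1 _ _ K0 (wc_ j)) (wop_bound1 _ _ K0 wc)) _.
  rewrite -mulrDl; apply: le_trans (_ : (2 * K + 1) * hnorm (x - y) <= _).
    by apply: ler_wpM2r; [exact: hnorm_ge0|rewrite mulr_natl mulr2n lerDl].
  rewrite mulrC -ler_pdivlMr; first exact: xy.
  by rewrite ltr_wpDl// mulr_ge0.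
move=> n L phi bphi e e0.
have lphi := L2_bmeas bphi.
pose d j z := -1 * c (n + k) z + c_ j (n + k) z.
have bd j : bmeas (cabs (-1) * K + K) (d j) := bmeas_lin (-1) (wc (n + k)) (wc_ j (n + k)).
have d0 z : d j z @[j --> \oo] --> 0.
  have /cvg_complexP ccz := cc (n + k) z; apply/cvg_complexP => e' e'0.
  by apply: filterS (ccz e' e'0) => j; rewrite subr0 /d mulN1r addrC.
have /cvg_realP/(_ e e0) := site_cvg0 (n + k) lphi bd d0.
apply: filterS => j; rewrite subr0 (ger0_norm (hnorm_ge0 _)) => hj.
rewrite (wop_site _ _ (wc_ j) ni lphi) (wop_site _ _ wc ni lphi).
have l1 := L2_M (wc_ j (n + k)) lphi; have l2 := L2_M (wc (n + k)) lphi.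
apply: ltW; apply: le_lt_trans hj; rewrite le_eqVlt; apply/orP; left; apply/eqP; congr hnorm.
rewrite [LHS]addrC -scaleN1r -(site_lin _ (-1) l2 l1); congr site.
by apply/funext => z; rewrite /d; ring.
Qed.

(** Commutation passes from U to its powers, to negative powers by inversion, and to bounded
    pointwise limits because these give strong limits. *)
Lemma Dop_commute (b : H -> H) : bounded_operator b ->
  (forall x, b (opU f h x) = opU f h (b x)) -> (forall x, opU f h (b x) = b (opU f h x)) ->
  forall K psi, bmeas K psi -> forall x, b (Dop psi x) = Dop psi (b x).
Proof.
move=> [lb [C bC]] bU _; have ni := nonsing_id R.
have [bD bZ b0 bB] := linearDZ lb.
apply: bmeas_ind.
- have DM K L phi psi x : bmeas K phi -> bmeas L psi ->
      Dop phi (Dop psi x) = Dop (fun z => phi z * psi z) x.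
    move=> bp bq; rewrite /Dop (wop_comp _ _ _ (weight_Dop bp) (weight_Dop bq) ni ni).
    by apply: wop_ext => // n z; rewrite subr0.
  have D1 x : Dop (fun z => circle_val z ^ 0) x = x.
    by rewrite -[RHS]wop_id.
  have nat_case (n : nat) x : b (Dop (fun z => circle_val z ^ n) x) = Dop (fun z => circle_val z ^ n) (b x).
    elim: n x => [|n IH] x; first by rewrite !D1.
    have e y : Dop (fun z => circle_val z ^ n.+1) y = opU f h (Dop (fun z => circle_val z ^ n) y).
      rewrite opUE (DM _ _ _ _ _ bmeas_id (bmeas_circleX R n)).
      by apply: wop_ext => // m z; rewrite -exprnP exprS.
    by rewrite !e bU IH.
  case=> n; first exact: nat_case.
  move=> x; apply: (commute_inv (P := Dop (fun z => circle_val z ^ n.+1))); last exact: nat_case.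
  + move=> y; rewrite (DM _ _ _ _ _ (bmeas_circleX R (Negz n)) (bmeas_circleX R n.+1)) -[RHS]D1.
    by apply: wop_ext => // m z; rewrite -expfzDr ?circle_val_neq0// NegzE addNr.
  + move=> y; rewrite (DM _ _ _ _ _ (bmeas_circleX R n.+1) (bmeas_circleX R (Negz n))) -[RHS]D1.
    by apply: wop_ext => // m z; rewrite -expfzDr ?circle_val_neq0// NegzE addrN.
- move=> a K L phi psi bp bq ip iq x.
  have e y : Dop (fun z => a * phi z + psi z) y = a *: Dop phi y + Dop psi y.
    rewrite -hmk_lin; try exact: l2_wop _ (weight_Dop _) ni (l2_repr y).
    + by congr hmk; apply/funext => n; apply/funext => z; rewrite mulrDl mulrA.
    + exact: l2_wop _ (weight_Dop bp) ni (l2_repr y).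
    + exact: l2_wop _ (weight_Dop bq) ni (l2_repr y).
  by rewrite !e bD bZ ip iq.
- move=> K phi_ phi bp_ bp ip pp x.
  apply/eqP; rewrite -subr_eq0; apply/eqP/hnorm_eq0/eqP.
  rewrite eq_le hnorm_ge0 andbT; apply: le0_eps => e e0.
  have cv y : forall e : R, 0 < e -> \forall j \near \oo, hnorm (Dop (phi_ j) y - Dop phi y) <= e.
    apply: (wop_cvg _ _ (fun j => weight_Dop (bp_ j)) (weight_Dop bp)) => n z.
    exact: pp.
  have C1 : 0 < `|C| + 1 by rewrite ltr_wpDl.
  have e' : 0 < (e / 2) / (`|C| + 1) by rewrite !divr_gt0.
  have e2 : 0 < e / 2 by rewrite divr_gt0.
  have [j _ /(_ j (leqnn j)) h1] := cv x _ e'.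
  have [i _ hi] := cv x _ e'; have [i' _ hi'] := cv (b x) _ e2.
  pose m := maxn i i'.
  have {h1} h1 := hi m (leq_maxl _ _); have h2 := hi' m (leq_maxr _ _).
  have -> : b (Dop phi x) - Dop phi (b x) =
      - b (Dop (phi_ m) x - Dop phi x) + (Dop (phi_ m) (b x) - Dop phi (b x)).
    by rewrite bB opprB ip addrA subrK.
  rewrite [e]splitr; apply: hnorm_add_le h2; rewrite hnorm_opp.
  apply: le_trans (bC _) _; apply: le_trans (_ : (`|C| + 1) * hnorm (Dop (phi_ m) x - Dop phi x) <= _).
    by rewrite ler_wpM2r ?hnorm_ge0//; apply: le_trans (ler_norm C) _; rewrite lerDl.
  by rewrite mulrC -ler_pdivlMr.
Qed.

Lemma Vop_commute (b : H -> H) : (forall x, b (@opV R x) = @opV R (b x)) ->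
  forall k x, b (Vop k x) = Vop k (b x).
Proof.
move=> bV; have ni := nonsing_id R.
have VD k l x : Vop k (Vop l x) = Vop (k + l) x.
  rewrite /Vop (wop_comp _ _ _ weight_1 weight_1 ni ni).
  by apply: wop_ext => // n z; rewrite mulr1.
have V0 x : Vop 0 x = x by exact: wop_id.
have nat_case (n : nat) x : b (Vop n x) = Vop n (b x).
  elim: n x => [|n IH] x; first by rewrite !V0.
  by rewrite (_ : n.+1%:Z = 1 + n%:Z)// -!VD -opVE bV IH.
case=> n; first exact: nat_case.
move=> x; apply: (commute_inv (P := Vop n.+1)); last exact: nat_case.
  by move=> y; rewrite VD NegzE addNr V0.
by move=> y; rewrite VD NegzE addrN V0.
Qed.

Lemma Top_bounded K k beta : bmeas K beta -> bounded_operator (Top k beta).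
Proof. by move=> bb; exact: wop_bounded (weight_Top k bb) (nonsing_id R). Qed.

(** What commutes with [opU] and [opV] commutes with every V^k psi(U). The choice psi = beta \o h
    cancels the inverse of [h] inside [Dop]. *)
Lemma Top_bicommutant (S : set (H -> H)) K k beta : S (opU f h) -> S (@opV R) -> bmeas K beta ->
  commutant (commutant S) (Top k beta).
Proof.
move=> SU SV bb; split; first exact: Top_bounded bb.
move=> b [bb' bS]; have ni := nonsing_id R.
have bU x : b (opU f h x) = opU f h (b x) by have := bS _ SU => /(congr1 (fun u => u x)).
have bV x : b (@opV R x) = @opV R (b x) by have := bS _ SV => /(congr1 (fun u => u x)).
have bbh : bmeas K (fun z => beta (h z)) by exact: bmeas_comp bb.
have [hK Kh] := pinv_bij bh.
have e x : Top k beta x = Vop k (Dop (fun z => beta (h z)) x).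
  rewrite /Vop /Dop (wop_comp _ _ _ weight_1 (weight_Dop bbh) ni ni).
  by apply: wop_ext => //; [move=> n z; rewrite mul1r Kh|rewrite addr0].
apply/funext => x /=; rewrite !e (Vop_commute bV) (Dop_commute bb' bU _ bbh)//.
Qed.

End Dynamics.

(** * Decay of the Fourier coefficients *)

Section FourierBasis.
Variable R : realType.
Local Notation T := (circle R).
Local Notation H := (Hspace R).
Local Notation haar := (@haar R).
Local Notation mu := (@lebesgue_measure R).
Implicit Types (x y : H) (phi psi : T -> R[i]).
#[local] Opaque hmk hrepr hdot hnorm.

Lemma ge0_haar_integral (psi : T -> R) : measurable_fun setT psi -> (forall z, 0 <= psi z) ->
  (\int[haar]_z (psi z)%:E = \int[mu]_(t in `[0%R, 1%R[) (psi (cexp t))%:E)%E.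
Proof.
move=> mpsi psi0.
have mE : measurable_fun setT (fun z => (psi z)%:E) by exact/measurable_EFinP.
have mc : measurable_fun setT (fun t : R => (psi (cexp t))%:E).
  by apply: (measurableT_comp mE); exact: measurable_cexp.
rewrite /haar ge0_integral_pushforward//=; last 2 first.
- exact: measurable_cexp.
- by move=> y _; rewrite lee_fin.
rewrite preimage_setT; pose I01 : set R := `[0%R, 1%R[%classic.
rewrite -(setUv I01) ge0_integral_setU//=; last 5 first.
- exact: measurable_itv.
- by apply: measurableC; exact: measurable_itv.
- by rewrite setUv.
- by move=> t _; rewrite lee_fin.
- by rewrite disj_set2E setICr.
rewrite [X in (_ + X)%E](_ : _ = 0%E) ?adde0; last first.
  apply: null_set_integral => //=.
  - by apply: measurableC; exact: measurable_itv.
  - exact: measurable_funTS.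
  - by rewrite /mrestr setIC setICr measure0.
apply: eq_measure_integral => A mA AI.
by rewrite /= /mrestr setIidl.
Qed.

(** The shift to 1 + psi >= 0 makes [ge0_haar_integral] applicable; a primitive along [cexp] is t +
    G t, and G 1 = G 0 leaves the value 1. *)
Lemma haar_integral0 (psi : T -> R) (G : R -> R) : measurable_fun setT psi ->
  (forall z, `|psi z| <= 1) -> continuous (fun t => psi (cexp t)) ->
  (forall t : R, is_derive t 1 G (psi (cexp t))) -> G 1 = G 0 ->
  \int[haar]_z psi z = 0.
Proof.
move=> mpsi psi1 cpsi dG G10.
have ipsi : haar.-integrable setT (EFin \o psi).
  apply: (le_integrable measurableT _ _ (finite_measure_integrable_cst haar 1 measurableT)).
    exact/measurable_EFinP.
  by move=> z _ /=; rewrite lee_fin normr1.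
have i1 : haar.-integrable setT (EFin \o (fun _ : T => 1 : R)).
  exact: finite_measure_integrable_cst.
have : \int[haar]_z (1 + psi z) = 1.
  rewrite /Rintegral ge0_haar_integral; last 2 first.
  - by apply: measurable_funD.
  - by move=> z; have := psi1 z; rewrite ler_norml => /andP[h _]; lra.
  have cf : continuous (fun t : R => 1 + psi (cexp t)).
    by move=> t; apply: cvgD; [exact: cvg_cst|exact: cpsi].
  rewrite integral_itv_bndo_bndc; last first.
    apply/measurable_EFinP/measurable_funTS; exact: continuous_measurable_fun.
  have dF t : is_derive (t : R) 1 (fun s => s + G s) (1 + psi (cexp t)).
    exact: is_deriveD.
  have cF : continuous (fun s : R => s + G s).
    by move=> t; apply/differentiable_continuous/derivable1_diffP; case: (dF t).
  rewrite (@continuous_FTC2 _ _ (fun t => t + G t))//.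
  - by rewrite /= G10; lra.
  - exact: continuous_subspaceT.
  - split.
    + by move=> t _; case: (dF t).
    + by apply: cvg_at_right_filter; exact: cF.
    + by apply: cvg_at_left_filter; exact: cF.
  - by move=> t _; rewrite derive1E; case: (dF t).
rewrite RintegralD// Rintegral_cst//= (haar_setT R) /= mul1r => /eqP.
by rewrite -subr_eq0 addrAC subrr add0r => /eqP.
Qed.

Lemma de_moivre (t : R) (n : nat) :
  circle_val (cexp t) ^+ n = cos (2 * pi * n%:R * t) +i* sin (2 * pi * n%:R * t).
Proof.
elim: n => [|n IH]; first by rewrite expr0 !mulr0 !mul0r cos0 sin0.
have -> : 2 * pi * n.+1%:R * t = 2 * pi * n%:R * t + 2 * pi * t by rewrite -(@natr1 R n); ring.
rewrite exprS IH cexp_val.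
rewrite cosD sinD; apply/eqP; rewrite eq_complex /=.
by apply/andP; split; apply/eqP; ring.
Qed.

Lemma cintegral_monomial (l : int) : cintegral (fun z : T => circle_val z ^ l) = (l == 0)%:R.
Proof.
have pi0 : 0 < pi :> R := pi_gt0 R.
have pos (n : nat) : (0 < n)%N ->
    \int[haar]_z complex.Re (circle_val z ^+ n) = 0 /\ \int[haar]_z complex.Im (circle_val z ^+ n) = 0.
  move=> n0; have w0 : 2 * pi * n%:R != 0 :> R by rewrite !mulf_neq0 ?gt_eqF// ltr0n.
  have [mr mi] := cmeasurable_circleX R n.
  have clin : continuous (fun t : R => 2 * pi * n%:R * t) by exact: mulrl_continuous.
  have dlin (w t : R) : is_derive t 1 (fun s => w * s) w.
    by apply: is_derive_eq; rewrite scaler1.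
  split.
    apply: (haar_integral0 (G := fun t => (2 * pi * n%:R)^-1 * sin (2 * pi * n%:R * t))).
    - exact: mr.
    - by move=> z; apply: le_trans (cabs_Re _) _; rewrite (cabs_circleX z n).
    - rewrite (_ : (fun t => _) = fun t => cos (2 * pi * n%:R * t)).
        by move=> t; apply: (@continuous_comp _ _ _ _ cos); [exact: clin|exact: continuous_cos].
      by apply/funext => t; rewrite de_moivre.
    - move=> t; rewrite de_moivre /=.
      have ds := is_derive1_comp (is_derive_sin (2 * pi * n%:R * t)) (dlin _ t).
      rewrite (_ : cos _ = (2 * pi * n%:R)^-1 * (cos (2 * pi * n%:R * t) * (2 * pi * n%:R))).
        exact: is_derive1_comp (dlin _ _) ds.
      by rewrite [RHS]mulrC mulfK.
    - rewrite mulr0 sin0 mulr1; congr (_ * _).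
      have := de_moivre 1 n; have := cexpDn (0 : R) 1; rewrite add0r => ->.
      by rewrite cexp_val mulr0 cos0 sin0 expr1n mulr1 => -[].
  apply: (haar_integral0 (G := fun t => - (2 * pi * n%:R)^-1 * cos (2 * pi * n%:R * t))).
  - exact: mi.
  - by move=> z; apply: le_trans (cabs_Im _) _; rewrite (cabs_circleX z n).
  - rewrite (_ : (fun t => _) = fun t => sin (2 * pi * n%:R * t)).
      by move=> t; apply: (@continuous_comp _ _ _ _ sin); [exact: clin|exact: continuous_sin].
    by apply/funext => t; rewrite de_moivre.
  - move=> t; rewrite de_moivre /=.
    have ds := is_derive1_comp (is_derive_cos (2 * pi * n%:R * t)) (dlin _ t).
    rewrite (_ : sin _ = - (2 * pi * n%:R)^-1 * (- sin (2 * pi * n%:R * t) * (2 * pi * n%:R))).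
      exact: is_derive1_comp (dlin _ _) ds.
    by rewrite !mulNr mulrN opprK [RHS]mulrC mulfK.
  - rewrite mulr0 cos0 mulr1; congr (_ * _).
    have := de_moivre 1 n; have := cexpDn (0 : R) 1; rewrite add0r => ->.
    by rewrite cexp_val mulr0 cos0 sin0 expr1n mulr1 => -[].
case: l => [[|n]|n].
- rewrite /cintegral; apply/eqP; rewrite eq_complex /=; apply/andP; split; apply/eqP.
    by rewrite Rintegral_cst//= (haar_setT R) mulr1.
  by rewrite Rintegral_cst//= mul0r.
- have [e1 e2] := pos n.+1 isT.
  by rewrite /cintegral; apply/eqP; rewrite eq_complex /=; apply/andP; split; apply/eqP.
- have [e1 e2] := pos n.+1 isT.
  have e z : circle_val z ^ Negz n = (circle_val z ^+ n.+1)^* :> R[i].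
    by rewrite (circle_conjX z n.+1) NegzE.
  have [_ mi] := cmeasurable_circleX R n.+1.
  rewrite /cintegral; apply/eqP; rewrite eq_complex /=; apply/andP; split; apply/eqP.
    by rewrite -[RHS]e1; apply: eq_Rintegral => z _; rewrite e; case: (_ ^+ _).
  transitivity (-1 * \int[haar]_z complex.Im (circle_val z ^+ n.+1)); last by rewrite e2 mulr0.
  rewrite -RintegralZl//.
    by apply: eq_Rintegral => z _; rewrite e mulN1r; case: (_ ^+ _).
  apply: (le_integrable measurableT _ _ (finite_measure_integrable_cst haar 1 measurableT)).
    exact/measurable_EFinP.
  by move=> z _ /=; rewrite lee_fin normr1; apply: le_trans (cabs_Im _) _; rewrite (cabs_circleX z n.+1).
Qed.

Lemma L2_monomial (l : int) : L2fun (fun z : T => circle_val z ^ l).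
Proof. exact: L2_bmeas (bmeas_circleX R l). Qed.

Lemma ip_monomial (l l' : int) :
  ip (fun z : T => circle_val z ^ l) (fun z => circle_val z ^ l') = (l == l')%:R.
Proof.
rewrite /ip -subr_eq0 -cintegral_monomial; congr cintegral; apply/funext => z.
by rewrite circle_conjX expfzDr ?circle_val_neq0.
Qed.

Lemma hdot_site n phi y : L2fun phi -> hdot (site n phi) y = ip phi (hrepr y n).
Proof.
move=> lp; rewrite hdotE.
have hE m : hip (site n phi) y m = if m == n then ip phi (hrepr y n) else 0.
  rewrite /hip; have [->|mn] := eqVneq m n.
    apply: ip_ae; try exact: cmeas_repr; [by case: lp| |exact: aeW].
    by apply: ae1 (site_repr n n lp) => z; rewrite eqxx.
  transitivity (ip (fun _ => 0) (hrepr y m)).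
    apply: ip_ae; try exact: cmeas_repr; [exact: cmeasurable_cst| |exact: aeW].
    by apply: ae1 (site_repr n m lp) => z; rewrite (negbTE mn).
  rewrite /ip /cintegral; under eq_fun do rewrite mul0r.
  by under [X in _ +i* X]eq_Rintegral do rewrite mul0r; rewrite /= !Rintegral_cst//= mul0r.
apply/cvg_lim; first exact: norm_hausdorff.
apply/cvg_complexP => e e0; exists `|n|%N => // N /= nN.
rewrite symsum_seq (bigD1_seq n) ?mem_window ?uniq_window//= hE eqxx big1 ?addr0 ?subrr ?cabs0//.
by move=> m /negbTE mn; rewrite hE mn.
Qed.

Lemma hdot_site2 n m phi psi : L2fun phi -> L2fun psi ->
  hdot (site n phi) (site m psi) = if n == m then ip phi psi else 0.
Proof.
move=> lp lq; rewrite hdot_site//.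
have [nm|nm] := eqVneq n m.
  apply: ip_ae; try exact: cmeas_repr; [by case: lp|by case: lp|by case: lq|exact: aeW|].
  by apply: ae1 (site_repr m n lq) => z; rewrite nm eqxx.
transitivity (ip phi (fun _ => 0)).
  apply: ip_ae; [by case: lp|by case: lp|exact: cmeas_repr|exact: cmeasurable_cst|exact: aeW|].
  by apply: ae1 (site_repr m n lq) => z; rewrite (negbTE nm).
rewrite /ip /cintegral; apply/eqP; rewrite eq_complex /=; apply/andP; split; apply/eqP.
  by under eq_Rintegral do rewrite rmorph0 mulr0; rewrite /= Rintegral_cst//= mul0r.
by under eq_Rintegral do rewrite rmorph0 mulr0; rewrite /= Rintegral_cst//= mul0r.
Qed.

Definition fbasis (kl : int * int) : H := site kl.1 (fun z => circle_val z ^ kl.2).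

Lemma hdot_basis kl kl' : hdot (fbasis kl) (fbasis kl') = (kl == kl')%:R.
Proof.
rewrite hdot_site2; try exact: L2_monomial.
rewrite ip_monomial; case: kl kl' => [k l] [k' l'] /=; rewrite xpair_eqE /=.
by case: eqP.
Qed.

(** With v the combination of basis vectors whose coefficients are those of [g], the sum S is both
    the inner product of [g] with W v and the squared norm of v. Cauchy-Schwarz gives S <= |g| C
    |v|. *)
Lemma bessel (W : H -> H) (C : R) (g : H) (s : seq (int * int)) : linear W -> 0 <= C ->
  (forall x, hnorm (W x) <= C * hnorm x) -> uniq s ->
  \sum_(kl <- s) cabs (hdot g (W (fbasis kl))) ^+ 2 <= C ^+ 2 * hnorm g ^+ 2.
Proof.
move=> lW C0 bW us; have [WD WZ W0 _] := linearDZ lW.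
pose c kl := hdot g (W (fbasis kl)).
pose v := \sum_(kl <- s) c kl *: fbasis kl.
set S := \sum_(kl <- s) _.
have S0 : 0 <= S by apply: sumr_ge0 => kl _; exact: sqr_ge0.
have cc (z : R[i]) : z^* * z = (cabs z ^+ 2)%:C.
  by rewrite cabs_sqr; case: z => a b; apply/eqP; rewrite eq_complex /=; apply/andP; split; apply/eqP; ring.
have vv : hnorm v ^+ 2 = S.
  rewrite hnorm_sqr; apply: complexI; rewrite -hdotxx /v hdot_suml rmorph_sum.
  apply: eq_big_seq => kl kls; rewrite hdotZl hdot_sumr (bigD1_seq kl kls us) /= hdotZr hdot_basis eqxx mulr1.
  rewrite big1 ?addr0; last first.
    by move=> kl' /negbTE n; rewrite hdotZr hdot_basis eq_sym n mulr0.
  by rewrite mulrC cc.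
have gW : hdot g (W v) = S%:C.
  have -> : W v = \sum_(kl <- s) W (c kl *: fbasis kl) by exact: lin_bigsum.
  rewrite hdot_sumr rmorph_sum; apply: eq_bigr => kl _.
  by rewrite WZ hdotZr cc.
have h1 : S <= hnorm g * (C * hnorm v).
  have := cabs_hdot g (W v); rewrite gW cabsR (ger0_norm S0) => h.
  by apply: le_trans h _; apply: ler_wpM2l; [exact: hnorm_ge0|exact: bW].
have g0 := hnorm_ge0 g; have v0 := hnorm_ge0 v; rewrite -vv in h1 *.
move: (hnorm g) (hnorm v) g0 v0 h1 => p q p0 q0 h1.
have [q00|q00] := eqVneq q 0; first by rewrite q00 expr0n mulr_ge0 ?sqr_ge0.
have qp : 0 < q by rewrite lt_def q00.
have h2 : q <= p * C by rewrite -(ler_pM2r qp) -mulrA -expr2.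
by rewrite -exprMn mulrC lerXn2r// ?nnegrE// mulr_ge0.
Qed.

End FourierBasis.

(** * Sigma-weak continuity along bounded, weakly convergent families *)

Section Predual.
Variable R : realType.
Local Notation T := (circle R).
Local Notation H := (Hspace R).
Implicit Types (x y g : H).
#[local] Opaque hmk hrepr hdot hnorm.

Lemma cvg_series_ereal (s : nat -> R) : (forall j, 0 <= s j) ->
  (\sum_(0 <= j <oo) (s j)%:E < +oo)%E -> cvgn (series s).
Proof.
move=> s0 sfin; apply: nondecreasing_is_cvgn.
  by apply/nondecreasing_series => j _ _; exact: s0.
exists (fine (\sum_(0 <= j <oo) (s j)%:E)%E) => _ [n _ <-].
rewrite -lee_fin fineK; last first.
  by rewrite ge0_fin_numE//; apply: nneseries_ge0 => j _ _; rewrite lee_fin.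
rewrite /series /= -sumEFin; apply: nneseries_lim_ge => j _ _; by rewrite lee_fin.
Qed.

Lemma cvg_complex_series (t : nat -> R[i]) (s : nat -> R) : (forall j, cabs (t j) <= s j) ->
  cvgn (series s) -> cvgn (series t).
Proof.
move=> ts cs; have s0 j : 0 <= s j := le_trans (cabs_ge0 _) (ts j).
have real_cvg (r : nat -> R) : (forall j, `|r j| <= s j) -> cvgn (series r).
  move=> rs; apply: normed_cvg; apply: (series_le_cvg _ s0 rs cs) => n; exact: normr_ge0.
have ReS n : complex.Re (series t n) = series (fun j => complex.Re (t j)) n.
  by rewrite /series /=; elim/big_rec2: _ => //= i a b _ <-; case: (t _) b => [? ?] [].
have ImS n : complex.Im (series t n) = series (fun j => complex.Im (t j)) n.
  by rewrite /series /=; elim/big_rec2: _ => //= i a b _ <-; case: (t _) b => [? ?] [].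
have /cvg_ex[a ra] := real_cvg _ (fun j => le_trans (cabs_Re _) (ts j)).
have /cvg_ex[b rb] := real_cvg _ (fun j => le_trans (cabs_Im _) (ts j)).
apply/cvg_ex; exists (a +i* b); apply: cvg_ReIm.
  by rewrite (_ : (fun n => _) = series (fun j => complex.Re (t j))); [exact: ra|apply/funext].
by rewrite (_ : (fun n => _) = series (fun j => complex.Im (t j))); [exact: rb|apply/funext].
Qed.

Lemma complex_series_tail (t : nat -> R[i]) (s : nat -> R) (J : nat) :
  (forall j, cabs (t j) <= s j) -> cvgn (series s) ->
  cabs (limn (series t)) <= \sum_(0 <= j < J) cabs (t j) + (limn (series s) - series s J).
Proof.
move=> ts cs; have s0 j : 0 <= s j := le_trans (cabs_ge0 _) (ts j).
have ct := cvg_complex_series ts cs.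
have nds : nondecreasing_seq (series s) by apply/nondecreasing_series => j _ _; exact: s0.
have cabs_sum m n : cabs (\sum_(m <= j < n) t j) <= \sum_(m <= j < n) cabs (t j).
  elim/big_rec2: _ => [|j a b _ ab]; first by rewrite cabs0.
  by apply: le_trans (cabsD _ _) _; rewrite lerD2l.
apply/ler_addgt0Pr => e e0.
have /cvg_complexP/(_ e e0)[N _ hN] := ct.
pose n := maxn N J; have hn := hN n (leq_maxl _ _).
rewrite -(subrK (series t n) (limn _)); apply: le_trans (cabsD _ _) _.
rewrite cabsB addrC; apply: lerD; last exact: ltW.
rewrite /series /= (@big_cat_nat _ _ _ J)//=; last exact: leq_maxr.
apply: le_trans (cabsD _ _) _; apply: lerD; first exact: cabs_sum.
apply: le_trans (cabs_sum _ _) _.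
apply: le_trans (ler_sum _ (fun j _ => ts j)) _.
have := nondecreasing_cvgn_le nds cs n.
rewrite {1}/series /= (@big_cat_nat _ _ _ J)//=; last exact: leq_maxr.
by rewrite -/(series s J) => h; rewrite lerBrDr addrC.
Qed.

(** On a uniformly bounded family the tail of the series is small uniformly in [i], and the finitely
    many remaining terms vanish along [F]. A bound by a sum of squares makes the dominating series
    converge directly by [square_summable]. *)
Lemma seminorm_vanish (I : Type) (F : set_system I) (FF : Filter F) (O : I -> H -> H) (B : R)
    (xi eta : nat -> H) : 0 <= B ->
  (forall i x y, cabs (hdot (O i x) y) <= B * (hnorm x ^+ 2 + hnorm y ^+ 2)) ->
  (forall x y (e : R), 0 < e -> F [set i | cabs (hdot (O i x) y) <= e]) ->
  square_summable xi -> square_summable eta ->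
  forall e : R, 0 < e -> F [set i | sigma_weak_seminorm xi eta (O i) < e].
Proof.
move=> B0 bO wO sxi seta e e0.
pose s j := B * (hnorm (xi j) ^+ 2 + hnorm (eta j) ^+ 2).
have cs : cvgn (series s).
  apply: cvg_series_ereal; first by move=> j; rewrite mulr_ge0// addr_ge0 ?sqr_ge0.
  under eq_eseriesr do rewrite EFinM EFinD.
  rewrite nneseriesZl; last by move=> j _; rewrite -EFinD lee_fin addr_ge0 ?sqr_ge0.
  rewrite nneseriesD; last 2 first.
  - by move=> j _ _; rewrite lee_fin sqr_ge0.
  - by move=> j _ _; rewrite lee_fin sqr_ge0.
  apply: lte_mul_pinfty; [by rewrite lee_fin|by []|].
  exact: (lte_add_pinfty sxi seta).
have e2 : 0 < e / 2 by rewrite divr_gt0.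
have /cvg_realP/(_ _ e2)[J _ /(_ J (leqnn J)) hJ] := cs.
(* An equal share of e / 2 for each head term; [J.+1] avoids division by zero when [J = 0]. *)
pose d := e / 2 / J.+1%:R.
have d0 : 0 < d by rewrite !divr_gt0.
have hF : F [set i | forall j, (j < J)%N -> cabs (hdot (O i (xi j)) (eta j)) <= d].
  move: (J) => J'; elim: J' => [|J' IH]; first by apply: filterS filterT.
  apply: filterS2 IH (wO (xi J') (eta J') d d0) => i h1 h2 j.
  by rewrite ltnS leq_eqVlt => /orP[/eqP ->|]; [exact: h2|exact: h1].
apply: filterS hF => i hi /=.
apply: le_lt_trans (complex_series_tail J (fun j => bO i (xi j) (eta j)) cs) _.
rewrite (splitr e); apply: ler_ltD.
  apply: le_trans (_ : \sum_(0 <= j < J) d <= _).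
    by rewrite !big_nat; apply: ler_sum => j /andP[_ jJ]; exact: hi.
  rewrite big_const_nat subn0 iter_addr_0 -[X in X <= _]mulr_natr /d -mulrA.
  apply: ler_piMr; first exact: ltW.
  by rewrite mulrC ler_pdivrMr// mul1r ler_nat.
by apply: le_lt_trans hJ; rewrite distrC ler_norm.
Qed.

(** The single entry point of the sigma-weak continuity of [x]. The filter is arbitrary in order to
    cover sequences as well as double indices tending to infinity. *)
Lemma predual_vanish (M : set (H -> H)) (x : (H -> H) -> R[i]) (b : H -> H)
    (I : Type) (F : set_system I) (FF : Filter F) (O : I -> H -> H) (B : R) :
  predual M x -> M b -> (forall i, M (O i)) -> 0 <= B ->
  (forall i g g', cabs (hdot (O i g - b g) g') <= B * (hnorm g ^+ 2 + hnorm g' ^+ 2)) ->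
  (forall g g' (e : R), 0 < e -> F [set i | cabs (hdot (O i g - b g) g') <= e]) ->
  forall e : R, 0 < e -> F [set i | cabs (x (O i) - x b) < e].
Proof.
move=> [_ cx] Mb MO B0 bO wO e e0.
have [k [xi [eta [ss hx]]]] := cx b Mb e e0.
have : F [set i | forall q : 'I_k, sigma_weak_seminorm (xi q) (eta q) (O i - b) < 1].
  apply: filter_forall => q; have [s1 s2] := ss q.
  exact: (@seminorm_vanish I F FF (fun i => O i - b) B (xi q) (eta q) B0 bO wO s1 s2 1 ltr01).
by apply: filterS => i hi; apply: hx.
Qed.

Lemma predual0 (M : set (H -> H)) (x : (H -> H) -> R[i]) : predual M x -> M 0 -> x 0 = 0.
Proof. by move=> [lx _] M0; have := lx (-1) 0 0 M0 M0; rewrite scaler0 addr0 mulN1r addNr. Qed.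

(** Membership in [c0] is convergence to 0 along this filter. *)
Definition cofinite (I : Type) : set_system I := fun P => finite_set (~` P).

Lemma cofinite_filter (I : Type) : Filter (@cofinite I).
Proof.
split; rewrite /cofinite.
- by rewrite setCT.
- by move=> P Q fP fQ; rewrite setCI finite_setU.
- by move=> P Q PQ; apply: sub_finite_set; exact: subsetC.
Qed.

End Predual.

(** * Adjoints of the [u_kl], and weak convergence of the [u_kl] to 0 *)

Section FourierCoefficients.
Variable R : realType.
Local Notation T := (circle R).
Local Notation H := (Hspace R).
Implicit Types (x y g : H) (phi psi : T -> R[i]).
#[local] Opaque hmk hrepr hdot hnorm.
Variable f : T -> T.
Hypothesis bf : bijective f.
Hypothesis nf : forall n, nonsing (ziter f n).

(** At coordinate [n] the weight works out to f^n(z)^(-l). Writing it as a [Top] yields membership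
    in M at once. *)
Definition uadj (k l : int) : H -> H :=
  Top f (- k) (fun z => circle_val (ziter f (- k) z) ^ (- l)).

Lemma bmeas_orbit (n l : int) : bmeas 1 (fun z : T => circle_val (ziter f n z) ^ l).
Proof. exact: bmeas_comp (mziter nf n) (bmeas_circleX R l). Qed.

Lemma uadjK k l x : u_ f k l (uadj k l x) = x.
Proof.
rewrite u_E /uadj /Top.
rewrite (wop_comp _ _ _ (weight_Top nf k (bmeas_circleX R l)) (weight_Top nf (- k) (bmeas_orbit (- k) (- l)))
  (nonsing_id R) (nonsing_id R)) -[RHS]wop_id.
apply: wop_ext => [n z| |//]; last by rewrite addrN.
rewrite /= -(ziterD _ _ bf) (_ : - k + (n - k - - k) = n - k); last by lia.
by rewrite -expfzDr ?circle_val_neq0// addrN.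
Qed.

Lemma u_isometry k l x : hnorm (u_ f k l x) = hnorm x.
Proof.
rewrite u_E; apply: (wop_isometry k x (weight_Top nf k (bmeas_circleX R l))).
by move=> n z; exact: cabs_circleX.
Qed.

Lemma u_linear k l : linear (u_ f k l).
Proof. by rewrite u_E; case: (Top_bounded nf k (bmeas_circleX R l)). Qed.

(** An isometry preserves inner products, so its right inverse is its adjoint. *)
Lemma u_adjoint k l : is_adjoint (u_ f k l) (uadj k l).
Proof.
move=> x y; rewrite -{1}(uadjK k l y).
exact: (isometry_hdot (u_linear k l) (u_isometry k l)).
Qed.

Lemma adjoint_u k l : adjoint (u_ f k l) = uadj k l.
Proof.
apply: adjointE; last exact: u_adjoint.
exact: (Top_bounded nf (- k) (bmeas_orbit (- k) (- l))).
Qed.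

Lemma uadj_contraction k l x : hnorm (uadj k l x) <= hnorm x.
Proof. by rewrite -[leLHS](u_isometry k l) uadjK. Qed.

Lemma finite_large_coeff (W : H -> H) g (e : R) : bounded_operator W -> 0 < e ->
  finite_set [set kl | e < cabs (hdot g (W (fbasis R kl)))].
Proof.
move=> [lW [C bW]] e0; apply: contrapT => inf.
have bW' y : hnorm (W y) <= `|C| * hnorm y.
  by apply: le_trans (bW y) _; apply: ler_wpM2r; [exact: hnorm_ge0|exact: ler_norm].
(* Bessel allows at most C^2 |g|^2 / e^2 coefficients above [e]; [n] exceeds this number. *)
pose n := (Num.truncn (`|C| ^+ 2 * hnorm g ^+ 2 / e ^+ 2)).+1.
have [B BA nB] := infinite_set_fset n inf.
have e2 : 0 < e ^+ 2 by rewrite exprn_gt0.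
have := bessel g lW (normr_ge0 C) bW' (finmap.fset_uniq B).
apply/negP; rewrite -ltNge.
apply: lt_le_trans (_ : n%:R * e ^+ 2 <= _).
  by rewrite -ltr_pdivrMr//; exact: truncnS_gt.
apply: le_trans (_ : \sum_(kl <- finmap.enum_fset B) e ^+ 2 <= _).
  rewrite big_const_seq count_predT iter_addr_0 -[X in _ <= X]mulr_natl ler_pM2r// ler_nat.
  by rewrite finmap.cardfE cardE in nB *; exact: nB.
rewrite !big_seq; apply: ler_sum => kl klB.
have := BA kl klB; rewrite /= => h.
by rewrite lerXn2r ?nnegrE ?cabs_ge0 ?ltW.
Qed.

(** The [u_kl] being isometries, convergence passes to limits of vectors and is tested on a total
    family. At coordinate [n] monomials in f^n(z) are adapted: [u_kl] multiplies them by f^n(z)^l,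
    which shifts the exponent. *)
Lemma u_weak_null g x (e : R) : 0 < e ->
  cofinite [set kl | cabs (hdot g (u_ f kl.1 kl.2 x)) <= e].
Proof.
have FC := cofinite_filter (int * int).
pose P x := forall e : R, 0 < e -> cofinite [set kl | cabs (hdot g (u_ f kl.1 kl.2 x)) <= e].
suff h : P x by exact: h.
have lin kl := linearDZ (u_linear kl.1 kl.2).
have P0 : P 0.
  move=> e' e0; apply: filterS filterT => kl _ /=.
  by have [_ _ -> _] := lin kl; rewrite hdot0r cabs0 ltW.
have PD y z : P y -> P z -> P (y + z).
  move=> py pz e' e0; have e2 : 0 < e' / 2 by rewrite divr_gt0.
  apply: filterS2 (py _ e2) (pz _ e2) => kl /= h1 h2.
  have [-> _ _ _] := lin kl; rewrite hdotDr [e']splitr.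
  exact: le_trans (cabsD _ _) (lerD h1 h2).
have PZ (a : R[i]) y : P y -> P (a *: y).
  move=> py e' e0; have a0 : 0 < cabs a + 1 by rewrite ltr_wpDl ?cabs_ge0.
  have e2 : 0 < e' / (cabs a + 1) by rewrite divr_gt0.
  apply: filterS (py _ e2) => kl /= h1.
  have [_ -> _ _] := lin kl; rewrite hdotZr cabsM cabsJ.
  apply: le_trans (_ : (cabs a + 1) * cabs (hdot g (u_ f kl.1 kl.2 y)) <= _).
    by apply: ler_wpM2r; [exact: cabs_ge0|rewrite lerDl].
  by rewrite mulrC -ler_pdivlMr.
have Plim y : (forall e : R, 0 < e -> exists2 z, P z & hnorm (y - z) <= e) -> P y.
  move=> hy e' e0; have e2 : 0 < e' / 2 by rewrite divr_gt0.
  have g0 : 0 < hnorm g + 1 by rewrite ltr_wpDl ?hnorm_ge0.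
  have e3 : 0 < e' / 2 / (hnorm g + 1) by rewrite divr_gt0.
  have [z pz yz] := hy _ e3.
  apply: filterS (pz _ e2) => kl /= h1.
  rewrite -(subrK z y); have [-> _ _ _] := lin kl; rewrite hdotDr [e']splitr.
  apply: le_trans (cabsD _ _) (lerD _ h1).
  apply: le_trans (cabs_hdot _ _) _; rewrite u_isometry.
  apply: le_trans (_ : (hnorm g + 1) * hnorm (y - z) <= _).
    by apply: ler_wpM2r; [exact: hnorm_ge0|rewrite lerDl].
  by rewrite mulrC -ler_pdivlMr.
apply: (H_ind P0 PD Plim) => n K phi bphi.
have key L psi : bmeas L psi -> P (site n (fun z => psi (ziter f n z))).
  move: L psi; apply: bmeas_ind.
  - move=> l e' e0.
    (* All u_kl act on this vector as one commutant element on distinct orthonormal vectors. *)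
    have ue kl : u_ f kl.1 kl.2 (site n (fun z => circle_val (ziter f n z) ^ l)) =
        Yop f n (fun _ => 1) (fbasis R (kl.1, kl.2 + l)).
      have lo := L2_bmeas (bmeas_orbit n l).
      rewrite u_E /Top (wop_site _ _ (weight_Top nf kl.1 (bmeas_circleX R kl.2)) (nonsing_id R) lo).
      rewrite /Yop /fbasis (wop_site _ _ (weight_1 R) (nf n) (L2_monomial R _)) addrC.
      congr site; apply/funext => z; rewrite mul1r addrC addrK.
      by rewrite -expfzDr ?circle_val_neq0.
    have bY : bounded_operator (Yop f n (fun _ => 1)).
      exact: (Yop_bounded nf n (weight_1 R 0)).
    have := finite_large_coeff g bY e0.
    move=> /(finite_preimage (f := fun kl : int * int => (kl.1, kl.2 + l))) fin.
    apply: sub_finite_set (fin _); last first.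
      by move=> [a b] [a' b'] _ _ /= [-> /addIr ->].
    by move=> kl /=; rewrite ue => /negP; rewrite -ltNge.
  - move=> a K1 K2 p q bp bq pp pq.
    have b1 := bmeas_comp (mziter nf n) bp; have b2 := bmeas_comp (mziter nf n) bq.
    rewrite (site_lin n a (L2_bmeas b1) (L2_bmeas b2)).
    exact: PD (PZ a _ pp) pq.
  - move=> K1 p_ p bp_ bp pp_ pc; apply: Plim => e' e0.
    have bj j := bmeas_comp (mziter nf n) (bp_ j); have b := bmeas_comp (mziter nf n) bp.
    pose d j z := -1 * p_ j (ziter f n z) + p (ziter f n z).
    have bd j : bmeas (cabs (-1) * K1 + K1) (d j) := bmeas_lin (-1) (bj j) b.
    have d0 z : d j z @[j --> \oo] --> 0.
      have /cvg_complexP pcz := pc (ziter f n z); apply/cvg_complexP => e1 e10.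
      apply: filterS (pcz e1 e10) => j.
      rewrite (_ : d j z - 0 = - (p_ j (ziter f n z) - p (ziter f n z))) ?cabsN//.
      by rewrite subr0 /d mulN1r opprB addrC.
    have l1 : L2fun (fun _ : T => 1 : R[i]) := L2_bmeas (weight_1 R 0).
    have /cvg_realP/(_ e' e0)[j _ /(_ j (leqnn j))] := site_cvg0 n l1 bd d0.
    rewrite subr0 (ger0_norm (hnorm_ge0 _)) => hj.
    exists (site n (fun z => p_ j (ziter f n z))); first exact: pp_.
    rewrite [X in hnorm X]addrC -scaleN1r -(site_lin n (-1) (L2_bmeas (bj j)) (L2_bmeas b)).
    apply: le_trans (ltW hj); rewrite le_eqVlt; apply/orP; left; apply/eqP; congr (hnorm (site _ _)).
    by apply/funext => z; rewrite mulr1.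
(* Every bounded [phi] has the form psi \o f^n, with psi = phi \o f^(-n). *)
have bphi' := bmeas_comp (mziter nf (- n)) bphi.
have := key _ _ bphi'; congr (P (site n _)); apply/funext => z.
by rewrite ziterN.
Qed.

End FourierCoefficients.

(** * Injectivity of the Fourier transform *)

Lemma addr_sub_sub (V : zmodType) (p q r s : V) : p + q - (r + s) = (p - r) + (q - s).
Proof. by rewrite opprD addrACA. Qed.

Section Fejer.
Variable R : realType.
Local Notation T := (circle R).
Local Notation H := (Hspace R).
Implicit Types (x y : H) (phi psi : T -> R[i]).
#[local] Opaque hmk hrepr hdot hnorm.

Lemma additive_null (I : Type) (F : set_system I) (FF : Filter F) (E : I -> H -> R[i]) (B : R) :
  (forall i x y, E i (x + y) = E i x + E i y) -> 0 <= B ->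
  (forall i x, cabs (E i x) <= B * hnorm x) ->
  (forall n K phi, bmeas K phi -> forall e : R, 0 < e -> F [set i | cabs (E i (site n phi)) <= e]) ->
  forall x (e : R), 0 < e -> F [set i | cabs (E i x) <= e].
Proof.
move=> ED B0 EB Esite; apply: H_ind.
- move=> e e0; apply: filterS filterT => i _ /=.
  by apply: le_trans (EB i 0) _; rewrite hnorm_zero mulr0 ltW.
- move=> x y hx hy e e0; have e2 : 0 < e / 2 by rewrite divr_gt0.
  apply: filterS2 (hx _ e2) (hy _ e2) => i /= h1 h2.
  by rewrite ED [e]splitr; exact: le_trans (cabsD _ _) (lerD h1 h2).
- move=> x hx e e0; have e2 : 0 < e / 2 by rewrite divr_gt0.
  have B1 : 0 < B + 1 by rewrite ltr_wpDl.
  have e3 : 0 < e / 2 / (B + 1) by rewrite divr_gt0.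
  have [y hy xy] := hx _ e3.
  apply: filterS (hy _ e2) => i /= h1.
  rewrite -(subrK y x) ED [e]splitr; apply: le_trans (cabsD _ _) (lerD _ h1).
  apply: le_trans (EB _ _) _.
  apply: le_trans (_ : (B + 1) * hnorm (x - y) <= _).
    by apply: ler_wpM2r; [exact: hnorm_ge0|rewrite lerDl].
  by rewrite mulrC -ler_pdivlMr.
- exact: Esite.
Qed.

(** Two applications of [additive_null], one in each variable. It reduces the Fejer estimates to
    matrix entries between bounded sites, which are explicit. *)
Lemma form_null (I : Type) (F : set_system I) (FF : Filter F) (D : I -> H -> H -> R[i]) (B : R) :
  (forall i x x' y, D i (x + x') y = D i x y + D i x' y) ->
  (forall i x y y', D i x (y + y') = D i x y + D i x y') -> 0 <= B ->
  (forall i x y, cabs (D i x y) <= B * (hnorm x * hnorm y)) ->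
  (forall m n K L phi psi, bmeas K phi -> bmeas L psi ->
    forall e : R, 0 < e -> F [set i | cabs (D i (site m phi) (site n psi)) <= e]) ->
  forall x y (e : R), 0 < e -> F [set i | cabs (D i x y) <= e].
Proof.
move=> Dl Dr B0 DB Dsite x.
apply: (additive_null FF (B := B * hnorm x)).
- by move=> i y y'; exact: Dr.
- by rewrite mulr_ge0 ?hnorm_ge0.
- by move=> i y; rewrite -mulrA; exact: DB.
move=> n L psi bpsi; move: x; apply: (additive_null FF (B := B * hnorm (site n psi))).
- by move=> i x x'; exact: Dl.
- by rewrite mulr_ge0 ?hnorm_ge0.
- by move=> i x; rewrite -mulrA [X in _ <= _ * X]mulrC; exact: DB.
by move=> m K phi bphi; exact: Dsite bphi bpsi.
Qed.

Definition inwin (N : nat) (s n : int) : bool := (0 <= n - s) && (n - s < N%:Z).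

Definition compress (N : nat) (s : int) : H -> H := wop (fun n _ => (inwin N s n)%:R) 0 id.

Lemma weight_compress N s : weight 1 (fun n (_ : T) => (inwin N s n)%:R).
Proof.
move=> n; split; first exact: cmeasurable_cst.
by move=> z; case: inwin; rewrite ?cabs0 ?cabs1.
Qed.

Lemma compress_linear N s : linear (compress N s).
Proof. exact: wop_linear (weight_compress N s) (nonsing_id R). Qed.

Lemma compress_site N s n phi : L2fun phi ->
  compress N s (site n phi) = (inwin N s n)%:R *: site n phi.
Proof.
move=> lp; rewrite /compress (wop_site _ _ (weight_compress N s) (nonsing_id R) lp) addr0.
set c := _%:R; rewrite -[RHS](subrK (site n phi)) -[X in _ = _ - X + _]scale1r -scalerBl.
rewrite -(site_lin n (c - 1) lp lp); congr site; apply/funext => z.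
by rewrite mulrBl mul1r subrK.
Qed.

(** A coordinate [n] lies in the windows that start at n - t with t < N, so it is counted at most
    [N] times. *)
Lemma sum_compress_sqr N (L : seq int) x : uniq L ->
  \sum_(s <- L) hnorm (compress N s x) ^+ 2 <= N%:R * hnorm x ^+ 2.
Proof.
move=> uL.
suff : (\sum_(s <- L) (hnorm (compress N s x) ^+ 2)%:E <= N%:R%:E * nsq (hrepr x))%E.
  by rewrite -(hnorm_nsq x) -EFinM sumEFin lee_fin.
pose v n := nrm2 (hrepr x n).
have cE s : (hnorm (compress N s x) ^+ 2)%:E = (\esum_(n in [set: int]) if inwin N s n then v n else 0)%E.
  rewrite hnorm_nsq; apply: eq_esum => n _.
  have wE := wopE 0 x n (weight_compress N s) (nonsing_id R).
  have mw : cmeasurable (fun z => (inwin N s n)%:R * hrepr x (n - 0) z).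
    by apply: cmeasurableZ; exact: cmeas_repr.
  rewrite (nrm2_ae (cmeas_repr _ _) mw wE) subr0.
  case: inwin; first by congr nrm2; apply/funext => z; rewrite mul1r.
  by under eq_fun do rewrite mul0r; exact: nrm20.
under eq_bigr do rewrite cE.
have v0 n : (0 <= v n)%E by exact: nrm2_ge0.
rewrite -esum_sum; last by move=> n s _ _; case: ifP.
apply: le_trans (le_esumZl (ler0n _ N) v0); apply: le_esum => n _.
have vE : v n = (fine (v n))%:E by rewrite fineK// ge0_fin_numE//; case: (L2_repr x n).
rewrite -big_mkcond /= vE sumEFin -EFinM lee_fin.
have f0 : 0 <= fine (v n) by exact: fine_ge0.
rewrite big_const_seq iter_addr_0 -[X in X <= _]mulr_natl; apply: ler_wpM2r => //.
rewrite ler_nat -size_filter -[leqRHS](size_iota 0 N) -(size_map (fun t : nat => n - t%:Z)).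
apply: uniq_leq_size; first exact: filter_uniq.
move=> s; rewrite mem_filter => /andP[/andP[s1 s2] _].
by apply/mapP; exists `|(n - s)%R|%N; rewrite ?mem_iota; lia.
Qed.

Lemma compress_le N s x : hnorm (compress N s x) <= hnorm x.
Proof. by rewrite -[leRHS]mul1r; exact: wop_bound1 0 x ler01 (weight_compress N s). Qed.

#[local] Opaque compress.

(** Uses u v <= (t u^2 + w v^2) / 2 with t = q / p and w = p / q, the weights for which each
    hypothesis contributes n p q / 2. *)
Lemma sum_cauchy (I : Type) (L : seq I) (u v : I -> R) (n p q : R) : 0 < p -> 0 < q ->
  \sum_(s <- L) u s ^+ 2 <= n * p ^+ 2 -> \sum_(s <- L) v s ^+ 2 <= n * q ^+ 2 ->
  \sum_(s <- L) u s * v s <= n * (p * q).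
Proof.
move=> p0 q0 hu hv.
have c2 : 2 * 2^-1 = 1 :> R by rewrite mulfV ?pnatr_eq0.
have c0 : 0 <= 2^-1 :> R by rewrite invr_ge0 ler0n.
have t0 : 0 <= q / p by rewrite divr_ge0 ?ltW.
have w0 : 0 <= p / q by rewrite divr_ge0 ?ltW.
have tt : q / p * (p / q) = 1 by rewrite mulrA divfK ?divff ?gt_eqF.
have tp : q / p * p ^+ 2 = p * q by rewrite expr2 mulrA divfK ?gt_eqF// mulrC.
have wq : p / q * q ^+ 2 = p * q by rewrite expr2 mulrA divfK ?gt_eqF.
move: (q / p) (p / q) 2^-1 t0 w0 tt tp wq c2 c0 => t w c t0 w0 tt tp wq c2 c0.
apply: le_trans (_ : \sum_(s <- L) (t * c * u s ^+ 2 + w * c * v s ^+ 2) <= _).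
  apply: ler_sum => s _; move: (u s) (v s) => a b.
  have h : 0 <= w * c * (t * a - b) ^+ 2 by apply: mulr_ge0; [exact: mulr_ge0|exact: sqr_ge0].
  rewrite -subr_ge0; move: h; congr (_ <= _).
  transitivity (t * (t * w) * c * a ^+ 2 + w * c * b ^+ 2 - (2 * c) * (t * w) * (a * b)); first by ring.
  by rewrite tt c2; ring.
rewrite big_split /= -!mulr_sumr.
have tc : 0 <= t * c by exact: mulr_ge0.
have wc : 0 <= w * c by exact: mulr_ge0.
apply: le_trans (lerD (ler_wpM2l tc hu) (ler_wpM2l wc hv)) _.
rewrite le_eqVlt; apply/orP; left; apply/eqP.
transitivity (n * c * (t * p ^+ 2) + n * c * (w * q ^+ 2)); first by ring.
rewrite tp wq; transitivity (n * (p * q) * (2 * c)); first by ring.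
by rewrite c2 mulr1.
Qed.

Lemma sum_compress N (L : seq int) x y : uniq L ->
  \sum_(s <- L) hnorm (compress N s x) * hnorm (compress N s y) <= N%:R * (hnorm x * hnorm y).
Proof.
move=> uL.
have null z : hnorm z = 0 -> forall s, hnorm (compress N s z) = 0.
  move=> z0 s; apply/eqP; rewrite eq_le hnorm_ge0 andbT.
  by rewrite -z0; exact: compress_le.
have nn0 : 0 <= N%:R * (hnorm x * hnorm y) by rewrite !mulr_ge0 ?hnorm_ge0.
have [x0|x0] := eqVneq (hnorm x) 0.
  apply: le_trans nn0; apply: sumr_le0 => s _.
  move: (hnorm _) (null x x0 s) => r ->; rewrite mul0r; exact: lexx.
have [y0|y0] := eqVneq (hnorm y) 0.
  apply: le_trans nn0; apply: sumr_le0 => s _.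
  move: (hnorm (compress N s y)) (null y y0 s) => r ->; rewrite mulr0; exact: lexx.
have xp : 0 < hnorm x by rewrite lt_def x0 hnorm_ge0.
have yp : 0 < hnorm y by rewrite lt_def y0 hnorm_ge0.
exact: (sum_cauchy (u := fun s => hnorm (compress N s x)) (v := fun s => hnorm (compress N s y))
  xp yp (sum_compress_sqr N x uL) (sum_compress_sqr N y uL)).
Qed.

(** This is max(N - |k|, 0), that is, N times the Fejer weight of [k]. *)
Definition npairs (N : nat) (k : int) : nat :=
  (\sum_(r < N) \sum_(t < N) (r%:Z - t%:Z == k)%R)%N.

Lemma sum_eq_nat (N : nat) (j : int) :
  (\sum_(t < N) (t%:Z == j) = ((0 <= j) && (j < N%:Z))%R)%N.
Proof.
elim: N => [|N IH]; first by rewrite big_ord0; lia.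
rewrite big_ord_recr /= IH; lia.
Qed.

Lemma npairsE N k : npairs N k = (\sum_(t < N) ((0 <= k + t%:Z) && (k + t%:Z < N%:Z))%R)%N.
Proof.
rewrite /npairs exchange_big /=; apply: eq_bigr => t _.
by rewrite -sum_eq_nat; apply: eq_bigr => r _; congr (nat_of_bool _); lia.
Qed.

Lemma npairs_le N k : (npairs N k <= N)%N.
Proof.
rewrite npairsE -[leqRHS]card_ord -sum1_card; apply: leq_sum => t _.
by case: (_ && _).
Qed.

Lemma npairs_ge N k : (N <= npairs N k + `|k|)%N.
Proof.
rewrite npairsE.
(* The remainder records where the condition fails: for k >= 0 at the last |k| values of [t], whence
   the truncated difference M + |k| - N; for k < 0 at the first |k| values. *)
have h M : (M <= N)%N -> (M <= \sum_(t < M) ((0 <= k + t%:Z) && (k + t%:Z < N%:Z))%R +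
    (if (0 <= k)%R then M + `|k| - N else `|k|))%N.
  elim: M => [//|M IH] MN; rewrite big_ord_recr /=; have := IH (ltnW MN).
  by move: (\sum_(t < M) _)%N => S; case: ifP => k0; case: (boolP (_ && _)) => hw; lia.
by have := h N (leqnn N); case: ifP => k0; lia.
Qed.

(** A window that contains both points starts at s = m - t = n - r with r, t < N, so r - t = n - m.
    The hypothesis on [L] ensures that no window around [m] is missed. *)
Lemma sum_inwin N (L : seq int) (m n : int) : uniq L -> (forall t, (t < N)%N -> m - t%:Z \in L) ->
  (\sum_(s <- L) inwin N s m * inwin N s n = npairs N (n - m))%N.
Proof.
move=> uL mL.
have inE_ s j : inwin N s j = (\sum_(t < N) (s == j - t%:Z)%R)%N :> nat.
  rewrite /inwin -sum_eq_nat; apply: eq_bigr => t _; congr (nat_of_bool _); lia.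
under eq_bigr do rewrite inE_ big_distrl /=.
rewrite exchange_big /= /npairs [RHS]exchange_big /=; apply: eq_bigr => t _.
rewrite (bigD1_seq (m - t%:Z)) ?mL//= eqxx mul1n big1 ?addn0.
  by rewrite inE_; apply: eq_bigr => r _; congr (nat_of_bool _); lia.
by move=> s /negbTE ->; rewrite mul0n.
Qed.

Variables (a : H -> H) (C : R) (d : int -> H -> H).
Hypothesis la : linear a.
Hypothesis C0 : 0 <= C.
Hypothesis ba : forall x, hnorm (a x) <= C * hnorm x.
Hypothesis bd : forall k, bounded_operator (d k).
Hypothesis dE : forall k m n K L phi psi, bmeas K phi -> bmeas L psi ->
  hdot (d k (site m phi)) (site n psi) =
  if m + k == n then hdot (a (site m phi)) (site n psi) else 0.

(** The diagonal [d k] occurs with total weight [npairs N k] / N. As a finite combination of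
    diagonals it stays in M, which the compressions of [a] need not do. *)
Definition fejer (N : nat) : H -> H :=
  (N%:R^-1 : R[i]) *: \sum_(r < N) \sum_(t < N) d (r%:Z - t%:Z).

Lemma fejerE N x : fejer N x = (N%:R^-1 : R[i]) *: \sum_(r < N) \sum_(t < N) d (r%:Z - t%:Z) x.
Proof.
rewrite /fejer; congr (_ *: _); rewrite fct_sumE; apply: eq_bigr => r _.
by rewrite fct_sumE.
Qed.

Lemma fejerD N x y : fejer N (x + y) = fejer N x + fejer N y.
Proof.
rewrite !fejerE -scalerDr -big_split /=; congr (_ *: _); apply: eq_bigr => r _.
rewrite -big_split /=; apply: eq_bigr => t _.
by have [ld _] := bd (r%:Z - t%:Z); have [-> _ _ _] := linearDZ ld.
Qed.

(** A preliminary bound that may grow with [N]; it makes the density argument for fixed [N]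
    possible, and [fejer_form] then gives the uniform one. *)
Lemma fejer_bounded N : exists2 B : R, 0 <= B & forall x, hnorm (fejer N x) <= B * hnorm x.
Proof.
pose P (W : H -> H) := exists2 B : R, 0 <= B & forall x, hnorm (W x) <= B * hnorm x.
have P0 : P 0 by exists 0 => // x; rewrite mul0r hnorm_zero.
have PD U V : P U -> P V -> P (U + V).
  move=> [B1 b1 h1] [B2 b2 h2]; exists (B1 + B2); first exact: addr_ge0.
  by move=> x; rewrite mulrDl; apply: le_trans (hnorm_add _ _) (lerD (h1 x) (h2 x)).
have Pd k : P (d k).
  have [_ [B hB]] := bd k; exists `|B|; first exact: normr_ge0.
  move=> x; apply: le_trans (hB x) _.
  by apply: ler_wpM2r; [exact: hnorm_ge0|exact: ler_norm].
have [B B0 hB] : P (\sum_(r < N) \sum_(t < N) d (r%:Z - t%:Z)).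
  by apply: (big_ind P P0 PD) => r _; apply: (big_ind P P0 PD) => t _; exact: Pd.
exists (cabs (N%:R^-1 : R[i]) * B); first by rewrite mulr_ge0 ?cabs_ge0.
move=> x; rewrite /fejer -mulrA.
rewrite [X in hnorm X](_ : _ = (N%:R^-1 : R[i]) *: (\sum_(r < N) \sum_(t < N) d (r%:Z - t%:Z)) x)//.
by rewrite hnorm_scale; apply: ler_wpM2l; [exact: cabs_ge0|exact: hB].
Qed.

Lemma fejer_site N m n K L phi psi : bmeas K phi -> bmeas L psi ->
  hdot (fejer N (site m phi)) (site n psi) =
  (N%:R^-1 * (npairs N (n - m))%:R) * hdot (a (site m phi)) (site n psi).
Proof.
move=> bp bq; rewrite fejerE hdotZl -mulrA; congr (_ * _).
rewrite hdot_suml /npairs natr_sum mulr_suml; apply: eq_bigr => r _.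
rewrite hdot_suml natr_sum mulr_suml; apply: eq_bigr => t _.
rewrite (dE _ _ _ bp bq) (_ : (m + _ == n) = (r%:Z - t%:Z == n - m)); last by lia.
by case: eqP; rewrite ?mul1r ?mul0r.
Qed.

Definition blocks N (L : seq int) x y : R[i] :=
  \sum_(s <- L) hdot (a (compress N s x)) (compress N s y).

Lemma blocks_bound N L x y : uniq L -> cabs (blocks N L x y) <= C * (N%:R * (hnorm x * hnorm y)).
Proof.
move=> uL; apply: le_trans (_ : \sum_(s <- L) C * (hnorm (compress N s x) * hnorm (compress N s y)) <= _).
  rewrite /blocks; elim/big_rec2: _ => [|s u v _ uv]; first by rewrite cabs0.
  apply: le_trans (cabsD _ _) (lerD _ uv); apply: le_trans (cabs_hdot _ _) _.
  by rewrite mulrA; apply: ler_wpM2r; [exact: hnorm_ge0|exact: ba].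
by rewrite -mulr_sumr; apply: ler_wpM2l => //; exact: sum_compress.
Qed.

Lemma blocks_site N (L : seq int) m n K K' phi psi : bmeas K phi -> bmeas K' psi ->
  uniq L -> (forall t, (t < N)%N -> m - t%:Z \in L) ->
  blocks N L (site m phi) (site n psi) =
  (npairs N (n - m))%:R * hdot (a (site m phi)) (site n psi).
Proof.
move=> bp bq uL mL; rewrite -(sum_inwin n uL mL) natr_sum mulr_suml; apply: eq_bigr => s _.
rewrite !compress_site; [|exact: L2_bmeas bq|exact: L2_bmeas bp].
have [_ aZ _ _] := linearDZ la.
by rewrite aZ hdotZl hdotZr natrM -mulrA rmorph_nat.
Qed.

(* [fejer N] is the average over s of the compressions of a to the windows [s, s + N), which
   bounds it independently of N. *)
Lemma fejer_form N x y : (0 < N)%N -> cabs (hdot (fejer N x) y) <= C * (hnorm x * hnorm y).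
Proof.
move=> N0; have N0' : 0 < N%:R :> R by rewrite ltr0n.
have [B B0 hB] := fejer_bounded N.
(* Left ends of windows, from -k to k; they exhaust the integers as [k] grows, while [N] stays
   fixed. *)
pose win k : seq int := [seq i%:Z - k%:Z | i <- iota 0 k.*2.+1].
pose D k u v := hdot (fejer N u) v - (N%:R)^-1 * blocks N (win k) u v.
have cN : cabs (N%:R^-1 : R[i]) = N%:R^-1.
  by rewrite -(rmorph_nat (real_complex R)) -fmorphV cabsR ger0_norm// invr_ge0 ltW.
have bB k u v : cabs (N%:R^-1 * blocks N (win k) u v) <= C * (hnorm u * hnorm v).
  rewrite cabsM cN ler_pdivrMl//; apply: le_trans (blocks_bound N u v (uniq_window k)) _.
  by rewrite mulrCA.
have [aD _ _ _] := linearDZ la.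
apply/ler_addgt0Pr => e e0.
(* Between two sites the difference is exactly 0 as soon as all windows around the first one are
   included; [form_null] extends this to all vectors. *)
have : \forall k \near \oo, cabs (D k x y) <= e.
  apply: (@form_null _ _ _ D (B + C)) e0.
  - move=> k u u' v; rewrite /D fejerD hdotDl (_ : blocks _ _ _ _ = blocks N (win k) u v + blocks N (win k) u' v).
      by rewrite mulrDr; exact: addr_sub_sub.
    rewrite /blocks -big_split /=; apply: eq_bigr => s _.
    by have [-> _ _ _] := linearDZ (compress_linear N s); rewrite aD hdotDl.
  - move=> k u v v'; rewrite /D hdotDr (_ : blocks _ _ _ _ = blocks N (win k) u v + blocks N (win k) u v').
      by rewrite mulrDr; exact: addr_sub_sub.
    rewrite /blocks -big_split /=; apply: eq_bigr => s _.
    by have [-> _ _ _] := linearDZ (compress_linear N s); rewrite hdotDr.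
  - exact: addr_ge0.
  - move=> k u v; rewrite /D mulrDl; apply: le_trans (cabsD _ _) _; rewrite cabsN.
    apply: lerD (bB k u v); apply: le_trans (cabs_hdot _ _) _.
    by rewrite mulrA; apply: ler_wpM2r; [exact: hnorm_ge0|exact: hB].
  move=> m n K K' phi psi bp bq e' e0; exists (`|m| + N)%N => // k /= hk.
  rewrite /D (fejer_site _ _ _ bp bq) (blocks_site _ bp bq (uniq_window k)); last first.
    by move=> t tN; rewrite mem_window; lia.
  by rewrite mulrA subrr cabs0 ltW.
move=> [k _ /(_ k (leqnn k)) hk].
rewrite -(subrK (N%:R^-1 * blocks N (win k) x y) (hdot _ _)).
by apply: le_trans (cabsD _ _) _; rewrite [leRHS]addrC; exact: lerD hk (bB k x y).
Qed.

(** Between sites [m] and [n] the mean misses at most the fraction |n - m| / (N + 1) of the entry of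
    [a]; the uniform bound carries the convergence to all vectors. *)
Lemma fejer_weak x y (e : R) : 0 < e ->
  \forall N \near \oo, cabs (hdot (fejer N.+1 x - a x) y) <= e.
Proof.
have [aD _ _ _] := linearDZ la.
pose D (N : nat) x y := hdot (fejer N.+1 x - a x) y.
apply: (@form_null _ _ _ D (C + C)).
- by move=> N u u' v; rewrite /D fejerD aD [X in hdot X _]addr_sub_sub; exact: hdotDl.
- by move=> N u v v'; rewrite /D hdotDr.
- exact: addr_ge0.
- move=> N u v; rewrite /D hdotBl mulrDl; apply: le_trans (cabsD _ _) _; rewrite cabsN.
  apply: lerD; first exact: fejer_form.
  apply: le_trans (cabs_hdot _ _) _.
  by rewrite mulrA; apply: ler_wpM2r; [exact: hnorm_ge0|exact: ba].
move=> m n K K' phi psi bp bq e' e0.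
pose A := hdot (a (site m phi)) (site n psi).
pose k := `|(n - m)%R|%N.
exists (Num.truncn (k%:R * cabs A / e')).+1 => // N /= hN.
rewrite /D hdotBl (fejer_site _ _ _ bp bq) -/A.
have N0 : 0 < N.+1%:R :> R by rewrite ltr0n.
have h1 := npairs_ge N.+1 (n - m); have h2 := npairs_le N.+1 (n - m).
rewrite (_ : _ - A = - (((N.+1%:R^-1 * (N.+1 - npairs N.+1 (n - m))%:R) : R)%:C * A)); last first.
  rewrite rmorphM /= fmorphV /= !rmorph_nat natrB// mulrBr mulVf ?pnatr_eq0//.
  by rewrite mulrBl mul1r opprB.
rewrite cabsN cabsM cabsR ger0_norm; last by rewrite mulr_ge0 ?invr_ge0 ?ler0n.
rewrite -mulrA ler_pdivrMl//; apply: le_trans (_ : k%:R * cabs A <= _).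
  by apply: ler_wpM2r; [exact: cabs_ge0|rewrite ler_nat /k; lia].
rewrite -ler_pdivrMr//; apply: ltW; apply: lt_le_trans (truncnS_gt _) _.
by rewrite ler_nat ltnW.
Qed.

End Fejer.

(** * Diagonals of an operator that commutes with the [Yop] *)

Section MatrixCoefficients.
Variable R : realType.
Local Notation T := (circle R).
Local Notation H := (Hspace R).
Local Notation haar := (@haar R).
Implicit Types (x y : H) (phi psi : T -> R[i]).
#[local] Opaque hmk hrepr hdot hnorm.
Variable f : T -> T.
Hypothesis nf : forall n, nonsing (ziter f n).
Variables (a : H -> H) (C : R).
Hypothesis C0 : 0 <= C.
Hypothesis ba : forall x, hnorm (a x) <= C * hnorm x.
Hypothesis aY : forall K m phi x, bmeas K phi -> a (Yop f m phi x) = Yop f m phi (a x).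

Definition coeff (k : int) : T -> R[i] := hrepr (a (site 0 (fun _ => 1))) k.

(** [Yop f m phi] sends the cyclic vector to [site m phi], so commutation expresses the image of
    every bounded site through one fixed vector. The entry then depends on n - m, up to composition
    with f^m. *)
Lemma coeff_site n m K phi : bmeas K phi ->
  {ae haar, forall z, hrepr (a (site m phi)) n z = phi z * coeff (n - m) (ziter f m z)}.
Proof.
move=> bp; have l1 : L2fun (fun _ : T => 1 : R[i]) := L2_bmeas (weight_1 R 0).
have -> : site m phi = Yop f m phi (site 0 (fun _ => 1)).
  rewrite /Yop (wop_site _ _ (weight_Yop bp) (nf m) l1) add0r.
  by congr site; apply/funext => z; rewrite mulr1.
rewrite (aY _ _ bp).
exact: (wopE m (a (site 0 (fun _ => 1))) n (weight_Yop bp) (nf m)).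
Qed.

Lemma cmeas_coeff k : cmeasurable (coeff k).
Proof. exact: cmeas_repr. Qed.

Lemma cmeas_trunc k phi psi : cmeasurable phi -> cmeasurable psi ->
  cmeasurable (fun z => if cabs (coeff k z) ^+ 2 <= C ^+ 2 then phi z else psi z).
Proof.
move=> [mr mi] [nr ni]; have mc := measurable_cabs_sqr (cmeas_coeff k).
split.
  rewrite (_ : (fun z => _) = fun z => if cabs (coeff k z) ^+ 2 <= C ^+ 2
    then complex.Re (phi z) else complex.Re (psi z)); last by apply/funext => z; case: ifP.
  by apply: measurable_fun_ifT => //; exact: measurable_fun_ler.
rewrite (_ : (fun z => _) = fun z => if cabs (coeff k z) ^+ 2 <= C ^+ 2
  then complex.Im (phi z) else complex.Im (psi z)); last by apply/funext => z; case: ifP.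
by apply: measurable_fun_ifT => //; exact: measurable_fun_ler.
Qed.

(** Tested on the indicator of the set where the modulus exceeds [C], the operator would stretch by
    more than [C] unless that set is null. The function [g] below measures the excess: it is
    nonnegative with integral 0. *)
Lemma coeff_bound k : {ae haar, forall z, cabs (coeff k z) ^+ 2 <= C ^+ 2}.
Proof.
pose phi z : R[i] := if cabs (coeff k z) ^+ 2 <= C ^+ 2 then 0 else 1.
have mphi : cmeasurable phi by apply: cmeas_trunc; exact: cmeasurable_cst.
have bphi : bmeas 1 phi.
  by split=> // z; rewrite /phi; case: ifP => _; rewrite ?cabs0 ?cabs1.
pose psi z := phi z * coeff k z.
have mpsi : cmeasurable psi by apply: cmeasurableM => //; exact: cmeas_coeff.
have lphi := L2_bmeas bphi; have [_ fphi] := lphi.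
have h1 : (nrm2 psi <= (C ^+ 2)%:E * nrm2 phi)%E.
  rewrite -(hsq_site 0 lphi) -hnorm_sqr -EFinM -exprMn.
  have e : {ae haar, forall z, hrepr (a (site 0 phi)) k z = psi z}.
    by apply: ae1 (coeff_site k 0 bphi) => z; rewrite subr0.
  rewrite -(nrm2_ae (cmeas_repr _ _) mpsi e).
  apply: le_trans (nrm2_le_nsq _ _) _; rewrite -hnorm_nsq lee_fin.
  by apply: lerXn2r; rewrite ?nnegrE ?mulr_ge0 ?hnorm_ge0.
pose g z := cabs (psi z) ^+ 2 - C ^+ 2 * cabs (phi z) ^+ 2.
have g0 z : 0 <= g z.
  rewrite /g /psi /phi; case: ifP => [_|/negbT]; first by rewrite mul0r cabs0 expr0n mulr0 subrr.
  by rewrite -ltNge mul1r cabs1 expr1n mulr1 subr_ge0 => /ltW.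
have mg : measurable_fun setT g.
  apply: measurable_funB; first exact: measurable_cabs_sqr.
  by apply: measurable_funM; [exact: measurable_cst|exact: measurable_cabs_sqr].
have ge : (\int[haar]_z (g z)%:E + (C ^+ 2)%:E * nrm2 phi = nrm2 psi)%E.
  rewrite /nrm2 -ge0_integralZl//=; last 3 first.
  - by apply/measurable_EFinP; exact: measurable_cabs_sqr.
  - by move=> z _; rewrite lee_fin sqr_ge0.
  - by rewrite lee_fin sqr_ge0.
  rewrite -ge0_integralD//=; last 4 first.
  - by move=> z _; rewrite lee_fin.
  - exact/measurable_EFinP.
  - by move=> z _; rewrite -EFinM lee_fin mulr_ge0 ?sqr_ge0.
  - apply/measurable_EFinP; apply: measurable_funM; first exact: measurable_cst.
    exact: measurable_cabs_sqr.
  by apply: eq_integral => z _; rewrite -EFinM -EFinD /g subrK.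
have i0 : (\int[haar]_z (g z)%:E = 0)%E.
  apply/eqP; rewrite eq_le integral_ge0 ?andbT; last by move=> z _; rewrite lee_fin.
  have fin : ((C ^+ 2)%:E * nrm2 phi)%E \is a fin_num.
    rewrite ge0_fin_numE; last by rewrite mule_ge0 ?nrm2_ge0 ?lee_fin ?sqr_ge0.
    by rewrite lte_mul_pinfty ?lee_fin ?sqr_ge0.
  by rewrite -(leeD2rE _ _ fin) add0e ge.
have /(ae_eq_integral_abs haar measurableT) : measurable_fun setT (fun z => (g z)%:E).
  exact/measurable_EFinP.
under eq_integral => z _ do rewrite gee0_abs ?lee_fin//.
move=> [/(_ i0) + _]; apply: filterS => z /(_ Logic.I) /= /eqP; rewrite eqe /g /psi /phi.
case: leP => // lt; rewrite mul1r cabs1 expr1n mulr1 subr_eq0 => /eqP e.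
by rewrite e ltxx in lt.
Qed.

(** [coeff] altered on a null set, so that the bound holds everywhere, as [bmeas] requires. *)
Definition bcoeff (k : int) : T -> R[i] :=
  fun z => if cabs (coeff k z) ^+ 2 <= C ^+ 2 then coeff k z else 0.

Lemma bmeas_bcoeff k : bmeas C (bcoeff k).
Proof.
split; first by apply: cmeas_trunc; [exact: cmeas_coeff|exact: cmeasurable_cst].
move=> z; rewrite /bcoeff; case: ifP => [h|_]; last by rewrite cabs0.
by rewrite -(ler_pXn2r (ltn0Sn 1)) ?nnegrE ?cabs_ge0.
Qed.

Lemma Top_coeff k m n K L phi psi : bmeas K phi -> bmeas L psi ->
  hdot (Top f k (bcoeff k) (site m phi)) (site n psi) =
  if m + k == n then hdot (a (site m phi)) (site n psi) else 0.
Proof.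
move=> bp bq; have lp := L2_bmeas bp; have lq := L2_bmeas bq.
have bcm : bmeas C (fun z => bcoeff k (ziter f m z)).
  exact: bmeas_comp (mziter nf m) (bmeas_bcoeff k).
rewrite /Top (wop_site _ _ (weight_Top nf k (bmeas_bcoeff k)) (nonsing_id R) lp) addrK.
have lc : L2fun (fun z => bcoeff k (ziter f m z) * phi z) := L2_M bcm lp.
rewrite hdot_site2//; case: eqP => // mkn.
rewrite [RHS]hdotC hdot_site// ipC//; congr (_^*).
apply: ip_ae; [by case: lq|by case: lq|by case: lc|exact: cmeas_repr|exact: aeW|].
(* The coefficient is evaluated at f^m(z), so the exceptional null set is pulled back;
   nonsingularity keeps it null. *)
have cb := nonsing_ae (nf m) (coeff_bound k).
apply: (ae2 _ (coeff_site n m bp) cb) => z -> h.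
by rewrite /bcoeff -mkn (_ : m + k - m = k) ?h 1?mulrC//; lia.
Qed.

End MatrixCoefficients.

(** * Linearity of commutants, and zeros of a predual element under limits *)

Section Vanishing.
Variable R : realType.
Local Notation T := (circle R).
Local Notation H := (Hspace R).
Implicit Types (y g : H) (phi psi : T -> R[i]).
#[local] Opaque hmk hrepr hdot hnorm.

Lemma commutant_lin (S : set (H -> H)) (c : R[i]) (u v : H -> H) : (forall b, S b -> linear b) ->
  commutant S u -> commutant S v -> commutant S (c *: u + v).
Proof.
move=> lS [[lu [K1 b1]] cu] [[lv [K2 b2]] cv].
have [uD uZ _ _] := linearDZ lu; have [vD vZ _ _] := linearDZ lv.
have E y : (c *: u + v) y = c *: u y + v y by [].
split; first split.
- move=> k y z; rewrite !E uD vD uZ vZ !scalerDr !scalerA [k * c]mulrC.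
  by rewrite addrACA.
- exists (cabs c * K1 + K2) => y; rewrite E mulrDl -mulrA.
  apply: le_trans (hnorm_add _ _) _; rewrite hnorm_scale; apply: lerD (b2 y).
  by apply: ler_wpM2l; [exact: cabs_ge0|exact: b1].
move=> b Sb; have [bD bZ _ _] := linearDZ (lS b Sb).
apply/funext => y /=; rewrite !E bD bZ.
have := cu b Sb => /(congr1 (fun w => w y)) /= ->.
by have := cv b Sb => /(congr1 (fun w => w y)) /= ->.
Qed.

Lemma commutant0 (S : set (H -> H)) : (forall b, S b -> linear b) -> commutant S 0.
Proof.
move=> lS; split; first split.
- by move=> k y z; rewrite scaler0 addr0.
- by exists 0 => y; rewrite hnorm_zero mul0r.
move=> b Sb; have [_ _ b0 _] := linearDZ (lS b Sb).
by apply/funext => y /=; rewrite [RHS]b0.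
Qed.

Variables (M : set (H -> H)) (x : (H -> H) -> R[i]).
Hypothesis Mlin : forall c u v, M u -> M v -> M (c *: u + v).
Hypothesis M0 : M 0.
Hypothesis px : predual M x.

Lemma predual_scale c u : M u -> x u = 0 -> M (c *: u) /\ x (c *: u) = 0.
Proof.
move=> Mu xu; have [lx _] := px; rewrite -[c *: u]addr0; split; first exact: Mlin.
by rewrite lx// xu mulr0 add0r (predual0 px M0).
Qed.

Lemma predual_sum (I : Type) (r : seq I) (F : I -> H -> H) :
  (forall i, M (F i) /\ x (F i) = 0) -> M (\sum_(i <- r) F i) /\ x (\sum_(i <- r) F i) = 0.
Proof.
move=> MF; have [lx _] := px.
elim/big_rec: _ => [|i u _ [Mu xu]]; first by split=> //; exact: predual0 px M0.
have [Mi xi] := MF i; rewrite -[F i]scale1r; split; first exact: Mlin.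
by rewrite lx// xi xu mulr0 addr0.
Qed.

(** [predual_vanish] along a sequence; p q <= p^2 + q^2 converts the usual operator bound into the
    one required there. *)
Lemma predual_limit (O : nat -> H -> H) (b : H -> H) (B : R) : M b -> (forall j, M (O j)) ->
  (forall j, x (O j) = 0) -> 0 <= B ->
  (forall j g g', cabs (hdot (O j g - b g) g') <= B * (hnorm g * hnorm g')) ->
  (forall g g' (e : R), 0 < e -> \forall j \near \oo, cabs (hdot (O j g - b g) g') <= e) ->
  x b = 0.
Proof.
move=> Mb MO xO B0 bO wO; apply: cabs_eq0; apply/eqP; rewrite eq_le cabs_ge0 andbT.
apply: le0_eps => e e0.
have bO' j g g' : cabs (hdot (O j g - b g) g') <= B * (hnorm g ^+ 2 + hnorm g' ^+ 2).
  apply: le_trans (bO j g g') _; apply: ler_wpM2l => //.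
  move: (hnorm g) (hnorm g') (hnorm_ge0 g) (hnorm_ge0 g') => p q p0 q0.
  by have := sqr_ge0 (p - q); have := mulr_ge0 p0 q0; rewrite !expr2; nra.
have [j _ /(_ j (leqnn j)) /=] := predual_vanish _ px Mb MO B0 bO' wO e0.
by rewrite xO sub0r cabsN => /ltW.
Qed.

End Vanishing.

(** * The three assertions for a predual element *)

Section Main.
Variable R : realType.
Local Notation T := (circle R).
Local Notation H := (Hspace R).
Implicit Types (y g : H) (phi psi : T -> R[i]).
#[local] Opaque hmk hrepr hdot hnorm.
Variables f h : T -> T.
Hypothesis bf : bijective f.
Hypothesis nf : forall n, nonsing (ziter f n).
Hypothesis bh : bijective h.
Hypothesis mh : measurable_fun setT h.
Hypothesis mh' : measurable_fun setT (pinv setT h).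
Variable S : set (H -> H).
Hypothesis SU : S (opU f h).
Hypothesis SV : S (@opV R).
Hypothesis SY : forall K m phi, bmeas K phi -> commutant S (Yop f m phi).
Local Notation M := (commutant (commutant S)).
Variable x : (H -> H) -> R[i].
Hypothesis px : predual M x.

Let commS_linear b : commutant S b -> linear b.
Proof. by move=> [[]]. Qed.

Let Mlin c u v : M u -> M v -> M (c *: u + v).
Proof. exact: commutant_lin commS_linear. Qed.

Let M0 : M 0.
Proof. exact: commutant0 commS_linear. Qed.

Let MTop K k beta : bmeas K beta -> M (Top f k beta).
Proof. exact: (Top_bicommutant nf bh mh mh' k SU SV). Qed.

Lemma M_uadj k l : M (uadj f k l).
Proof. exact: MTop (bmeas_orbit nf (- k) (- l)). Qed.

Lemma fourierE kl : fourier f x kl = x (uadj f kl.1 kl.2).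
Proof. by rewrite /fourier adjoint_u. Qed.

Lemma fourier_c0 : c0 (fourier f x).
Proof.
move=> e e0.
(* Moves the adjoint across the inner product, so that weak convergence of the [u_kl] yields that of
   their adjoints. *)
have aE kl g g' : cabs (hdot (uadj f kl.1 kl.2 g) g') = cabs (hdot g (u_ f kl.1 kl.2 g')).
  by rewrite hdotC cabsJ -(u_adjoint bf nf) hdotC cabsJ.
have := @predual_vanish R M x 0 _ _ (cofinite_filter (int * int))
  (fun kl => uadj f kl.1 kl.2) 1 px M0 (fun kl => M_uadj kl.1 kl.2) ler01 _ _ e e0.
move=> h'; apply: sub_finite_set (h' _ _).
- by move=> kl /=; rewrite fourierE (predual0 px M0) subr0 => h1; apply/negP; rewrite -leNgt.
- move=> kl g g'; rewrite subr0 mul1r; apply: le_trans (cabs_hdot _ _) _.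
  apply: le_trans (_ : hnorm g * hnorm g' <= _).
    by apply: ler_wpM2r; [exact: hnorm_ge0|exact: uadj_contraction].
  move: (hnorm g) (hnorm g') (hnorm_ge0 g) (hnorm_ge0 g') => p q p0 q0.
  by have := sqr_ge0 (p - q); have := mulr_ge0 p0 q0; rewrite !expr2; nra.
- move=> g g' e1 e10; apply: sub_finite_set (u_weak_null bf nf g g' e10).
  by apply: subsetC => kl /=; rewrite subr0 aE.
Qed.

Lemma fourier_norm : (c0_norm (fourier f x) <= predual_norm M x)%E.
Proof.
apply: ge_ereal_sup => _ [kl _ <-]; rewrite fourierE; apply: ereal_sup_ubound.
exists (uadj f kl.1 kl.2) => //; split; first exact: M_uadj.
apply: ge_ereal_sup => _ [y /= y1 <-]; rewrite lee_fin.
exact: le_trans (uadj_contraction bf nf _ _ _) y1.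
Qed.

Lemma Top_lin k (c : R[i]) K L phi psi : bmeas K phi -> bmeas L psi ->
  Top f k (fun z => c * phi z + psi z) = c *: Top f k phi + Top f k psi.
Proof.
move=> bp bq; apply/funext => y.
have lw N chi (bc : bmeas N chi) := l2_wop k (weight_Top nf k bc) (nonsing_id R) (l2_repr y).
rewrite -[RHS]/(c *: Top f k phi y + Top f k psi y) /Top /wop.
rewrite -(hmk_lin c (lw _ _ bp) (lw _ _ bq)); congr hmk.
by apply/funext => n; apply/funext => z; rewrite mulrDl mulrA.
Qed.

Hypothesis x0 : forall kl, fourier f x kl = 0.

(** The adjoints of the [u_kl] give monomials in f^k(z) rather than in z. The induction therefore
    runs over psi with beta = psi \o f^k, and psi = beta \o f^(-k) recovers the statement. *)
Lemma Top_vanish k K beta : bmeas K beta -> x (Top f k beta) = 0.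
Proof.
move=> bb.
pose P psi := x (Top f k (fun z => psi (ziter f k z))) = 0.
have bo L psi (bp : bmeas L psi) := bmeas_comp (mziter nf k) bp.
suff PP L psi : bmeas L psi -> P psi.
  have bb' := bmeas_comp (mziter nf (- k)) bb.
  rewrite -[RHS](PP _ _ bb'); congr (x (Top f k _)).
  by apply/funext => z; rewrite ziterN.
move: L psi; apply: bmeas_ind.
(* Coefficients are values at adjoints, which reverses both signs: index (-k, -l) gives V^k with
   weight f^k(z)^l. *)
- by move=> l; have := x0 (- k, - l); rewrite fourierE /uadj /= !opprK.
- move=> c K1 K2 p q bp bq pp pq; rewrite /P (Top_lin k c (bo _ _ bp) (bo _ _ bq)).
  have [lx _] := px; rewrite lx; [|exact: MTop (bo _ _ bp)|exact: MTop (bo _ _ bq)].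
  by rewrite [x _]pp [X in _ + X]pq mulr0 addr0.
move=> K1 p_ p bp_ bp pp_ pc.
have K10 : 0 <= K1 by have [_ b] := bp; exact: le_trans (cabs_ge0 _) (b (cexp 0)).
have w_ j := weight_Top nf k (bo _ _ (bp_ j)); have w := weight_Top nf k (bo _ _ bp).
apply: (predual_limit px (O := fun j => Top f k (fun z => p_ j (ziter f k z))) (B := K1 + K1)).
- exact: MTop (bo _ _ bp).
- by move=> j; exact: MTop (bo _ _ (bp_ j)).
- exact: pp_.
- exact: addr_ge0.
- move=> j g g'; apply: le_trans (cabs_hdot _ _) _; rewrite mulrA.
  apply: ler_wpM2r; first exact: hnorm_ge0.
  apply: le_trans (hnorm_add _ _) _; rewrite hnorm_opp mulrDl.
  by apply: lerD; [exact: wop_bound1 K10 (w_ j)|exact: wop_bound1 K10 w].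
move=> g g' e e0.
have g0 : 0 < hnorm g' + 1 by rewrite ltr_wpDl ?hnorm_ge0.
have e1 : 0 < e / (hnorm g' + 1) by rewrite divr_gt0.
have := wop_cvg k g w_ w _ e1; move=> h1; apply: filterS (h1 _) => [j hj|n z]; last exact: pc.
apply: le_trans (cabs_hdot _ _) _.
apply: le_trans (_ : e / (hnorm g' + 1) * (hnorm g' + 1) <= _); last by rewrite divfK ?gt_eqF.
by apply: ler_pM; [exact: hnorm_ge0|exact: hnorm_ge0|exact: hj|rewrite lerDl].
Qed.

Lemma fourier_injective a : M a -> x a = 0.
Proof.
move=> Ma; have [[la [C' ba']] aS] := Ma.
pose C := `|C'|; have C0 : 0 <= C by exact: normr_ge0.
have ba y : hnorm (a y) <= C * hnorm y.
  by apply: le_trans (ba' y) _; apply: ler_wpM2r; [exact: hnorm_ge0|exact: ler_norm].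
have aY K m phi y : bmeas K phi -> a (Yop f m phi y) = Yop f m phi (a y).
  by move=> bp; have := aS _ (SY m bp) => /(congr1 (fun w => w y)).
have bb k := bmeas_bcoeff a C0 k.
pose d k := Top f k (bcoeff a C k).
have bd k : bounded_operator (d k) := Top_bounded nf k (bb k).
have dE k m n K L phi psi : bmeas K phi -> bmeas L psi ->
    hdot (d k (site m phi)) (site n psi) =
    if m + k == n then hdot (a (site m phi)) (site n psi) else 0.
  exact: Top_coeff.
have Md k : M (d k) /\ x (d k) = 0.
  by split; [exact: MTop (bb k)|exact: Top_vanish (bb k)].
have Mf N : M (fejer d N) /\ x (fejer d N) = 0.
  have [Ms xs] : M (\sum_(r < N) \sum_(t < N) d (r%:Z - t%:Z)) /\
      x (\sum_(r < N) \sum_(t < N) d (r%:Z - t%:Z)) = 0.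
    by apply: predual_sum => // r; apply: predual_sum.
  exact: predual_scale.
have [aD _ _ _] := linearDZ la.
(* Indexing by N + 1 skips the empty mean. One [C] bounds the Fejer mean and the other one [a]. *)
apply: (predual_limit px (O := fun N => fejer d N.+1) (B := C + C)) => //.
- by move=> N; case: (Mf N.+1).
- by move=> N; case: (Mf N.+1).
- exact: addr_ge0.
- move=> N g g'; rewrite hdotBl mulrDl; apply: le_trans (cabsD _ _) _; rewrite cabsN.
  apply: lerD; first exact: (fejer_form la C0 ba bd dE).
  apply: le_trans (cabs_hdot _ _) _.
  by rewrite mulrA; apply: ler_wpM2r; [exact: hnorm_ge0|exact: ba].
- by move=> g g' e e0; exact: (fejer_weak la C0 ba bd dE).
Qed.

End Main.

Theorem theorem4p2 (R : realType) (alpha : R)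
    (alpha_gt0 : 0 < alpha) (alpha_lt : alpha < 2^-1)
    (alpha_irr : irrational alpha)
    (f : circle R -> circle R)
    (f_diffeo : smooth_diffeo f) (f_or : orientation_preserving f)
    (f_rot : has_rotation_number f (2 * alpha))
    (h : circle R -> circle R)
    (h_homeo : circle_homeo h) (h1 : h (cexp 0) = cexp 0)
    (h_conj : f = h \o rotation (2 * alpha) \o pinv setT h)
    (A : cstar_algebra R) (U V : A)
    (A_torus : noncommutative_torus (2 * alpha) U V)
    (omega : A -> R[i]) (omega_state : is_state omega)
    (omegaE : forall m n : int, omega (zpow U m * zpow V n) =
      if n == 0 then cintegral (fun z => circle_val (pinv setT h z) ^ m) else 0)
    (pi_omega : A -> Hspace R -> Hspace R)
    (gns : is_gns omega pi_omega (xi_omega R))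
    (pi_omegaU : pi_omega U = opU f h) (pi_omegaV : pi_omega V = @opV R) :
  let M := commutant (commutant (range pi_omega)) in
  forall x : (Hspace R -> Hspace R) -> R[i], predual M x ->
    [/\ c0 (fourier f x),
        (c0_norm (fourier f x) <= predual_norm M x)%E
      & (forall kl, fourier f x kl = 0) -> forall a, M a -> x a = 0].

Proof.
move=> M x px.
have [bf _ _] := f_diffeo; have [bh ch ch'] := h_homeo.
have nf := nonsing_diffeo f_diffeo h_homeo h_conj.
have mh := circle_continuous_measurable ch; have mh' := circle_continuous_measurable ch'.
have [rep _ _] := gns.
have [[uU uV _] gen _] := A_torus.
have SU : range pi_omega (opU f h) by exists U.
have SV : range pi_omega (@opV R) by exists V.
(* Explicit commutation with the two generators suffices, by norm-closed generation. *)
have SY K m phi : bmeas K phi -> commutant (range pi_omega) (Yop f m phi).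
  move=> bp; apply: (commutant_generators rep uU uV gen); first exact: Yop_bounded bp.
    by move=> y; rewrite pi_omegaU; exact: Yop_opU bp.
  by move=> y; rewrite pi_omegaV; exact: Yop_opV bp.
split.
- exact (fourier_c0 bf nf bh mh mh' SU SV px).
- exact (fourier_norm bf nf bh mh mh' SU SV x).
- by move=> x0 a; exact: (fourier_injective bf nf bh mh mh' SU SV SY px x0).
Qed.
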